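(* Let $G$ be a connected complex semisimple Lie group with Lie algebra $\mathfrak g$. Let $r_1,r_2\in\wedge^2\mathfrak g$ be classical r-matrices satisfying $$[\![r_1,r_1]\!]=[\![r_2,r_2]\!]=\varphi .$$ Then there exists a $U_h(\mathfrak g,r_1)\otimes U_h(\mathfrak g,r_2)$-invariant quantization of the two-sided action of $G$ on $G$, i.e. of the $G\times G$-manifold $G$ with the action $(g_1,g_2)\triangleright g=g_1gg_2^{-1}$.
   Context: **Quantum group.** A classical r-matrix is an element $r\in\wedge^2\mathfrak g$ whose Schouten bracket $\varphi=[\![r,r]\!]\in\wedge^3\mathfrak g$ is $\mathfrak g$-invariant. Let $\Delta$ and $\varepsilon$ be the usual comultiplication and counit of $U(\mathfrak g)$. The quantum group $U_h(\mathfrak g,r)$ is $U(\mathfrak g)[[h]]$ as a topological $\mathbb C[[h]]$-algebra, with counit the natural extension of $\varepsilon$ and comultiplication $\Delta_h(x)=F_h\Delta(x)F_h^{-1}$, where $F_h\in U(\mathfrak g)^{\otimes 2}[[h]]$ satisfies $F_h=1\otimes1+\frac h2 r+o(h)$, $(\varepsilon\otimes1)F_h=(1\otimes\varepsilon)F_h=1\otimes 1$ (i.e. is the unit), and $$(F_h\otimes1)\cdot(\Delta\otimes \mathrm{id})(F_h)=(1\otimes F_h)\cdot(\mathrm{id}\otimes\Delta)(F_h)\cdot\Phi_h .$$ Here $\Phi_h\in U(\mathfrak g)^{\otimes3}[[h]]$ is a fixed invariant element, the same for all r-matrices with the same $\varphi$, of the form $\Phi_h=1\otimes1\otimes1+h^2\varphi+o(h^2)$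 ($\varphi$ up to a normalizing scalar factor), satisfying the pentagon identity $(\mathrm{id}^{\otimes2}\otimes\Delta)(\Phi_h)\cdot(\Delta\otimes\mathrm{id}^{\otimes2})(\Phi_h)=(1\otimes\Phi_h)\cdot(\mathrm{id}\otimes\Delta\otimes\mathrm{id})(\Phi_h)\cdot(\Phi_h\otimes1)$ and the relation $\Phi_h\Phi_h^s=1$, where $\Phi_h^s=(s\otimes s\otimes s)(\Phi_h)$ and $s$ is the antipode of $U(\mathfrak g)$ ($s(x)=-x$ for $x\in\mathfrak g$). The Hopf algebra $U_h(\mathfrak g,r_1)\otimes U_h(\mathfrak g,r_2)$ is the tensor product Hopf algebra (over $\mathbb C[[h]]$, completed); it is a quantum group for the Lie algebra $\mathfrak g\oplus\mathfrak g$ of $G\times G$ with r-matrix $(r_1,r_2)$. **Invariant quantization.** Let $\mathcal A$ be the sheaf of functions (analytic, smooth or algebraic) on the manifold $G$, with the action of $U(\mathfrak g\oplus\mathfrak g)=U(\mathfrak g)\otimes U(\mathfrak g)$ induced by the $G\times G$-action, extended $\mathbb C[[h]]$-linearly to $\mathcal A[[h]]$. An invariant quantization with respect to $H=U_h(\mathfrak g,r_1)\otimes U_h(\mathfrak g,r_2)$ is an associative $\mathbb C[[h]]$-linear multiplication $m_h=\sum_{k\ge0}h^km_k$ on $\mathcal A[[h]]$, with $m_0$ the usual multiplication and $m_k$, $k>0$, bidifferential operators vanishing on constants, such that $b\,m_h(x\otimes y)=m_h(\Delta_H(b)(x\otimes y))$ for all $b\in H$, $x,y\in\mathcal A$, where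 $\Delta_H$ is the comultiplication of $H$. *)

(* Defs.v *)
From HB Require Import structures.
From mathcomp Require Import all_boot all_order all_algebra generic_quotient.
From mathcomp Require Import all_classical all_reals all_analysis.
From mathcomp Require Import complex.

Set Implicit Arguments.
Unset Strict Implicit.
Unset Printing Implicit Defensive.

Import Order.TTheory GRing.Theory Num.Theory.
Import numFieldNormedType.Exports.

Local Open Scope classical_set_scope.
Local Open Scope ring_scope.
Local Open Scope quotient_scope.

(* Needed to see that tensor products of nonzero algebras are nonzero. *)
Lemma exists_linear_form (K : fieldType) (V : lmodType K) (v : V) : v != 0 ->
  exists phi : V -> K^o, linear phi /\ phi v = 1.
Proof.
move=> v0.
pose sub (W : set V) := W 0 /\ forall a x y, W x -> W y -> W (a *: x + y).
pose good (W : set V) := W !=set0 -> sub W /\ ~ W v.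
have [F Fgood Ftot|W [Wgood Wmax]] := @Zorn_bigcup V good.
  move=> [x0 [W0 FW0 W0x0]].
  have sW W : F W -> W !=set0 -> sub W /\ ~ W v by move=> /Fgood.
  split; last by move=> [W FW Wv]; have [|_ /(_ Wv)] := sW W FW; first by exists v.
  split; first by exists W0 => //; have [|[]] := sW W0 FW0; first by exists x0.
  move=> a x y [X FX Xx] [Y FY Yy]; have [XY|YX] := Ftot X Y FX FY.
  - exists Y => //; have [|[_ h] _] := sW Y FY; first by exists y.
    by apply: h => //; exact: XY.
  - exists X => //; have [|[_ h] _] := sW X FX; first by exists x.
    by apply: h => //; exact: YX.
have [Wsub Wv] : sub W /\ ~ W v.
  apply: Wgood; apply/set0P/negP => /eqP W0.
  have : W `<` [set 0].
    by rewrite W0; split=> // /(_ 0) h; exact: h.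
  move/Wmax => /=; apply => _; split; last by move=> /eqP; rewrite (negbTE v0).
  by split=> // a x y /= -> ->; rewrite scaler0 addr0.
have W0 : W 0 by case: Wsub.
have WZ a x : W x -> W (a *: x) by move=> Wx; rewrite -[_ *: _]addr0; apply: Wsub.2.
have WD x y : W x -> W y -> W (x + y) by move=> Wx Wy; rewrite -[x]scale1r; apply: Wsub.2.
have dec x : exists c : K^o, W (x - c *: v).
  have [Wx|nWx] := pselect (W x); first by exists 0; rewrite scale0r subr0.
  pose W' := [set y | exists a, W (y - a *: x)].
  have WW' : W `<` W'.
    split; last by move=> /(_ x) h; apply/nWx/h; exists 1; rewrite scale1r subrr.
    by move=> y Wy; exists 0; rewrite scale0r subr0.
  have : ~ good W' by exact: Wmax.
  have sW' : sub W'.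
    split; first by exists 0; rewrite scale0r subr0.
    move=> a y z [b Wb] [c Wc]; exists (a * b + c).
    rewrite (_ : _ - _ = a *: (y - b *: x) + (z - c *: x)); first exact: Wsub.2.
    by rewrite scalerBr scalerA scalerDl opprD addrACA.
  have [[b Wb]|nW'v] := pselect (W' v); last by case.
  move=> _; have b0 : b != 0.
    by apply/eqP => b0; apply: Wv; move: Wb; rewrite b0 scale0r subr0.
  exists (b^-1); have := WZ (- b^-1) _ Wb.
  by rewrite scalerBr scalerA mulNr mulVf// scaleN1r opprK scaleNr addrC.
have uniq x (c d : K^o) : W (x - c *: v) -> W (x - d *: v) -> c = d.
  move=> Wc Wd; have [//|] := eqVneq c d; rewrite -subr_eq0 => cd.
  case: Wv; rewrite -[v]scale1r -(mulVf cd) -scalerA; apply: WZ.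
  rewrite (_ : _ *: v = (-1) *: (x - c *: v) + (x - d *: v)); first exact: Wsub.2.
  by rewrite scaleN1r opprB addrA subrK scalerBl.
pose phi x := sval (cid (dec x)).
have phiP x : W (x - phi x *: v) by rewrite /phi; case: cid.
exists phi; split; last by apply: (uniq v) => //; rewrite scale1r subrr.
move=> a x y; apply: (uniq (a *: x + y)) => //.
rewrite (_ : _ - _ = a *: (x - phi x *: v) + (y - phi y *: v)); first exact: Wsub.2.
by rewrite scalerBr scalerA scalerDl opprD addrACA.
Qed.

Section TensorModule.
Variables (K : fieldType).

Definition bilinear_map (M N P : lmodType K) (f : M -> N -> P) : Prop :=
  (forall n, linear (f^~ n)) /\ (forall m, linear (f m)).

Variables (M N : lmodType K).

Definition tsum (P : lmodType K) (f : M -> N -> P) (s : seq (M * N)) : P :=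
  \sum_(p <- s) f p.1 p.2.

(* Formal sums of pure tensors, identified when every bilinear map takes the
   same value on them: this is the universal property of [M (x) N]. *)
Definition tequiv (s t : seq (M * N)) : bool :=
  `[< forall (P : lmodType K) (f : M -> N -> P), bilinear_map f ->
        tsum f s = tsum f t >].

Lemma tequiv_is_equiv : equiv_class_of tequiv.
Proof.
split=> [s|s t|t s u].
- exact/asboolP.
- by apply/asboolP/asboolP => h P f bf; rewrite h.
- by move=> /asboolP h1 /asboolP h2; apply/asboolP => P f bf; rewrite h1// h2.
Qed.
Canonical tequiv_equiv := EquivRelPack tequiv_is_equiv.

Definition tensor := {eq_quot tequiv_equiv}.
HB.instance Definition _ := Choice.on tensor.
HB.instance Definition _ := EqQuotient.on tensor.

(* Value on a tensor of the linear map induced by [f]; only meaningful when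
   [f] is bilinear, in which case [tlift_pi] shows that it does not depend on
   the chosen representative. *)
Definition tlift (P : lmodType K) (f : M -> N -> P) (t : tensor) : P :=
  tsum f (repr t).

Definition tclass (s : seq (M * N)) : tensor := \pi s.
Definition pure (m : M) (n : N) : tensor := tclass [:: (m, n)].

Lemma tlift_pi (P : lmodType K) (f : M -> N -> P) s :
  bilinear_map f -> tlift f (tclass s) = tsum f s.
Proof.
move=> bf; rewrite /tlift /tclass; case: piP => t /eqmodP /asboolP h.
by rewrite h.
Qed.

Lemma tlift_pure (P : lmodType K) (f : M -> N -> P) m n :
  bilinear_map f -> tlift f (pure m n) = f m n.
Proof. by move=> bf; rewrite tlift_pi// /tsum big_seq1. Qed.

Lemma tensor_ext (x y : tensor) :
  (forall (P : lmodType K) (f : M -> N -> P), bilinear_map f ->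
     tlift f x = tlift f y) -> x = y.
Proof.
move=> h; rewrite -[x]reprK -[y]reprK; apply/eqmodP/asboolP => P f bf.
exact: h.
Qed.

Definition tzero : tensor := tclass [::].
Definition tadd (x y : tensor) : tensor := tclass (repr x ++ repr y).
Definition tscale (a : K) (x : tensor) : tensor :=
  tclass [seq (a *: p.1, p.2) | p <- repr x].
Definition topp (x : tensor) : tensor := tscale (- 1) x.

Section lift.
Variables (P : lmodType K) (f : M -> N -> P).
Hypothesis bf : bilinear_map f.

Lemma bilinear_scalel a m n : f (a *: m) n = a *: f m n.
Proof.
have := bf.1 n a m 0; rewrite !addr0 => ->.
suff -> : f 0 n = 0 by rewrite addr0.
by have := bf.1 n 1 0 0; rewrite /= scaler0 addr0 scale1r => /eqP;
  rewrite -subr_eq subrr eq_sym => /eqP.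
Qed.

Lemma tlift_zero : tlift f tzero = 0.
Proof. by rewrite tlift_pi// /tsum big_nil. Qed.
Lemma tlift_add x y : tlift f (tadd x y) = tlift f x + tlift f y.
Proof. by rewrite tlift_pi// /tsum big_cat. Qed.
Lemma tlift_scale a x : tlift f (tscale a x) = a *: tlift f x.
Proof.
rewrite tlift_pi// /tsum big_map /tlift /tsum scaler_sumr.
by apply: eq_bigr => p _; rewrite /= bilinear_scalel.
Qed.
End lift.

Let tE := (tlift_zero, tlift_add, tlift_scale).

Lemma taddA : associative tadd.
Proof. by move=> x y z; apply: tensor_ext => P f bf; rewrite !tE// addrA. Qed.
Lemma taddC : commutative tadd.
Proof. by move=> x y; apply: tensor_ext => P f bf; rewrite !tE// addrC. Qed.
Lemma tadd0 : left_id tzero tadd.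
Proof. by move=> x; apply: tensor_ext => P f bf; rewrite !tE// add0r. Qed.
Lemma taddN : left_inverse tzero topp tadd.
Proof.
by move=> x; apply: tensor_ext => P f bf; rewrite !tE// scaleN1r addNr.
Qed.
HB.instance Definition _ := GRing.isZmodule.Build tensor taddA taddC tadd0 taddN.

Lemma tscaleA a b x : tscale a (tscale b x) = tscale (a * b) x.
Proof. by apply: tensor_ext => P f bf; rewrite !tE// scalerA. Qed.
Lemma tscale1 : left_id 1 tscale.
Proof. by move=> x; apply: tensor_ext => P f bf; rewrite !tE// scale1r. Qed.
Lemma tscaleDr : right_distributive tscale +%R.
Proof.
by move=> a x y; apply: tensor_ext => P f bf; rewrite !tE// scalerDr.
Qed.
Lemma tscaleDl x : {morph tscale^~ x : a b / a + b}.
Proof.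
by move=> a b; apply: tensor_ext => P f bf; rewrite !tE// scalerDl.
Qed.
HB.instance Definition _ := GRing.Zmodule_isLmodule.Build K tensor
  tscaleA tscale1 tscaleDr tscaleDl.

Lemma tlift_linear (P : lmodType K) (f : M -> N -> P) :
  bilinear_map f -> linear (tlift f).
Proof. by move=> bf a x y; rewrite tlift_add// tlift_scale. Qed.

Lemma pure_bilinear : bilinear_map pure.
Proof.
split=> [n a m m'|m a n n']; apply: tensor_ext => P f bf;
  rewrite tlift_linear// !tlift_pure//.
- exact: bf.1.
- exact: bf.2.
Qed.

Lemma tlift_tsum (P : lmodType K) (f : M -> N -> P) s :
  bilinear_map f -> tlift f (tsum pure s) = tsum f s.
Proof.
move=> bf; elim: s => [|p s ih]; first by rewrite /tsum !big_nil tlift_zero.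
by rewrite /tsum !big_cons tlift_add// -/(tsum _ _) ih tlift_pure.
Qed.

Lemma tensor_pureE (x : tensor) : x = \sum_(p <- repr x) pure p.1 p.2.
Proof.
by apply: tensor_ext => P f bf; rewrite -/(tsum pure _) tlift_tsum.
Qed.

End TensorModule.

Arguments tensor {K} (M N)%_type_scope.
Notation "M ⊗ N" := (tensor M N) (at level 40, left associativity) : type_scope.
Notation "x ⊗ y" := (pure x y) (at level 40, left associativity) : ring_scope.

Section TensorMaps.
Variable K : fieldType.

Definition tmap (M N M' N' : lmodType K) (f : M -> M') (g : N -> N') :
    M ⊗ N -> M' ⊗ N' :=
  tlift (fun m n => f m ⊗ g n).

Definition tflip (M N : lmodType K) : M ⊗ N -> N ⊗ M :=
  tlift (fun m n => n ⊗ m).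

Definition tassoc (M N P : lmodType K) : M ⊗ (N ⊗ P) -> (M ⊗ N) ⊗ P :=
  tlift (fun m np => tlift (fun n p => (m ⊗ n) ⊗ p) np).

Definition tswap23 (M N P Q : lmodType K) :
    (M ⊗ N) ⊗ (P ⊗ Q) -> (M ⊗ P) ⊗ (N ⊗ Q) :=
  tlift (fun mn pq =>
    tlift (fun m n => tlift (fun p q => (m ⊗ p) ⊗ (n ⊗ q)) pq) mn).

End TensorMaps.

Section TensorAlgebra.
Variables (K : fieldType) (A B : algType K).
Implicit Types x y z : A ⊗ B.

Definition tone : A ⊗ B := 1 ⊗ 1.
Definition tmul x y : A ⊗ B :=
  tlift (fun a b => tlift (fun a' b' => (a * a') ⊗ (b * b')) y) x.

Lemma tmul_inner a b :
  bilinear_map (fun (a' : A) (b' : B) => (a * a') ⊗ (b * b')).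
Proof.
split=> [b' c u v|a' c u v] /=; rewrite mulrDr -scalerAr.
- exact: (@pure_bilinear K A B).1.
- exact: (@pure_bilinear K A B).2.
Qed.

Lemma tmul_outer y : bilinear_map (fun (a : A) (b : B) =>
  tlift (fun a' b' => (a * a') ⊗ (b * b')) y).
Proof.
split=> [b c u v|a c u v] /=; rewrite /tlift /tsum scaler_sumr -big_split /=;
  apply: eq_bigr => p _; rewrite mulrDl -scalerAl.
- exact: (@pure_bilinear K A B).1.
- exact: (@pure_bilinear K A B).2.
Qed.

Lemma tmul_linl y : linear (tmul^~ y).
Proof. exact/tlift_linear/tmul_outer. Qed.

Lemma tmul_linr x : linear (tmul x).
Proof.
have E y : tmul x y = \sum_(p <- repr x)
    tlift (fun a' b' => (p.1 * a') ⊗ (p.2 * b')) y by [].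
move=> c u v; rewrite !E scaler_sumr -big_split /=.
by apply: eq_bigr => p _; rewrite (tlift_linear (tmul_inner _ _)).
Qed.

Lemma tmul_pure a b a' b' :
  tmul (a ⊗ b) (a' ⊗ b') = (a * a') ⊗ (b * b').
Proof.
by rewrite /tmul (tlift_pure _ _ (tmul_outer _)) (tlift_pure _ _ (tmul_inner _ _)).
Qed.

Lemma tmulDl : left_distributive tmul +%R.
Proof. by move=> x y z; have := tmul_linl z 1 x y; rewrite !scale1r. Qed.
Lemma tmulDr : right_distributive tmul +%R.
Proof. by move=> x y z; have := tmul_linr x 1 y z; rewrite !scale1r. Qed.
Lemma tmul0 x : tmul x 0 = 0.
Proof. by apply: (@addrI _ (tmul x 0)); rewrite -tmulDr !addr0. Qed.
Lemma t0mul x : tmul 0 x = 0.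
Proof. by apply: (@addrI _ (tmul 0 x)); rewrite -tmulDl !addr0. Qed.

Lemma tensor_ind (Q : A ⊗ B -> Prop) :
  Q 0 -> (forall a b x, Q x -> Q (a ⊗ b + x)) -> forall x, Q x.
Proof.
move=> Q0 QD x; rewrite [x]tensor_pureE; elim: (repr x) => [|p s ih].
- by rewrite big_nil.
- by rewrite big_cons; apply: QD.
Qed.

Lemma tmulA : associative tmul.
Proof.
move=> x y z; elim/tensor_ind: x y z => [|a b x ihx] y z; first by rewrite !t0mul.
rewrite !tmulDl ihx; congr (_ + _).
elim/tensor_ind: y {ihx} z => [|c d y ihy] z; first by rewrite tmul0 !t0mul tmul0.
rewrite tmulDl !tmulDr tmulDl ihy; congr (_ + _).
elim/tensor_ind: z => [|e f z ihz]; first by rewrite !tmul0.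
by rewrite !tmulDr ihz !tmul_pure !mulrA.
Qed.
Lemma tmul1 : right_id tone tmul.
Proof.
move=> x; elim/tensor_ind: x => [|a b x ih]; first by rewrite t0mul.
by rewrite tmulDl ih tmul_pure !mulr1.
Qed.
Lemma t1mul : left_id tone tmul.
Proof.
move=> x; elim/tensor_ind: x => [|a b x ih]; first by rewrite tmul0.
by rewrite tmulDr ih tmul_pure !mul1r.
Qed.

Lemma tone_neq0 : tone != 0.
Proof.
have [phi [lphi phi1]] := exists_linear_form (oner_neq0 A).
have bf : bilinear_map (fun (a : A) (b : B) => phi a *: b).
  split=> [b c u v|a c u v] /=; first by rewrite lphi scalerDl scalerA.
  by rewrite scalerDr !scalerA mulrC.
apply/eqP => /(congr1 (tlift (fun (a : A) (b : B) => phi a *: b))).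
rewrite tlift_pure// phi1 scale1r [0 in RHS]/(tzero A B) tlift_zero//.
by apply/eqP/oner_neq0.
Qed.

HB.instance Definition _ := GRing.Zmodule_isNzRing.Build (A ⊗ B)%type
  tmulA t1mul tmul1 tmulDl tmulDr tone_neq0.

Lemma tmul_scalel (a : K) x y : a *: (x * y) = (a *: x) * y.
Proof.
by have := tmul_linl y a x 0; rewrite /= t0mul !addr0.
Qed.
Lemma tmul_scaler (a : K) x y : a *: (x * y) = x * (a *: y).
Proof.
by have := tmul_linr x a y 0; rewrite /= tmul0 !addr0.
Qed.
HB.instance Definition _ :=
  GRing.Lmodule_isLalgebra.Build K (A ⊗ B)%type tmul_scalel.
HB.instance Definition _ :=
  GRing.Lalgebra_isAlgebra.Build K (A ⊗ B)%type tmul_scaler.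

End TensorAlgebra.

Section Enveloping.
Variables (K : fieldType) (g : lmodType K) (br : g -> g -> g).

Definition lie_map (A : algType K) (f : g -> A) : Prop :=
  linear f /\ forall x y, f (br x y) = f x * f y - f y * f x.

Definition weval (A : algType K) (f : g -> A) (s : seq (K * seq g)) : A :=
  \sum_(p <- s) p.1 *: \prod_(x <- p.2) f x.

(* Noncommutative polynomials in elements of [g], identified when they take
   the same value under every map of [g] to an associative algebra that turns
   the bracket into the commutator: this is the universal property of U(g). *)
Definition wequiv (s t : seq (K * seq g)) : bool :=
  `[< forall (A : algType K) (f : g -> A), lie_map f ->
        weval f s = weval f t >].

Lemma wequiv_is_equiv : equiv_class_of wequiv.
Proof.
split=> [s|s t|t s u].
- exact/asboolP.
- by apply/asboolP/asboolP => h P f bf; rewrite h.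
- by move=> /asboolP h1 /asboolP h2; apply/asboolP => P f bf; rewrite h1// h2.
Qed.
Canonical wequiv_equiv := EquivRelPack wequiv_is_equiv.

Definition uea := {eq_quot wequiv_equiv}.
HB.instance Definition _ := Choice.on uea.
HB.instance Definition _ := EqQuotient.on uea.

(* The algebra map extending [f]; meaningful when [f] is a [lie_map]. *)
Definition ulift (A : algType K) (f : g -> A) (u : uea) : A :=
  weval f (repr u).

Definition uclass (s : seq (K * seq g)) : uea := \pi s.
Definition uinj (x : g) : uea := uclass [:: (1, [:: x])].

Lemma ulift_pi (A : algType K) (f : g -> A) s :
  lie_map f -> ulift f (uclass s) = weval f s.
Proof.
move=> hf; rewrite /ulift /uclass; case: piP => t /eqmodP /asboolP h.
by rewrite h.
Qed.

Lemma uea_ext (u v : uea) :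
  (forall (A : algType K) (f : g -> A), lie_map f -> ulift f u = ulift f v) ->
  u = v.
Proof.
move=> h; rewrite -[u]reprK -[v]reprK; apply/eqmodP/asboolP => A f hf.
exact: h.
Qed.

Definition uzero : uea := uclass [::].
Definition uone : uea := uclass [:: (1, [::])].
Definition uadd (u v : uea) : uea := uclass (repr u ++ repr v).
Definition uscale (a : K) (u : uea) : uea :=
  uclass [seq (a * p.1, p.2) | p <- repr u].
Definition uopp (u : uea) : uea := uscale (- 1) u.
Definition umul (u v : uea) : uea :=
  uclass [seq (p.1 * q.1, p.2 ++ q.2) | p <- repr u, q <- repr v].

Section lift.
Variables (A : algType K) (f : g -> A).
Hypothesis hf : lie_map f.

Lemma ulift_inj x : ulift f (uinj x) = f x.
Proof. by rewrite ulift_pi// /weval !big_seq1 scale1r. Qed.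
Lemma ulift_zero : ulift f uzero = 0.
Proof. by rewrite ulift_pi// /weval big_nil. Qed.
Lemma ulift_one : ulift f uone = 1.
Proof. by rewrite ulift_pi// /weval big_seq1 big_nil scale1r. Qed.
Lemma ulift_add u v : ulift f (uadd u v) = ulift f u + ulift f v.
Proof. by rewrite ulift_pi// /weval big_cat. Qed.
Lemma ulift_scale a u : ulift f (uscale a u) = a *: ulift f u.
Proof.
rewrite ulift_pi// /weval big_map /ulift /weval scaler_sumr.
by apply: eq_bigr => p _; rewrite /= scalerA.
Qed.
Lemma ulift_mul u v : ulift f (umul u v) = ulift f u * ulift f v.
Proof.
rewrite ulift_pi// /weval big_allpairs_dep /ulift /weval mulr_suml.
apply: eq_bigr => p _; rewrite mulr_sumr; apply: eq_bigr => q _.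
by rewrite /= big_cat /= -scalerAl -scalerAr scalerA.
Qed.
End lift.

Let uE := (ulift_zero, ulift_one, ulift_add, ulift_scale, ulift_mul).

Lemma uaddA : associative uadd.
Proof. by move=> x y z; apply: uea_ext => A f hf; rewrite !uE// addrA. Qed.
Lemma uaddC : commutative uadd.
Proof. by move=> x y; apply: uea_ext => A f hf; rewrite !uE// addrC. Qed.
Lemma uadd0 : left_id uzero uadd.
Proof. by move=> x; apply: uea_ext => A f hf; rewrite !uE// add0r. Qed.
Lemma uaddN : left_inverse uzero uopp uadd.
Proof.
by move=> x; apply: uea_ext => A f hf; rewrite !uE// scaleN1r addNr.
Qed.
HB.instance Definition _ := GRing.isZmodule.Build uea uaddA uaddC uadd0 uaddN.

Lemma umulA : associative umul.
Proof. by move=> x y z; apply: uea_ext => A f hf; rewrite !uE// mulrA. Qed.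
Lemma umul1 : right_id uone umul.
Proof. by move=> x; apply: uea_ext => A f hf; rewrite !uE// mulr1. Qed.
Lemma u1mul : left_id uone umul.
Proof. by move=> x; apply: uea_ext => A f hf; rewrite !uE// mul1r. Qed.
Lemma umulDl : left_distributive umul +%R.
Proof. by move=> x y z; apply: uea_ext => A f hf; rewrite !uE// mulrDl. Qed.
Lemma umulDr : right_distributive umul +%R.
Proof. by move=> x y z; apply: uea_ext => A f hf; rewrite !uE// mulrDr. Qed.
Lemma uone_neq0 : uone != 0.
Proof.
have hf : lie_map (fun _ : g => 0 : K^o).
  by split=> [a x y|x y]; rewrite ?scaler0 ?addr0// mul0r subrr.
apply/eqP => h; have := congr1 (ulift (fun _ : g => 0 : K^o)) (h : uone = uzero).
by rewrite !uE// => /eqP; rewrite oner_eq0.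
Qed.
HB.instance Definition _ := GRing.Zmodule_isNzRing.Build uea
  umulA u1mul umul1 umulDl umulDr uone_neq0.

Lemma uscaleA a b x : uscale a (uscale b x) = uscale (a * b) x.
Proof. by apply: uea_ext => A f hf; rewrite !uE// scalerA. Qed.
Lemma uscale1 : left_id 1 uscale.
Proof. by move=> x; apply: uea_ext => A f hf; rewrite !uE// scale1r. Qed.
Lemma uscaleDr : right_distributive uscale +%R.
Proof. by move=> a x y; apply: uea_ext => A f hf; rewrite !uE// scalerDr. Qed.
Lemma uscaleDl x : {morph uscale^~ x : a b / a + b}.
Proof. by move=> a b; apply: uea_ext => A f hf; rewrite !uE// scalerDl. Qed.
HB.instance Definition _ := GRing.Zmodule_isLmodule.Build K uea
  uscaleA uscale1 uscaleDr uscaleDl.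

Lemma uscaleAl (a : K) (x y : uea) : a *: (x * y) = (a *: x) * y.
Proof. by apply: uea_ext => A f hf; rewrite !uE// scalerAl. Qed.
Lemma uscaleAr (a : K) (x y : uea) : a *: (x * y) = x * (a *: y).
Proof. by apply: uea_ext => A f hf; rewrite !uE// scalerAr. Qed.
HB.instance Definition _ := GRing.Lmodule_isLalgebra.Build K uea uscaleAl.
HB.instance Definition _ := GRing.Lalgebra_isAlgebra.Build K uea uscaleAr.

Lemma uinj_lie_map : lie_map uinj.
Proof.
split=> [a x y|x y]; apply: uea_ext => A f hf.
- have -> : a *: uinj x + uinj y = uadd (uscale a (uinj x)) (uinj y) by [].
  by rewrite !uE// !ulift_inj// hf.1.
- have -> : uinj x * uinj y - uinj y * uinj x =
    uadd (umul (uinj x) (uinj y)) (uopp (umul (uinj y) (uinj x))) by [].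
  by rewrite !uE// !ulift_inj// hf.2 scaleN1r.
Qed.

Definition counit : uea -> K^o := ulift (fun _ : g => 0 : K^o).
Definition comul : uea -> uea ⊗ uea := ulift (fun x => uinj x ⊗ 1 + 1 ⊗ uinj x).
Definition antipode (u : uea) : uea :=
  \sum_(p <- repr u) p.1 *: \prod_(x <- rev p.2) (- uinj x).

(* Action of U(g) on [E] induced by [rho : g -> E -> E]; meaningful on a
   subspace of [E] on which [rho] is a representation of [g]. *)
Definition uact (E : lmodType K) (rho : g -> E -> E) (u : uea) (e : E) : E :=
  \sum_(p <- repr u) p.1 *: foldr rho e p.2.

End Enveloping.

(* A series [sum_n h^n a_n] with coefficients in [A] is the sequence
   [a : nat -> A]. *)

Definition hcst (A : zmodType) (a : A) : nat -> A :=
  fun n => if n is 0%N then a else 0.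

Definition hconv (A B : Type) (C : zmodType) (op : A -> B -> C)
    (a : nat -> A) (b : nat -> B) : nat -> C :=
  fun n => \sum_(i < n.+1) op (a i) (b (n - i)%N).

Definition hmul (A : pzRingType) : (nat -> A) -> (nat -> A) -> nat -> A :=
  hconv *%R.

(* [h]-linear extension to series of a map with values in series. *)
Definition hext (A : Type) (B : zmodType) (D : A -> nat -> B)
    (a : nat -> A) : nat -> B :=
  fun n => \sum_(i < n.+1) D (a i) (n - i)%N.

Section Rmatrix.
Variables (K : fieldType) (g : lmodType K) (br : g -> g -> g).

Definition in_wedge2 (r : g ⊗ g) : Prop := tflip r = - r.

(* [r12, r13] + [r12, r23] + [r13, r23] *)
Definition schouten (r : g ⊗ g) : g ⊗ g ⊗ g :=
  tlift (fun a b => tlift (fun c d =>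
    (br a c ⊗ b) ⊗ d + (a ⊗ br b c) ⊗ d + (a ⊗ c) ⊗ br b d) r) r.

Definition ad3 (x : g) (t : g ⊗ g ⊗ g) : g ⊗ g ⊗ g :=
  tlift (fun ab c => tlift (fun a b =>
    (br x a ⊗ b) ⊗ c + (a ⊗ br x b) ⊗ c + (a ⊗ b) ⊗ br x c) ab) t.

Definition classical_rmatrix (r : g ⊗ g) : Prop :=
  in_wedge2 r /\ forall x, ad3 x (schouten r) = 0.

End Rmatrix.

Section Quantum.
Variables (K : fieldType) (g : lmodType K) (br : g -> g -> g).
Local Notation U := (uea br).
Local Notation U2 := (U ⊗ U)%type.
Local Notation U3 := (U2 ⊗ U)%type.
Local Notation U4 := (U3 ⊗ U)%type.
Local Notation eps := (@counit K g br).
Local Notation Delta := (@comul K g br).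
Local Notation s := (@antipode K g br).

(* [1 (x) t] and [id (x) Delta], with values reassociated to the left. *)
Definition one_tensor (A : algType K) (t : A ⊗ U) : U ⊗ A ⊗ U :=
  tassoc (1 ⊗ t).
Definition id_comul (A : algType K) (t : A ⊗ U) : A ⊗ U ⊗ U :=
  tassoc (tmap id Delta t).

Definition one_tensor3 (t : U3) : U4 := tmap (@one_tensor U) id t.

Record is_associator (phi : g ⊗ g ⊗ g) (Phi : nat -> U3) : Prop := {
  assoc_0 : Phi 0%N = 1;
  assoc_1 : Phi 1%N = 0;
  assoc_2 : exists2 c : K, c != 0 &
    Phi 2%N = c *: tmap (tmap (@uinj K g br) (@uinj K g br)) (@uinj K g br) phi;
  assoc_invariant : forall (x : g) (k : nat),
    let x3 := tmap Delta id (Delta (uinj br x)) in x3 * Phi k = Phi k * x3;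
  assoc_pentagon :
    hmul (@id_comul U2 \o Phi) (tmap (tmap Delta id) id \o Phi) =
    hmul (hmul (one_tensor3 \o Phi) (tmap (@id_comul U) id \o Phi))
         ((fun t => t ⊗ 1) \o Phi);
  assoc_antipode : hmul Phi (tmap (tmap s s) s \o Phi) = hcst 1
}.

Record quantum_group (Phi : nat -> U3) (r : g ⊗ g) := {
  twist : nat -> U2;
  twist_inv : nat -> U2;
  twistK : hmul twist twist_inv = hcst 1;
  twist_invK : hmul twist_inv twist = hcst 1;
  twist_0 : twist 0%N = 1;
  twist_1 : twist 1%N = 2^-1 *: tmap (@uinj K g br) (@uinj K g br) r;
  twist_counitl : tlift (fun u v => eps u *: v) \o twist = hcst 1;
  twist_counitr : tlift (fun u v => eps v *: u) \o twist = hcst 1;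
  twist_cocycle :
    hmul ((fun t => t ⊗ 1) \o twist) (tmap Delta id \o twist) =
    hmul (hmul (@one_tensor U \o twist) (@id_comul U \o twist)) Phi
}.

(* Comultiplication of [U_h(g, r)] on elements of [U(g)]. *)
Definition qcomul (Phi : nat -> U3) (r : g ⊗ g) (Q : quantum_group Phi r)
    (u : U) : nat -> U2 :=
  hmul (hmul (twist Q) (hcst (Delta u))) (twist_inv Q).

(* Comultiplication of the completed tensor product of U_h(g, r1) and
   U_h(g, r2), whose underlying algebra is [U2[[h]]]. *)
Definition qcomul2 (Phi : nat -> U3) (r1 r2 : g ⊗ g)
    (Q1 : quantum_group Phi r1) (Q2 : quantum_group Phi r2)
    (b : nat -> U2) : nat -> (U2 ⊗ U2)%type :=
  hext (fun (w : U2) n =>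
    tlift (fun u v =>
      hconv (fun p q => tswap23 (p ⊗ q)) (qcomul Q1 u) (qcomul Q2 v) n) w) b.

End Quantum.

#[non_forgetful_inheritance]
HB.instance Definition _ (R : rcfType) := NormedModule.copy R[i] R[i]^o.

Section Smoothness.
Variables (K : numFieldType) (V W : normedModType K).

(* For [K = R[i]], class C^oo is the same as holomorphic (analytic). *)
Fixpoint Ck (k : nat) (D : set V) (f : V -> W) : Prop :=
  match k with
  | 0%N => forall x, D x -> {for x, continuous f}
  | k'.+1 => (forall x, D x -> differentiable f x) /\
             (forall v, Ck k' D (fun x => 'd f x v))
  end.

Definition Coo (D : set V) (f : V -> W) : Prop := forall k, Ck k D f.

End Smoothness.

HB.structure Definition TopGroup := {G of Topological G & Group G}.

Section LieGroups.
Variable R : realType.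
Local Notation C := R[i].

Record chart (G : topologicalType) (n : nat) := Chart {
  cdom : set G;
  cfun : G -> 'rV[C]_n;
  cinv : 'rV[C]_n -> G;
  cdom_open : open cdom;
  cimg_open : open (cfun @` cdom);
  cfunK : forall x, cdom x -> cinv (cfun x) = x;
  cfun_continuous : forall x, cdom x -> {for x, continuous cfun};
  cinv_continuous : forall z, (cfun @` cdom) z -> {for z, continuous cinv}
}.

Definition cimg (G : topologicalType) n (c : chart G n) : set 'rV[C]_n :=
  cfun c @` cdom c.

Record complexLieGroup := {
  lie_sort :> TopGroup.type;
  lie_dim : nat;
  lie_atlas : set (chart lie_sort lie_dim);
  lie_hausdorff : hausdorff_space lie_sort;
  lie_mul_continuous : continuous (fun p : lie_sort * lie_sort => (p.1 * p.2)%g);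
  lie_inv_continuous : continuous (fun x : lie_sort => (x^-1)%g);
  lie_cover : forall x, exists c, lie_atlas c /\ cdom c x;
  lie_compat : forall c c', lie_atlas c -> lie_atlas c' ->
    Coo (cfun c @` (cdom c `&` cdom c')) (cfun c' \o cinv c);
  lie_mul_holomorphic : forall c1 c2 c3,
    lie_atlas c1 -> lie_atlas c2 -> lie_atlas c3 ->
    Coo [set p : 'rV[C]_lie_dim * 'rV[C]_lie_dim | [/\ cimg c1 p.1, cimg c2 p.2 &
          cdom c3 (cinv c1 p.1 * cinv c2 p.2)%g]]
      (fun p => cfun c3 (cinv c1 p.1 * cinv c2 p.2)%g);
  lie_inv_holomorphic : forall c c', lie_atlas c -> lie_atlas c' ->
    Coo [set z | cimg c z /\ cdom c' (cinv c z)^-1%g]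
      (fun z => cfun c' (cinv c z)^-1%g)
}.

Variable G : complexLieGroup.
Local Notation n := (lie_dim G).

Definition unit_chart : chart G n := sval (cid (lie_cover (1%g : G))).

(* The Lie algebra, as the tangent space at the unit, identified with [C^n]
   through [unit_chart]. *)
Definition lie_algebra := 'rV[C]_n.

(* [d/dt F(t)] at [t = 0], for complex-valued [F] of a real variable. *)
Definition derive0 (F : R -> C) : C :=
  (derive1 (fun t => complex.Re (F t)) 0 +i* derive1 (fun t => complex.Im (F t)) 0)%C.

(* Derivative at the unit along the holomorphic tangent vector [X]; on a
   function that is merely smooth this is the (1,0)-part of the derivative,
   so that it is complex linear in [X]. *)
Definition tangent_derive (X : lie_algebra) (f : G -> C) : C :=
  let z := cfun unit_chart 1%g in
  let D (v : 'rV[C]_n) :=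
    derive0 (fun t : R => f (cinv unit_chart (z + t%:C%C *: v))) in
  2^-1 * (D X - 'i * D ('i *: X)).

(* The left (resp. right) invariant vector field with value [X] at the unit. *)
Definition left_invariant (X : lie_algebra) (f : G -> C) : G -> C :=
  fun a => tangent_derive X (fun b => f (a * b)%g).
Definition right_invariant (X : lie_algebra) (f : G -> C) : G -> C :=
  fun a => tangent_derive X (fun b => f (b * a)%g).

(* Value at the unit, in coordinates, of the commutator of left invariant
   vector fields. *)
Definition lie_bracket (X Y : lie_algebra) : lie_algebra :=
  \row_j (let x j := fun a : G => cfun unit_chart a ord0 j in
    left_invariant X (left_invariant Y (x j)) 1%g
    - left_invariant Y (left_invariant X (x j)) 1%g).

Definition lie_ideal (I : {vspace 'rV[C]_n}) : Prop :=
  forall X Y, Y \in I -> lie_bracket X Y \in I.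

Definition derived (I : {vspace 'rV[C]_n}) : {vspace 'rV[C]_n} :=
  <<[seq lie_bracket X Y | X <- vbasis I, Y <- vbasis I]>>%VS.

Definition semisimple : Prop :=
  forall I : {vspace 'rV[C]_n}, lie_ideal I ->
    (exists k, iter k derived I = 0%VS) -> I = 0%VS.

(* A section over [V] is represented by its extension by zero to [G]. *)

Inductive function_class := Analytic | Smooth | Algebraic.

Definition holomorphic_on (V : set G) (f : G -> C) : Prop :=
  forall c, lie_atlas c ->
    Coo (cfun c @` (cdom c `&` V)) (f \o cinv c).

Definition of_real_coords (p : 'rV[R]_n * 'rV[R]_n) : 'rV[C]_n :=
  \row_j (p.1 ord0 j +i* p.2 ord0 j)%C.

Definition smooth_on (V : set G) (f : G -> C) : Prop :=
  forall c, lie_atlas c ->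
    let D := [set p | (cfun c @` (cdom c `&` V)) (of_real_coords p)] in
    Coo D (fun p => complex.Re (f (cinv c (of_real_coords p)))) /\
    Coo D (fun p => complex.Im (f (cinv c (of_real_coords p)))).

(* A connected complex semisimple Lie group has a unique structure of affine
   algebraic group, whose coordinate ring is generated by the matrix
   coefficients of its finite-dimensional holomorphic representations. *)
Definition holomorphic_repr N (rho : G -> 'M[C]_N) : Prop :=
  [/\ rho 1%g = 1%:M,
      forall a b, rho (a * b)%g = rho a *m rho b &
      forall i j, holomorphic_on setT (fun a => rho a i j)].

Inductive regular : (G -> C) -> Prop :=
| regular_coef N (rho : G -> 'M[C]_N) i j :
    holomorphic_repr rho -> regular (fun a => rho a i j)
| regular_cst z : regular (fun=> z)
| regular_add p q : regular p -> regular q -> regular (fun a => p a + q a)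
| regular_mul p q : regular p -> regular q -> regular (fun a => p a * q a).

Definition zariski_open (V : set G) : Prop :=
  forall a, V a ->
    exists q, [/\ regular q, q a != 0 & forall b, q b != 0 -> V b].

Definition regular_on (V : set G) (f : G -> C) : Prop :=
  forall a, V a -> exists p q, [/\ regular p, regular q, q a != 0 &
    forall b, V b -> q b != 0 -> f b = p b / q b].

Definition cls_open (cls : function_class) (V : set G) : Prop :=
  match cls with
  | Analytic | Smooth => open V
  | Algebraic => zariski_open V
  end.

Definition section_on (cls : function_class) (V : set G) (f : G -> C) : Prop :=
  (forall a, ~ V a -> f a = 0) /\
  match cls with
  | Analytic => holomorphic_on V f
  | Smooth => smooth_on V f
  | Algebraic => regular_on V f
  end.

Definition restr (V : set G) (f : G -> C) : G -> C := patch (fun=> 0) V f.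

Definition fmul (f k : G -> C) : G -> C := fun a => f a * k a.

(* [(g1, g2)] acts on functions by [f |-> (a |-> f (g1^-1 * a * g2))]. *)

Local Notation U := (uea lie_bracket).
Local Notation H := (U ⊗ U)%type.

Definition act_left (V : set G) (X : lie_algebra) (f : G -> C) : G -> C :=
  restr V (fun a => - right_invariant X f a).
Definition act_right (V : set G) (Y : lie_algebra) (f : G -> C) : G -> C :=
  restr V (left_invariant Y f).

Definition act (V : set G) (b : H) (f : G -> C) : G -> C :=
  tlift (fun u v => uact (act_left V) u (uact (act_right V) v f)) b.

(* Differential operators of order at most [k] on the algebra [S] of sections,
   in the sense of Grothendieck. *)
Fixpoint diffop (S : (G -> C) -> Prop) (k : nat) (D : (G -> C) -> G -> C) :
    Prop :=
  match k with
  | 0%N => forall a f, S a -> S f -> D (fmul a f) = fmul a (D f)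
  | k'.+1 => forall a, S a -> diffop S k' (fun f => D (fmul a f) - fmul a (D f))
  end.

Record bilinear_sheaf_op (cls : function_class)
    (B : set G -> (G -> C) -> (G -> C) -> G -> C) : Prop := {
  bop_section : forall V f k, cls_open cls V ->
    section_on cls V f -> section_on cls V k -> section_on cls V (B V f k);
  bop_restr : forall V W f k, cls_open cls V -> cls_open cls W -> W `<=` V ->
    section_on cls V f -> section_on cls V k ->
    restr W (B V f k) = B W (restr W f) (restr W k);
  bop_linearl : forall V f f' k (z : C), cls_open cls V ->
    section_on cls V f -> section_on cls V f' -> section_on cls V k ->
    B V (z *: f + f') k = z *: B V f k + B V f' k;
  bop_linearr : forall V f k k' (z : C), cls_open cls V ->
    section_on cls V f -> section_on cls V k -> section_on cls V k' ->
    B V f (z *: k + k') = z *: B V f k + B V f k'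
}.

Definition bidifferential (cls : function_class)
    (B : set G -> (G -> C) -> (G -> C) -> G -> C) : Prop :=
  bilinear_sheaf_op cls B /\
  exists N, forall V, cls_open cls V -> forall f, section_on cls V f ->
    diffop (section_on cls V) N (B V f) /\
    diffop (section_on cls V) N (fun k => B V k f).

(* [C[[h]]]-bilinear extension of [sum_k h^k m_k] to series. *)
Definition star (m : nat -> (G -> C) -> (G -> C) -> G -> C)
    (x y : nat -> G -> C) : nat -> G -> C :=
  fun N => \sum_(k < N.+1) hconv (m k) x y (N - k)%N.

Record invariant_quantization (cls : function_class)
    (Phi : nat -> (H ⊗ U)%type) (r1 r2 : lie_algebra ⊗ lie_algebra)
    (Q1 : quantum_group Phi r1) (Q2 : quantum_group Phi r2)
    (m : nat -> set G -> (G -> C) -> (G -> C) -> G -> C) : Prop := {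
  iq_0 : forall V f k, cls_open cls V ->
    section_on cls V f -> section_on cls V k -> m 0%N V f k = fmul f k;
  iq_bidifferential : forall i, (0 < i)%N -> bidifferential cls (m i);
  iq_constants : forall i V f (z : C), (0 < i)%N -> cls_open cls V ->
    section_on cls V f ->
    m i V (restr V (fun=> z)) f = 0 /\ m i V f (restr V (fun=> z)) = 0;
  iq_assoc : forall V (x y z : nat -> G -> C), cls_open cls V ->
    (forall i, section_on cls V (x i)) ->
    (forall i, section_on cls V (y i)) ->
    (forall i, section_on cls V (z i)) ->
    star (m^~ V) (star (m^~ V) x y) z = star (m^~ V) x (star (m^~ V) y z);
  (* For [T] in [H (x) H], the value of [m_j] on [T (x (x) y)] is computed by
     evaluating [m_j (b1 x) (b2 y)] on [T], linearly in [b1 (x) b2]. *)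
  iq_invariant : forall V (b : nat -> H) (x y : G -> C), cls_open cls V ->
    section_on cls V x -> section_on cls V y ->
    hconv (act V) b (fun j => m j V x y) =
    hconv (fun (T : H ⊗ H) j =>
        tlift (fun b1 b2 => m j V (act V b1 x) (act V b2 y)) T)
      (qcomul2 Q1 Q2 b) id
}.

End LieGroups.

(* Main.v *)
From HB Require Import structures.
Require Import Defs.
From mathcomp Require Import all_boot all_order all_algebra generic_quotient perm.
From mathcomp Require Import all_classical all_reals all_analysis.
From mathcomp Require Import complex.
From mathcomp Require Import ring.

(** Consider the two commuting infinitesimal actions of [g] on functions on [G]:
    [L], given by the right invariant fields with the opposite sign, and [R],
    given by the left invariant fields. Both act by derivations of the usual
    multiplication. Let [F1] and [F2] be the twists of the two quantum groups.
    The quantization is the usual multiplication twisted on both sides,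

      [m_h (f ⊗ k) = sum (L_p' R_q' f) (L_p'' R_q'' k)],

    where [p' ⊗ p''] runs over [F1^-1] and [q' ⊗ q''] over [F2^-1] ([starm]).

    Formal properties. As [L] and [R] act by derivations, an element [u] acts on
    a product through [Delta u] ([P2_comul]); together with
    [F^-1 Delta_h(u) = Delta(u) F^-1] this is the invariance of [m_h]
    ([starm_invariant]). Constants are annihilated by the fields and the twists
    are normalized by the counit, so that [m_h] is undeformed on constants
    ([starm_cst]).

    Associativity ([starm_assoc]). The two iterated products of three functions
    apply to them the inverses of the two sides of the cocycle equations, through
    [L] for [F1] and through [R] for [F2]. They differ only by a factor [Phi] on
    the left, acting both through [L] and through [R]; it is the same [Phi] for
    both twists. This double action of [Phi] becomes trivial after
    multiplication. Indeed at a point [a] the field [L_X] takes the value of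
    [- R_Y] with [Y = Ad_(a^-1) X] ([right_leftE]). Hence, at [a], elements acting
    through [L] can be moved to [R], after applying [Ad_(a^-1)] and the antipode,
    and the double action of [Phi] becomes the action through [R] of
    [(s ⊗ s ⊗ s)(Ad_(a^-1) Phi) Phi]. Now [Phi] is invariant under [g]; as [G] is
    connected it is invariant under [Ad] ([Ad_invariant]), and what remains is
    [Phi^s Phi = 1] ([Phi_series]).

    Analysis enters through the facts on fields used above. Left and right fields
    commute because they differentiate [f (z w)] in [z] and in [w]
    ([ifield_comm], from the symmetry of second derivatives); the commutator of
    invariant fields is governed by the Lie bracket ([left_bracket],
    [right_bracket]); and [Ad_(a^-1) X] is holomorphic in [a] with derivative
    given by the bracket ([Adv_inv_hol], [td_Adv_inv]). A holomorphic function
    with zero derivative along all right fields is constant on a connected group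
    ([connected_constant]). The fields preserve analytic, smooth and algebraic
    sections ([section_ifield]), and a word of length [l] in them is a
    differential operator of order at most [l] ([bounded_uact]), which bounds the
    order of each coefficient of [m_h] uniformly in the open set. *)

Set Implicit Arguments.
Unset Strict Implicit.
Unset Printing Implicit Defensive.

Import Order.TTheory GRing.Theory Num.Theory.
Import numFieldNormedType.Exports.

Local Open Scope classical_set_scope.
Local Open Scope ring_scope.

(** * Calculus of functions of class C^k *)

Lemma open_near (T : topologicalType) (D : set T) (x : T) :
  open D -> D x -> \forall y \near x, D y.
Proof. by move=> oD Dx; exact: open_nbhs_nbhs. Qed.

Section Diff.
Variable K : numFieldType.

Section VW.
Variables V W : normedModType K.

Lemma diff_epsP (f : V -> W) (df : {linear V -> W}) (x : V) :
  continuous df ->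
  (forall e : K, 0 < e -> \forall h \near (0 : V),
    `|f (h + x) - f x - df h| <= e * `|h|) ->
  differentiable f x /\ 'd f x = df :> (V -> W).
Proof.
move=> cdf H.
have E : f \o shift x = cst (f x) + df +o_ (0:V) id.
  by apply/eqaddoP => e e0; near=> h; rewrite /= opprD addrA; near: h; exact: H.
have dE := diff_unique cdf E; split => //.
by apply/diff_locallyP; rewrite dE.
Unshelve. all: by end_near. Qed.

Lemma diff_eps (f : V -> W) (x : V) (e : K) : differentiable f x -> 0 < e ->
  \forall h \near (0 : V), `|f (h + x) - f x - 'd f x h| <= e * `|h|.
Proof.
move=> /diff_locallyP[_ /eqaddoP H] e0; near=> h.
by rewrite -[_ - _]addrA -opprD; near: h; apply: H.
Unshelve. all: by end_near. Qed.

Lemma diff_near_eq (f g : V -> W) (x : V) :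
  {near x, f =1 g} -> differentiable f x ->
  differentiable g x /\ 'd g x = 'd f x :> (V -> W).
Proof.
move=> fg df; apply: diff_epsP; first exact: diff_continuous.
move=> e e0; have := diff_eps df e0.
have : \forall h \near (0 : V), f (h + x) = g (h + x).
  have fg' : \forall y \near x, f y = g y by [].
  by move: fg'; rewrite (near_shift (0 : V)) subr0.
move=> h1 h2; near=> h; have <- : f (h + x) = g (h + x) by near: h.
by rewrite -(nbhs_singleton fg); near: h.
Unshelve. all: by end_near. Qed.

Lemma diff_on_eq (D : set V) (f g : V -> W) (x v : V) : open D -> D x ->
  (forall y, D y -> f y = g y) -> differentiable f x -> 'd f x v = 'd g x v.
Proof.
move=> oD Dx fg df; have [|_ ->//] := @diff_near_eq f g x _ df.
by near=> y; apply: fg; near: y; exact: open_near.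
Unshelve. all: by end_near. Qed.

Lemma CkW k (D D' : set V) (f : V -> W) : D' `<=` D -> Ck k D f -> Ck k D' f.
Proof.
move=> DD; elim: k f => [|k ih] f /=; first by move=> H x /DD; exact: H.
by move=> [H1 H2]; split=> [x /DD|v]; [exact: H1|exact: ih].
Qed.

Lemma CkS k (D : set V) (f : V -> W) : Ck k.+1 D f -> Ck k D f.
Proof.
elim: k f => [|k ih] f [H1 H2].
  by move=> x /H1 ?; exact: differentiable_continuous.
by split=> // v; apply: ih.
Qed.

Lemma Ck_eq k (D : set V) (f g : V -> W) : open D ->
  (forall x, D x -> f x = g x) -> Ck k D f -> Ck k D g.
Proof.
move=> oD; elim: k f g => [|k ih] f g fg /=.
  move=> H x Dx; rewrite /prop_for /continuous_at -(fg x Dx).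
  apply: cvg_trans (H x Dx).
  by apply: near_eq_cvg; near=> y; rewrite fg//; near: y; exact: open_near.
have nfg x : D x -> {near x, f =1 g}.
  by move=> Dx; near=> y; apply: fg; near: y; exact: open_near.
move=> [H1 H2]; split=> [x Dx|v].
  by have [] := diff_near_eq (nfg x Dx) (H1 x Dx).
apply: ih (H2 v) => x Dx.
by have [_ ->] := diff_near_eq (nfg x Dx) (H1 x Dx).
Unshelve. all: by end_near. Qed.

Lemma Ck_cst k (D : set V) (w : W) : Ck k D (fun=> w).
Proof.
elim: k w => [|k ih] w /=; first by move=> x _; exact: cvg_cst.
split=> [x _|v]; first exact: differentiable_cst.
by rewrite (_ : (fun x => _) = fun=> 0)//; apply/funext => x; rewrite diff_cst.
Qed.

Lemma Ck_add k (D : set V) (f g : V -> W) : open D ->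
  Ck k D f -> Ck k D g -> Ck k D (fun x => f x + g x).
Proof.
move=> oD; elim: k f g => [|k ih] f g.
  by move=> Hf Hg x Dx; apply: cvgD; [exact: Hf|exact: Hg].
move=> [f1 f2] [g1 g2]; split=> [x Dx|v].
  exact: (differentiableD (f1 x Dx) (g1 x Dx)).
apply: (Ck_eq oD _ (ih _ _ (f2 v) (g2 v))) => x Dx.
by rewrite (diffD (f1 x Dx) (g1 x Dx)).
Qed.

Lemma Ck_sum k (D : set V) (I : Type) (s : seq I) (f : I -> V -> W) : open D ->
  (forall i, Ck k D (f i)) -> Ck k D (fun x => \sum_(i <- s) f i x).
Proof.
move=> oD H; elim: s => [|i s ih].
  by rewrite (_ : (fun x => _) = fun=> 0) ?funeqE//; [exact: Ck_cst|move=> x; rewrite big_nil].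
rewrite (_ : (fun x => _) = fun x => f i x + \sum_(i <- s) f i x); first exact: Ck_add.
by apply/funext => x; rewrite big_cons.
Qed.

End VW.

Section comp_lin.
Variables V W W' : normedModType K.

Lemma diff_linl (f : V -> W) (L : {linear W -> W'}) x : continuous L ->
  differentiable f x -> differentiable (L \o f) x /\
    forall v, 'd (L \o f) x v = L ('d f x v).
Proof.
move=> cL df; split; first exact/differentiable_comp/linear_differentiable.
by move=> v; rewrite diff_comp//; [rewrite /= diff_lin|exact: linear_differentiable].
Qed.

Lemma Ck_linl k (D : set V) (f : V -> W) (L : {linear W -> W'}) :
  open D -> continuous L -> Ck k D f -> Ck k D (L \o f).
Proof.
move=> oD cL; elim: k f => [|k ih] f /=.
  by move=> H x Dx; apply: continuous_comp; [exact: H|exact: cL].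
move=> [f1 f2]; split=> [x Dx|v]; first by have [] := diff_linl cL (f1 x Dx).
apply: (Ck_eq oD _ (ih _ (f2 v))) => x Dx /=.
by have [_ ->] := diff_linl cL (f1 x Dx).
Qed.

Lemma Ck_linr k (D : set W) (f : W -> W') (L : {linear V -> W}) (c : W) :
  open D -> continuous L -> Ck k D f ->
  Ck k [set x | D (c + L x)] (fun x => f (c + L x)).
Proof.
move=> oD cL.
have dL x : is_diff x (fun x => c + L x) L.
  have dLx : is_diff x L L.
    by split; [exact: linear_differentiable|exact: diff_lin].
  by have := is_diffD (is_diff_cst c x) dLx; rewrite add0r.
have cA : continuous (fun x => c + L x).
  by move=> x; apply: differentiable_continuous; exact: ex_diff.
have oD' : open [set x | D (c + L x)] by have /continuousP := cA; apply.
elim: k f => [|k ih] f /=.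
  by move=> H x Dx; apply: continuous_comp; [exact: cA|exact: H].
move=> [f1 f2].
have dfL x : D (c + L x) -> differentiable (fun x => f (c + L x)) x /\
    forall v, 'd (fun x => f (c + L x)) x v = 'd f (c + L x) (L v).
  move=> Dx; have d1 := @ex_diff _ _ _ _ _ _ _ (dL x); split.
    exact: (differentiable_comp d1 (f1 _ Dx)).
  by move=> v; rewrite (diff_comp d1 (f1 _ Dx)) /= diff_val.
split=> [x Dx|v]; first by have [] := dfL x Dx.
by apply: (Ck_eq oD' _ (ih _ (f2 (L v)))) => x Dx /=; rewrite (dfL x Dx).2.
Qed.
End comp_lin.

Section scalar.
Variable V : normedModType K.

Lemma Ck_mul k (D : set V) (f g : V -> K) : open D ->
  Ck k D f -> Ck k D g -> Ck k D (fun x => f x * g x).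
Proof.
move=> oD; elim: k f g => [|k ih] f g.
  by move=> Hf Hg x Dx; apply: cvgM; [exact: Hf|exact: Hg].
move=> Hf Hg; have [f1 f2] := Hf; have [g1 g2] := Hg; split=> [x Dx|v].
  exact: (differentiableM (f1 x Dx) (g1 x Dx)).
have H := Ck_add oD (ih _ _ (CkS Hf) (g2 v)) (ih _ _ (CkS Hg) (f2 v)).
by apply: (Ck_eq oD _ H) => x Dx; rewrite (diffM (f1 x Dx) (g1 x Dx)).
Qed.

Lemma Ck_inv k (D : set V) (f : V -> K) : open D -> (forall x, D x -> f x != 0) ->
  Ck k D f -> Ck k D (fun x => (f x)^-1).
Proof.
move=> oD f0; elim: k => [|k ih].
  by move=> H x Dx; apply: cvgV; [exact: f0|exact: H].
move=> Hf; have [f1 f2] := Hf; split=> [x Dx|v].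
  exact: (differentiableV (f1 x Dx) (f0 x Dx)).
have Hi := ih (CkS Hf).
have H := Ck_mul oD (Ck_mul oD (@Ck_cst V K k D (-1)) (Ck_mul oD Hi Hi)) (f2 v).
apply: (Ck_eq oD _ H) => x Dx; rewrite (diffV (f1 x Dx) (f0 x Dx)) /=.
by rewrite mulN1r -expr2 exprVn scaleNr mulNr.
Qed.
End scalar.

Section comp.
Variables V W : normedModType K.
Variables (I : finType) (e : I -> W) (l : I -> {linear W -> K^o}).
Hypotheses (cl : forall i, continuous (l i))
  (eE : forall w, w = \sum_i (l i w : K) *: e i).

(** The chain rule expresses the derivative of [f o phi] as a sum of products of
    derivatives of the coordinates of [phi] and of [f o phi] again, for which
    the induction hypothesis applies; coordinates [l i] on [W] are needed for
    this. *)
Lemma Ck_comp k (D : set V) (D' : set W) (f : W -> K) (phi : V -> W) :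
  open D -> open D' -> (forall x, D x -> D' (phi x)) ->
  Ck k D phi -> Ck k D' f -> Ck k D (f \o phi).
Proof.
move=> oD oD' DD'; elim: k f => [|k ih] f.
  move=> Hp Hf x Dx; apply: continuous_comp; first exact: Hp.
  by apply: Hf; exact: DD'.
move=> Hp Hf; have [p1 p2] := Hp; have [f1 f2] := Hf.
split=> [x Dx|v].
  by apply: differentiable_comp; [exact: p1|apply: f1; exact: DD'].
have H i : Ck k D (fun x => (l i \o (fun y => 'd phi y v)) x *
    ((fun y => 'd f y (e i)) \o phi) x).
  apply: (Ck_mul oD); last exact: (ih _ (CkS Hp) (f2 _)).
  exact: (Ck_linl oD (@cl i) (p2 v)).
apply: (Ck_eq oD _ (Ck_sum (index_enum I) oD H)) => x Dx.
rewrite diff_comp; [|exact: p1|by apply: f1; exact: DD'].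
rewrite /= {2}(eE ('d phi x v)) linear_sum; apply: eq_bigr => i _.
by rewrite linearZ.
Qed.
End comp.
End Diff.

(** * Complex coordinates as pairs of real coordinates *)

(** Turns the predicate [linear] into the structure expected by the
    differential. *)
Lemma ex_linear (K : pzRingType) (V W : lmodType K) (f : V -> W) : linear f ->
  exists L : {linear V -> W}, L = f :> (V -> W).
Proof.
move=> lf; pose L := GRing.isLinear.Build K V W _ f lf.
by exists (HB.pack_for {linear V -> W} f L).
Qed.

Section Transfer.
Variable R : realType.
Local Notation C := R[i].

Lemma gt0_complex (e : C) : 0 < e -> exists2 r : R, 0 < r & e = r%:C%C.
Proof. by case: e => a b; rewrite ltcE /= => /andP[/eqP -> a0]; exists a. Qed.

(** A real normed space and a complex one are not normed modules over the same
    field. Continuity and differentiability are transported along real linear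
    maps between them that are bounded in this sense. *)
Record real_bounded (V' : normedModType R) (V : normedModType C)
    (a : V' -> V) : Prop := {
  rb_lin : forall r x y, a (r *: x + y) = r%:C%C *: a x + a y;
  rb_bd : exists2 k : R, 0 < k & forall x, `|a x| <= (k * `|x|)%:C%C }.

Record bounded_real (V : normedModType C) (V' : normedModType R)
    (b : V -> V') : Prop := {
  br_lin : forall (r : R) x y, b (r%:C%C *: x + y) = r *: b x + b y;
  br_bd : exists2 k : R, 0 < k & forall x, (`|b x|)%:C%C <= k%:C%C * `|x| }.

Section bounds.
Variables (V : normedModType C) (V' : normedModType R).

Lemma real_bounded0 (a : V' -> V) : real_bounded a -> a 0 = 0.
Proof.
move=> ha; have := rb_lin ha 1 0 0.
rewrite !scale1r addr0 => /eqP; rewrite -subr_eq subrr eq_sym.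
by move/eqP.
Qed.
Lemma real_boundedB (a : V' -> V) x y : real_bounded a ->
  a (x - y) = a x - a y.
Proof.
move=> ha; rewrite addrC -scaleN1r (rb_lin ha) rmorphN1 scaleN1r.
by rewrite addrC.
Qed.
Lemma real_boundedD (a : V' -> V) x y : real_bounded a ->
  a (x + y) = a x + a y.
Proof. by move=> ha; rewrite -[x]scale1r (rb_lin ha) !scale1r. Qed.
Lemma bounded_realB (b : V -> V') x y : bounded_real b ->
  b (x - y) = b x - b y.
Proof.
move=> ha; rewrite addrC -scaleN1r (_ : -1 = (-1)%:C%C) ?(br_lin ha) ?rmorphN1//.
by rewrite scaleN1r addrC.
Qed.

Lemma real_bounded_continuous (a : V' -> V) : real_bounded a -> continuous a.
Proof.
move=> ha x; have [k k0 hk] := rb_bd ha.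
apply/cvgrPdist_lt => e /gt0_complex[r r0 ->]; near=> y.
rewrite -real_boundedB//; apply: (le_lt_trans (hk _)); rewrite ltcR.
rewrite mulrC -ltr_pdivlMr//; near: y.
by apply: (@cvgr_dist_lt _ _ _ (nbhs x) _ id x); [exact: cvg_id|exact: divr_gt0].
Unshelve. all: by end_near. Qed.

Lemma bounded_real_continuous (b : V -> V') : bounded_real b -> continuous b.
Proof.
move=> ha x; have [k k0 hk] := br_bd ha.
apply/cvgrPdist_lt => e e0; near=> y.
rewrite -bounded_realB// -ltcR; apply: (le_lt_trans (hk _)).
have kC : 0 < k%:C%C :> C by rewrite ltcR.
rewrite mulrC -ltr_pdivlMr//; near: y.
apply: (@cvgr_dist_lt _ _ _ (nbhs x) _ id x); first exact: cvg_id.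
by apply: divr_gt0 => //; rewrite ltcR.
Unshelve. all: by end_near. Qed.

End bounds.

Section transfer.
Variables (V W : normedModType C) (V' W' : normedModType R).
Variables (a : V' -> V) (b : W -> W').
Hypotheses (ha : real_bounded a) (hb : bounded_real b).

(** The real linear part of the complex differential is a real differential:
    complex differentiability implies real differentiability of the real and
    imaginary parts. *)
Lemma diff_transfer (f : V -> W) x : differentiable f (a x) ->
  differentiable (b \o f \o a) x /\
  forall v, 'd (b \o f \o a) x v = b ('d f (a x) (a v)).
Proof.
move=> df.
have : linear (fun v => b ('d f (a x) (a v))).
  by move=> r u v; rewrite (rb_lin ha) linearD linearZ (br_lin hb).
move=> /ex_linear[L LE].
suff [d1 d2] : differentiable (b \o f \o a) x /\
    'd (b \o f \o a) x = L :> (V' -> W').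
  by split => // v; rewrite d2 LE.
have cL : continuous (L : V' -> W').
  rewrite LE => y; apply: (@continuous_comp _ _ _ a (fun v => b ('d f (a x) v))).
    exact: real_bounded_continuous.
  apply: continuous_comp; last exact: bounded_real_continuous.
  exact: diff_continuous.
apply: (@diff_epsP _ _ _ (b \o f \o a) L x cL) => e e0.
have [k k0 hk] := rb_bd ha; have [k' k0' hk'] := br_bd hb.
(* Passing through [a] and [b] costs the factors [k] and [k']. *)
have e0' : 0 < (e / (k * k'))%:C%C :> C by rewrite ltcR divr_gt0// mulr_gt0.
have ca : a h @[h --> (0 : V')] --> (0 : V).
  by rewrite -(real_bounded0 ha); exact: real_bounded_continuous.
have := ca _ (diff_eps df e0'); rewrite /= => near0; near=> h.
have H : `|f (a h + a x) - f (a x) - 'd f (a x) (a h)| <=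
  (e / (k * k'))%:C%C * `|a h| by near: h; exact: near0.
rewrite LE /= -!bounded_realB// real_boundedD// -lecR.
apply: (le_trans (hk' _)).
have kC : 0 <= k'%:C%C :> C by rewrite lecR ltW.
apply: (le_trans (ler_wpM2l kC H)).
have eC : 0 <= k'%:C%C * (e / (k * k'))%:C%C :> C.
  by rewrite mulr_ge0// ltW.
rewrite mulrA; apply: (le_trans (ler_wpM2l eC (hk _))).
rewrite -!rmorphM lecR le_eqVlt; apply/orP; left; apply/eqP.
rewrite (_ : k' * (e / (k * k')) = e / k); first by rewrite mulrA divfK ?gt_eqF.
by rewrite invfM mulrA [k' * e]mulrC -!mulrA [k^-1 * _]mulrC mulVKf ?gt_eqF.
Unshelve. all: by end_near. Qed.

Lemma Ck_transfer k (D : set V) (f : V -> W) : open D -> Ck k D f ->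
  Ck k (a @^-1` D) (b \o f \o a).
Proof.
move=> oD; have ca := real_bounded_continuous ha.
have oD' : open (a @^-1` D) by have /continuousP := ca; apply.
elim: k f => [|k ih] f.
  move=> H x Dx; apply: continuous_comp; first exact: ca.
  by apply: continuous_comp; [exact: H|exact: bounded_real_continuous].
move=> [f1 f2]; split=> [x Dx|v]; first by have [] := diff_transfer (f1 _ Dx).
apply: (Ck_eq oD' _ (ih _ (f2 (a v)))) => x Dx.
by rewrite (diff_transfer (f1 _ Dx)).2.
Qed.
End transfer.

Section coords.
Variable n : nat.
Local Notation E := ('rV[R]_n * 'rV[R]_n)%type.

(** A copy of [of_real_coords] for any dimension; being convertible to it, it can
    be used on the conditions that define smooth functions on the group. *)
Definition of_reals (p : E) : 'rV[C]_n :=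
  \row_j (p.1 ord0 j +i* p.2 ord0 j)%C.
Definition to_reals (z : 'rV[C]_n) : E :=
  (\row_j complex.Re (z ord0 j), \row_j complex.Im (z ord0 j)).

Lemma of_realsK : cancel of_reals to_reals.
Proof.
case=> x y; rewrite /to_reals /of_reals; congr (_, _);
by apply/rowP => j; rewrite !mxE.
Qed.
Lemma to_realsK : cancel to_reals of_reals.
Proof. by move=> z; apply/rowP => j; rewrite !mxE; case: (z ord0 j). Qed.

Lemma mx_norm_le (K : numFieldType) (v : 'rV[K]_n) (e : K) :
  0 <= e -> (forall j, `|v ord0 j| <= e) -> `|v| <= e.
Proof.
move=> e0 H; have [v0|v0] := eqVneq (mx_norm v) 0.
  by rewrite -[`|v|]/(mx_norm v) v0.
have [[i j] E] := mx_norm_neq0 v0; rewrite -[`|v|]/(mx_norm v) E /=.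
by rewrite (_ : i = ord0)//; apply: ord1.
Qed.

Lemma mx_norm_coord (K : numFieldType) (v : 'rV[K]_n) j : `|v ord0 j| <= `|v|.
Proof.
rewrite -[`|v|]/(mx_norm v) mx_normE.
set m := (\big[Order.max/_]_i _).
have : `|v ord0 j|%:nng <= m by have /bigmax_leP[_ /(_ (ord0, j) isT)] := lexx m.
by rewrite -num_le.
Qed.

Lemma normc_ReIm (a b : R) : `|(a +i* b)%C| <= (`|a| + `|b|)%:C%C.
Proof.
rewrite (_ : (a +i* b)%C = a%:C%C + 'i%C * b%:C%C); last first.
  by rewrite [LHS]complexE.
apply: (le_trans (ler_normD _ _)); rewrite normrM !normc_def /=.
rewrite !expr0n /= expr1n add0r !addr0 !sqrtr_sqr sqrtr1 mul1r.
by rewrite rmorphD.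
Qed.

Lemma Re_normc (z : C) : `|complex.Re z|%:C%C <= `|z|.
Proof.
case: z => a b /=; rewrite normc_def lecR /= -sqrtr_sqr ler_wsqrtr//.
by rewrite lerDl sqr_ge0.
Qed.

Lemma Im_normc (z : C) : `|complex.Im z|%:C%C <= `|z|.
Proof.
case: z => a b /=; rewrite normc_def lecR /= -sqrtr_sqr ler_wsqrtr//.
by rewrite lerDr sqr_ge0.
Qed.

Lemma of_reals_bounded : real_bounded of_reals.
Proof.
split=> [r x y|].
  by apply/rowP => j; rewrite !mxE; congr Complex; rewrite /= ?mul0r ?subr0 ?addr0.
exists 2 => // -[x y]; apply: mx_norm_le => [|j].
  by rewrite lecR mulr_ge0.
rewrite mxE /=; apply: (le_trans (normc_ReIm _ _)); rewrite lecR mulr_natl mulr2n.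
apply: lerD; apply: (le_trans (mx_norm_coord _ _)).
  by rewrite prod_normE le_max lexx.
by rewrite prod_normE le_max lexx orbT.
Qed.

Lemma to_reals_bounded : bounded_real to_reals.
Proof.
split=> [r x y|].
  congr (_, _); apply/rowP => j; rewrite !mxE /= ?mul0r ?subr0 ?addr0;
  by case: (x ord0 j) => a b /=; case: (y ord0 j) => c d /=; rewrite ?mul0r ?subr0 ?addr0.
exists 1 => // x; rewrite mul1r prod_normE.
have [r rE] : exists r : R, `|x| = r%:C%C.
  by exists (complex.Re `|x|); rewrite RRe_real// normr_real.
have r0 : 0 <= r by rewrite -ler0c -rE.
rewrite rE lecR ge_max; apply/andP; split; apply: mx_norm_le => // j;
  rewrite mxE -lecR -rE; apply: (le_trans _ (mx_norm_coord _ j)).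
  exact: Re_normc.
exact: Im_normc.
Qed.

End coords.

Lemma Re_bounded : bounded_real (@complex.Re R : C -> R).
Proof.
split=> [r [a b] [c d]|]; first by rewrite /= mul0r subr0.
by exists 1 => // z; rewrite mul1r; exact: Re_normc.
Qed.

Lemma Im_bounded : bounded_real (@complex.Im R : C -> R).
Proof.
split=> [r [a b] [c d]|]; first by rewrite /= mul0r addr0.
by exists 1 => // z; rewrite mul1r; exact: Im_normc.
Qed.

End Transfer.

(** * Symmetry of second derivatives *)

Section Schwarz.
Variables (R : realType) (E : normedModType R).

Lemma line_derive (u : E -> R) (c v : E) (s : R) :
  differentiable u (c + s *: v) ->
  is_derive s 1 (fun t => u (c + t *: v)) ('d u (c + s *: v) v).
Proof.
move=> du; pose L := fun t : R => c + t *: v.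
have dL : is_diff s L (fun t => t *: v).
  rewrite (_ : (fun t => t *: v) = 0 + *:%R^~ v); last by rewrite add0r.
  exact: (is_diffD (is_diff_cst c s) (is_diff_scalel s v)).
have dL' : differentiable L s by exact: ex_diff.
have duL : differentiable (u \o L) s by exact: (differentiable_comp dL' du).
rewrite (_ : (fun t => _) = u \o L)//; split; first exact: diff_derivable.
by rewrite deriveE// (diff_comp dL' du) /= diff_val scale1r.
Qed.

Lemma line_MVT (u : E -> R) (c v : E) (d : R) : 0 < d ->
  (forall s, 0 <= s <= d -> differentiable u (c + s *: v)) ->
  exists2 s, 0 <= s <= d & u (c + d *: v) - u c = d * 'd u (c + s *: v) v.
Proof.
move=> d0 du.
have H (s : R) : 0 <= s <= d ->
    is_derive s 1 (fun t => u (c + t *: v)) ('d u (c + s *: v) v).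
  by move=> /du; exact: line_derive.
have [||s sd E1] := @MVT R (fun t => u (c + t *: v))
    (fun s => 'd u (c + s *: v) v) 0 d d0.
- by move=> s; rewrite in_itv /= => /andP[s0 sd]; apply: H; rewrite !ltW.
- apply: derivable_within_continuous => s; rewrite in_itv /= => sd.
  by have [] := H s sd.
exists s; first by move: sd; rewrite in_itv /= => /andP[s0 sd]; rewrite !ltW.
by move: E1; rewrite scale0r addr0 subr0 mulrC.
Qed.

(** Apply the mean value theorem first to the increment
    [y |-> u (y + d w) - u y] in the direction [v], then to [d u . v] in the
    direction [w]. *)
Lemma square_MVT (u : E -> R) (x v w : E) (d : R) (D : set E) : 0 < d ->
  Ck 2 D u ->
  (forall s t : R, 0 <= s <= d -> 0 <= t <= d -> D (x + s *: v + t *: w)) ->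
  exists s t : R, [/\ 0 <= s <= d, 0 <= t <= d &
    u (x + d *: v + d *: w) - u (x + d *: v) - u (x + d *: w) + u x =
    d * (d * 'd (fun y => 'd u y v) (x + s *: v + t *: w) w)].
Proof.
move=> d0 [u1 u2] HD; have d0d : 0 <= d <= d by rewrite lexx ltW.
have z0d : 0 <= (0 : R) <= d by rewrite lexx ltW.
pose f := fun y => u (y + d *: w) - u y.
have df s : 0 <= s <= d -> is_diff (x + s *: v) f
   (fun h => 'd u (x + s *: v + d *: w) h - 'd u (x + s *: v) h).
  move=> sd.
  have D1 : differentiable u (x + s *: v + d *: w) by apply: u1; exact: HD.
  have D2 : differentiable u (x + s *: v).
    by apply: u1; have := HD s 0 sd z0d; rewrite scale0r addr0.
  have D3 : is_diff (x + s *: v) (fun y => y + d *: w) (id : E -> E).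
    have := is_diffD (is_diff_id (x + s *: v)) (is_diff_cst (d *: w) (x + s *: v)).
    by rewrite addr0.
  have D4 : is_diff (x + s *: v) (u \o (fun y => y + d *: w))
     ('d u (x + s *: v + d *: w) \o id).
    exact: (is_diff_comp D3 (differentiableP D1)).
  exact: (is_diffB D4 (differentiableP D2)).
have [|s sd E1] := @line_MVT f x v d d0.
  by move=> s /df h; exact: ex_diff.
have [|t td E2] := @line_MVT (fun y => 'd u y v) (x + s *: v) w d d0.
  move=> t td; have [+ _] := u2 v; apply; exact: HD.
exists s, t; split => //; rewrite -E2.
have dfs := df s sd; move: E1; rewrite diff_val /f => <-.
by ring.
Qed.

(** The second difference of [u] on a small parallelogram is symmetric in [v] and
    [w]. By [square_MVT] it equals either mixed derivative at some nearby point,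
    and both are continuous at [x]. *)
Lemma schwarz (u : E -> R) (x v w : E) (D : set E) : open D -> D x -> Ck 2 D u ->
  'd (fun y => 'd u y v) x w = 'd (fun y => 'd u y w) x v.
Proof.
move=> oD Dx Hu; have [u1 u2] := Hu.
pose p a b y := 'd (fun y => 'd u y a) y b.
have cp a b : {for x, continuous (p a b)} by have [_ /(_ b)] := u2 a; apply.
suff H e : 0 < e -> `|p v w x - p w v x| <= e + e.
  apply/eqP; rewrite -subr_eq0 -normr_eq0 eq_le normr_ge0 andbT.
  apply/ler_addgt0Pl => e e0; rewrite addr0.
  by apply: (le_trans (H (e / 2) _)); [rewrite divr_gt0|rewrite -splitr].
move=> e0.
have : \forall y \near x, [/\ D y, `|p v w x - p v w y| < e &
    `|p w v x - p w v y| < e].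
  near=> y; split; near: y; first exact: open_near.
  - by have /cvgrPdist_lt := cp v w; apply.
  - by have /cvgrPdist_lt := cp w v; apply.
move=> /nbhs_ballP[r /= r0 rD].
(* The parallelogram with sides [d v] and [d w] at [x] lies in the ball of
   radius [r]; adding [1] keeps the denominator positive. *)
pose d := r / (`|v| + `|w| + 1).
have M0 : 0 < `|v| + `|w| + 1 by rewrite ltr_wpDl// addr_ge0.
have d0 : 0 < d by exact: divr_gt0.
have B (a b : E) (s t : R) : `|a| + `|b| = `|v| + `|w| -> 0 <= s <= d -> 0 <= t <= d ->
   ball x r (x + s *: a + t *: b).
  move=> ab /andP[s0 sd] /andP[t0 td]; rewrite -ball_normE /= -addrA opprD addrA subrr.
  rewrite add0r normrN; apply: (le_lt_trans (ler_normD _ _)).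
  rewrite !normrZ (ger0_norm s0) (ger0_norm t0).
  apply: (@le_lt_trans _ _ (d * (`|v| + `|w|))).
    by rewrite -ab mulrDr; apply: lerD; rewrite ler_wpM2r.
  by rewrite /d mulrAC ltr_pdivrMr// ltr_pM2l// ltrDl.
have [|s [t [sd td E1]]] := @square_MVT u x v w d D d0 Hu.
  by move=> s t sd td; have [] := rD _ (B v w s t erefl sd td).
have [|s' [t' [sd' td' E2]]] := @square_MVT u x w v d D d0 Hu.
  by move=> s' t' sd' td'; have [] := rD _ (B w v s' t' (addrC _ _) sd' td').
have [_ h1 _] := rD _ (B v w s t erefl sd td).
have [_ _ h2] := rD _ (B w v s' t' (addrC _ _) sd' td').
have E3 : p v w (x + s *: v + t *: w) = p w v (x + s' *: w + t' *: v).
  have /mulfI : d != 0 by rewrite gt_eqF.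
  move/(_ (d * p v w (x + s *: v + t *: w)) (d * p w v (x + s' *: w + t' *: v))).
  rewrite /p -E1 -E2 (addrAC x (d *: w)) => h.
  have /mulfI : d != 0 by rewrite gt_eqF.
  by apply; apply: h; ring.
rewrite (_ : _ - _ = (p v w x - p v w (x + s *: v + t *: w)) -
   (p w v x - p w v (x + s' *: w + t' *: v))); last by rewrite E3; ring.
by apply: (le_trans (ler_normB _ _)); apply: lerD; exact: ltW.
Unshelve. all: by end_near. Qed.

End Schwarz.

(** * Wirtinger derivatives and germs of functions *)

Section Wirtinger.
Variables (R : realType).
Local Notation C := R[i].

Lemma complex_iE : 'i = (0 +i* 1)%C :> C.
Proof. by []. Qed.

Lemma complexD (a b c d : R) : ((a + b) +i* (c + d))%C = (a +i* c)%C + (b +i* d)%C.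
Proof. by []. Qed.

Lemma complexZD (r a b c d : R) :
  ((r * a + b) +i* (r * c + d))%C = r%:C%C * (a +i* c)%C + (b +i* d)%C.
Proof. by rewrite complexD; congr (_ + _); simpc. Qed.

Lemma complex_leibniz (a b c d a' b' c' d' : R) :
  (((a * c' + c * a') - (b * d' + d * b')) +i* ((a * d' + d * a') + (b * c' + c * b')))%C
  = (a +i* b)%C * (c' +i* d')%C + (c +i* d)%C * (a' +i* b')%C.
Proof. by simpc; congr Complex; ring. Qed.

Section diff_apply.
Variable E : normedModType R.

Lemma dlin_apply (u : E -> R) p (r : R) x y :
  'd u p (r *: x + y) = r * 'd u p x + 'd u p y.
Proof. by rewrite linearP. Qed.

Lemma dadd_apply (u u' : E -> R) p x : differentiable u p -> differentiable u' p ->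
  'd (u + u') p x = 'd u p x + 'd u' p x.
Proof. by move=> d d'; rewrite (diffD d d'). Qed.

Lemma dsub_apply (u u' : E -> R) p x : differentiable u p -> differentiable u' p ->
  'd (u - u') p x = 'd u p x - 'd u' p x.
Proof. by move=> d d'; rewrite (diffB d d'). Qed.

Lemma dmul_apply (u u' : E -> R) p x : differentiable u p -> differentiable u' p ->
  'd (u * u') p x = u p * 'd u' p x + u' p * 'd u p x.
Proof. by move=> d d'; rewrite (diffM d d'). Qed.

End diff_apply.

Section calc.
Variable n : nat.
Local Notation Cn := 'rV[C]_n.
Local Notation E := ('rV[R]_n * 'rV[R]_n)%type.
Implicit Types (g : Cn -> C) (z v w X Y : Cn).

Definition re_part g : E -> R := @complex.Re R \o g \o @of_reals R n.
Definition im_part g : E -> R := @complex.Im R \o g \o @of_reals R n.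

Definition real_diff g z : Prop :=
  differentiable (re_part g) (to_reals z) /\
  differentiable (im_part g) (to_reals z).

Definition rdir v g z : C := Defs.derive0 (fun t : R => g (z + t%:C%C *: v)).

(** The Wirtinger derivative [d/dX], that is the (1,0)-part of the differential.
    It is the complex derivative on holomorphic functions, and it is complex
    linear in [X] for all smooth functions. *)
Definition pd X g z : C := 2^-1 * (rdir X g z - 'i * rdir ('i *: X) g z).

Lemma pdE X g z : pd X g z = 2^-1 * (rdir X g z - 'i * rdir ('i *: X) g z).
Proof. by []. Qed.

Lemma to_reals_line z v (t : R) : to_reals (z + t%:C%C *: v) = to_reals z + t *: to_reals v.
Proof. by rewrite addrC (br_lin (to_reals_bounded R n)) addrC. Qed.

Lemma rdirE v g z : real_diff g z ->
  rdir v g z = ('d (re_part g) (to_reals z) (to_reals v) +i*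
                'd (im_part g) (to_reals z) (to_reals v))%C.
Proof.
move=> [d1 d2]; have L (u : E -> R) : differentiable u (to_reals z) ->
    derive1 (fun t : R => u (to_reals z + t *: to_reals v)) 0 = 'd u (to_reals z) (to_reals v).
  move=> du; rewrite derive1E.
  have H : is_derive (0 : R) 1 (fun t => u (to_reals z + t *: to_reals v))
     ('d u (to_reals z + 0 *: to_reals v) (to_reals v)).
    by apply: line_derive; rewrite scale0r addr0.
  by rewrite (@derive_val _ _ _ _ _ _ _ H) scale0r addr0.
rewrite /rdir /Defs.derive0 -!L//; congr Complex; congr (derive1 _ 0); apply/funext => t;
  by rewrite /re_part /im_part /= -to_reals_line to_realsK.
Qed.

Lemma derive0_near (F F' : R -> C) : {near (0 : R), F =1 F'} ->
  Defs.derive0 F = Defs.derive0 F'.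
Proof.
move=> FF; rewrite /Defs.derive0 !derive1E; congr Complex; apply: near_eq_derive;
  by near=> t; rewrite (_ : F t = F' t)//; near: t; exact: FF.
Unshelve. all: by end_near. Qed.

Lemma near_line (P : Cn -> Prop) z v : (\forall y \near z, P y) ->
  \forall t \near (0 : R), P (z + t%:C%C *: v).
Proof.
move=> Pz.
have ct : (fun t : R => of_reals (to_reals z + t *: to_reals v)) @ (0 : R) --> z.
  rewrite -[X in _ --> X]to_realsK -[to_reals z in X in _ --> X]addr0 -[0 in X in _ --> X](scale0r (to_reals v)).
  apply: continuous_comp; last exact: (real_bounded_continuous (of_reals_bounded R n)).
  by apply: cvgD; [exact: cvg_cst|apply: cvgZr_tmp; exact: cvg_id].
have := ct _ Pz; rewrite /= => h; near=> t.
by rewrite -[_ + _]to_realsK to_reals_line; near: t; exact: h.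
Unshelve. all: by end_near. Qed.

Lemma rdir_near v g g' z : {near z, g =1 g'} -> rdir v g z = rdir v g' z.
Proof. by move=> gg; apply: derive0_near; exact: (near_line v (gg : \forall y \near z, g y = g' y)). Qed.

Lemma pd_near X g g' z : {near z, g =1 g'} -> pd X g z = pd X g' z.
Proof. by move=> gg; rewrite /pd !(rdir_near _ gg). Qed.

Lemma rdir_lin g z (r : R) v w : real_diff g z ->
  rdir (r%:C%C *: v + w) g z = r%:C%C * rdir v g z + rdir w g z.
Proof.
move=> dg; rewrite (rdirE _ dg) (rdirE v dg) (rdirE w dg) (br_lin (to_reals_bounded R n)).
by apply: etrans (complexZD _ _ _ _ _); congr Complex; exact: dlin_apply.
Qed.

(** Complex linearity in [X] follows from real linearity of [rdir] because the
    combination of [X] and [i X] in [pd] absorbs the multiplication by [i]. *)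
Lemma pd_lin g z (a : C) X Y : real_diff g z ->
  pd (a *: X + Y) g z = a * pd X g z + pd Y g z.
Proof.
move=> dg; case: a => x y.
have D (b : C) v w : b = (complex.Re b)%:C%C + 'i * (complex.Im b)%:C%C ->
   rdir (b *: v + w) g z = (complex.Re b)%:C%C * rdir v g z +
    (complex.Im b)%:C%C * rdir ('i *: v) g z + rdir w g z.
  move=> {1}->; rewrite scalerDl mulrC -scalerA -addrA rdir_lin//.
  by rewrite rdir_lin// addrA.
rewrite /pd D; last by rewrite [LHS]complexE.
have iaE : 'i * (x +i* y)%C = (- y +i* x)%C :> C by rewrite complex_iE; simpc.
rewrite scalerDr scalerA iaE D; last by rewrite [LHS]complexE.
rewrite /= (_ : (x +i* y)%C = x%:C%C + 'i * y%:C%C); last by rewrite [LHS]complexE.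
have i2 : 'i * 'i = -1 :> C by rewrite -expr2 sqrCi.
set a := rdir _ _ _; set b := rdir _ _ _; set c := rdir _ _ _; set d := rdir _ _ _.
rewrite (_ : (- y)%:C%C = - y%:C%C :> C); last by rewrite rmorphN.
by ring: i2.
Qed.

Lemma real_diff_cst (c : C) z : real_diff (fun=> c) z.
Proof. by split; exact: differentiable_cst. Qed.

Lemma rdir_cst v (c : C) z : rdir v (fun=> c) z = 0.
Proof.
rewrite rdirE; last exact: real_diff_cst.
have H a : 'd (fun=> a : R) (to_reals z) = 0 :> (E -> R) by exact: diff_cst.
have -> : re_part (fun=> c) = fun=> complex.Re c by [].
have -> : im_part (fun=> c) = fun=> complex.Im c by [].
by rewrite !H.
Qed.

Lemma real_diffD g g' z : real_diff g z -> real_diff g' z ->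
  real_diff (fun y => g y + g' y) z /\
  forall v, rdir v (fun y => g y + g' y) z = rdir v g z + rdir v g' z.
Proof.
move=> dg dg'; have [r1 i1] := dg; have [r2 i2] := dg'.
have rE : re_part (fun y => g y + g' y) = re_part g + re_part g'.
  by apply/funext => p; rewrite /re_part /= raddfD.
have iE : im_part (fun y => g y + g' y) = im_part g + im_part g'.
  by apply/funext => p; rewrite /im_part /= raddfD.
have d : real_diff (fun y => g y + g' y) z.
  by split; rewrite ?rE ?iE; exact: differentiableD.
split => // v; rewrite (rdirE v d) (rdirE v dg) (rdirE v dg').
apply: etrans (complexD _ _ _ _); congr Complex.
  by rewrite rE; exact: dadd_apply.
by rewrite iE; exact: dadd_apply.
Qed.

Lemma real_diffM g g' z : real_diff g z -> real_diff g' z ->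
  real_diff (fun y => g y * g' y) z /\
  forall v, rdir v (fun y => g y * g' y) z = g z * rdir v g' z + g' z * rdir v g z.
Proof.
move=> dg dg'; have [r1 i1] := dg; have [r2 i2] := dg'.
have rE : re_part (fun y => g y * g' y) = re_part g * re_part g' - im_part g * im_part g'.
  by apply/funext => p; rewrite /re_part /im_part /= !fctE; case: (g _) => a b; case: (g' _) => c d /=.
have iE : im_part (fun y => g y * g' y) = re_part g * im_part g' + im_part g * re_part g'.
  by apply/funext => p; rewrite /re_part /im_part /= !fctE; case: (g _) => a b; case: (g' _) => c d /=.
have d1 := differentiableM r1 r2; have d2 := differentiableM i1 i2.
have d3 := differentiableM r1 i2; have d4 := differentiableM i1 r2.
have d : real_diff (fun y => g y * g' y) z.
  by split; rewrite ?rE ?iE; [exact: differentiableB|exact: differentiableD].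
split => // v; rewrite (rdirE v d) (rdirE v dg) (rdirE v dg').
have gE h : (h z = re_part h (to_reals z) +i* im_part h (to_reals z) :> C)%C.
  by rewrite /re_part /im_part /= to_realsK; case: (h z).
rewrite (gE g) (gE g'); apply: etrans (complex_leibniz _ _ _ _ _ _ _ _); congr Complex.
  rewrite rE; apply: (etrans (dsub_apply _ d1 d2)); congr (_ - _); exact: dmul_apply.
rewrite iE; apply: (etrans (dadd_apply _ d3 d4)); congr (_ + _); exact: dmul_apply.
Qed.

Opaque rdir.

Lemma pd_cst X (c : C) z : pd X (fun=> c) z = 0.
Proof. by rewrite /pd !rdir_cst mulr0 subrr mulr0. Qed.

Lemma pdD X g g' z : real_diff g z -> real_diff g' z ->
  pd X (fun y => g y + g' y) z = pd X g z + pd X g' z.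
Proof. by move=> dg dg'; have [_ E] := real_diffD dg dg'; rewrite /pd !E; ring. Qed.

Lemma pdM X g g' z : real_diff g z -> real_diff g' z ->
  pd X (fun y => g y * g' y) z = g z * pd X g' z + g' z * pd X g z.
Proof. by move=> dg dg'; have [_ E] := real_diffM dg dg'; rewrite /pd !E; ring. Qed.

End calc.

Section germs.
Variable n : nat.
Local Notation Cn := 'rV[C]_n.
Local Notation E := ('rV[R]_n * 'rV[R]_n)%type.
Implicit Types (g : Cn -> C) (z v w X Y : Cn) (D : set Cn).

Definition csmooth_on D g : Prop :=
  Coo (@of_reals R n @^-1` D) (re_part g) /\ Coo (@of_reals R n @^-1` D) (im_part g).

(** The class of [g] near [z]: holomorphic if [b], real smooth otherwise. The
    flag lets the three sheaves of functions share one development. *)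
Definition germ (b : bool) g z : Prop := exists D,
  [/\ open D, D z & if b then Coo D g else csmooth_on D g].

Lemma open_of_reals D : open D -> open (@of_reals R n @^-1` D).
Proof.
by have /continuousP := @real_bounded_continuous _ _ _ _ (of_reals_bounded R n); apply.
Qed.

Lemma csmooth_onW D D' g : D' `<=` D -> csmooth_on D g -> csmooth_on D' g.
Proof.
move=> DD [h1 h2]; split=> k; [apply: CkW (h1 k)|apply: CkW (h2 k)];
by move=> p; exact: DD.
Qed.

Lemma germ_near b g z : germ b g z -> \forall y \near z, germ b g y.
Proof.
move=> [D [oD Dz H]]; near=> y; exists D; split => //.
by near: y; exact: (open_near oD Dz).
Unshelve. all: by end_near. Qed.

Lemma germ_eq b g g' z : {near z, g =1 g'} -> germ b g z -> germ b g' z.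
Proof.
move=> gg [D [oD Dz H]]; pose D' := D `&` [set y | g y = g' y]°.
have oD' : open D' by apply: openI => //; exact: open_interior.
exists D'; split => //.
have EE y : D' y -> g y = g' y by move=> [_ /interior_subset].
case: b H => H.
  by move=> k; apply: (@Ck_eq _ _ _ _ _ g) => //; apply: CkW (H k) => y [].
have [h1 h2] : csmooth_on D' g by apply: csmooth_onW H => y [].
by split=> k; [apply: (Ck_eq _ _ (h1 k))|apply: (Ck_eq _ _ (h2 k))];
  try (exact: open_of_reals); move=> p Dp; rewrite /re_part /im_part /= EE.
Qed.

Lemma germ_cst b (c : C) z : germ b (fun=> c) z.
Proof.
exists setT; split=> //; first exact: openT.
by case: b; [move=> k; exact: Ck_cst|split=> k; exact: Ck_cst].
Qed.

Lemma germ_common b g g' z : germ b g z -> germ b g' z -> exists D,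
  [/\ open D, D z, if b then Coo D g else csmooth_on D g &
      if b then Coo D g' else csmooth_on D g'].
Proof.
move=> [D [oD Dz H]] [D' [oD' Dz' H']]; exists (D `&` D').
split => //; first exact: openI.
  by case: b H {H'} => H; [move=> k; apply: CkW (H k)|apply: csmooth_onW H]; move=> y [].
by case: b H' {H} => H; [move=> k; apply: CkW (H k)|apply: csmooth_onW H]; move=> y [].
Qed.

Lemma germD b g g' z : germ b g z -> germ b g' z -> germ b (fun y => g y + g' y) z.
Proof.
move=> h1 h2; have [D [oD Dz {h1 h2}]] := germ_common h1 h2.
case: b => h1 h2; exists D; split => //; first by move=> k; exact: Ck_add.
have oD' := open_of_reals oD; have [r1 i1] := h1; have [r2 i2] := h2.
split=> k; [apply: (Ck_eq oD' _ (Ck_add oD' (r1 k) (r2 k)))|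
            apply: (Ck_eq oD' _ (Ck_add oD' (i1 k) (i2 k)))];
by move=> p Dp; rewrite /re_part /im_part /= raddfD.
Qed.

Lemma germM b g g' z : germ b g z -> germ b g' z -> germ b (fun y => g y * g' y) z.
Proof.
move=> h1 h2; have [D [oD Dz {h1 h2}]] := germ_common h1 h2.
case: b => h1 h2; exists D; split => //; first by move=> k; exact: Ck_mul.
have oD' := open_of_reals oD; have [r1 i1] := h1; have [r2 i2] := h2.
have m1 k : Ck k (@of_reals R n @^-1` D) (fun y => -1 : R) by exact: Ck_cst.
split=> k; [apply: (Ck_eq oD' _ (Ck_add oD' (Ck_mul oD' (r1 k) (r2 k))
     (Ck_mul oD' (m1 k) (Ck_mul oD' (i1 k) (i2 k)))))|
            apply: (Ck_eq oD' _ (Ck_add oD' (Ck_mul oD' (r1 k) (i2 k))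
     (Ck_mul oD' (i1 k) (r2 k))))];
move=> p Dp; rewrite /re_part /im_part /=; case: (g _) => a e; case: (g' _) => c d /=.
  by rewrite mulN1r.
by [].
Qed.

Lemma germ_real_diff g z : germ false g z -> real_diff g z.
Proof.
move=> [D [oD Dz [h1 h2]]]; have Dz' : (@of_reals R n @^-1` D) (to_reals z).
  by rewrite /= to_realsK.
by split; [have [+ _] := h1 1%N|have [+ _] := h2 1%N]; apply.
Qed.

Lemma rdir_near_parts D g v : csmooth_on D g -> forall y, D y ->
  rdir v g y = ('d (re_part g) (to_reals y) (to_reals v) +i*
                'd (im_part g) (to_reals y) (to_reals v))%C.
Proof.
move=> [h1 h2] y Dy; rewrite rdirE//; have Dy' : (@of_reals R n @^-1` D) (to_reals y).
  by rewrite /= to_realsK.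
by split; [have [+ _] := h1 1%N|have [+ _] := h2 1%N]; apply.
Qed.

Lemma re_part_rdir D g v : csmooth_on D g -> forall p, (@of_reals R n @^-1` D) p ->
  re_part (rdir v g) p = 'd (re_part g) p (to_reals v).
Proof.
move=> H p Dp; rewrite -[LHS]/(complex.Re (rdir v g (of_reals p))).
by rewrite (rdir_near_parts v H Dp)/= of_realsK.
Qed.

Lemma im_part_rdir D g v : csmooth_on D g -> forall p, (@of_reals R n @^-1` D) p ->
  im_part (rdir v g) p = 'd (im_part g) p (to_reals v).
Proof.
move=> H p Dp; rewrite -[LHS]/(complex.Im (rdir v g (of_reals p))).
by rewrite (rdir_near_parts v H Dp)/= of_realsK.
Qed.

Lemma germ_rdir g z v : germ false g z -> germ false (rdir v g) z.
Proof.
move=> [D [oD Dz H]]; exists D; split => //; have oD' := open_of_reals oD.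
have [h1 h2] := H; split=> k.
  have [_ /(_ (to_reals v)) H'] := h1 k.+1.
  by apply: (Ck_eq oD' _ H') => p Dp; rewrite (re_part_rdir v H Dp).
have [_ /(_ (to_reals v)) H'] := h2 k.+1.
by apply: (Ck_eq oD' _ H') => p Dp; rewrite (im_part_rdir v H Dp).
Qed.

Lemma germ_pd_smooth g z X : germ false g z -> germ false (pd X g) z.
Proof.
move=> h; rewrite /pd.
apply: (germM (germ_cst false 2^-1 z)).
have h1 := germM (germ_cst false (- 'i) z) (germ_rdir ('i *: X) h).
apply: (germ_eq _ (germD (germ_rdir X h) h1)); near=> y; by rewrite mulNr.
Unshelve. all: by end_near. Qed.

Lemma rdir_comm g z v w : germ false g z -> rdir v (rdir w g) z = rdir w (rdir v g) z.
Proof.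
move=> h; have [D [oD Dz H]] := h.
have dw := germ_real_diff (germ_rdir w h); have dv := germ_real_diff (germ_rdir v h).
rewrite !rdirE//; have oD' := open_of_reals oD; have [h1 h2] := H.
have Dz' : (@of_reals R n @^-1` D) (to_reals z) by rewrite /= to_realsK.
congr Complex.
  apply: (etrans (diff_on_eq _ oD' Dz' (re_part_rdir w H) dw.1)).
  apply: (etrans _ (esym (diff_on_eq _ oD' Dz' (re_part_rdir v H) dv.1))).
  exact: (schwarz _ _ oD' Dz' (h1 2%N)).
apply: (etrans (diff_on_eq _ oD' Dz' (im_part_rdir w H) dw.2)).
apply: (etrans _ (esym (diff_on_eq _ oD' Dz' (im_part_rdir v H) dv.2))).
exact: (schwarz _ _ oD' Dz' (h2 2%N)).
Qed.

Lemma rdir_pd g z v X : germ false g z ->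
  rdir v (pd X g) z = 2^-1 * (rdir v (rdir X g) z - 'i * rdir v (rdir ('i *: X) g) z).
Proof.
move=> h; have d1 := germ_real_diff (germ_rdir X h).
have d2 := germ_real_diff (germ_rdir ('i *: X) h).
have [d3 e3] := real_diffM (real_diff_cst (- 'i) z) d2.
have [d4 e4] := real_diffD d1 d3.
have [_ e5] := real_diffM (real_diff_cst 2^-1 z) d4.
rewrite (_ : pd X g = fun y => 2^-1 * (rdir X g y + - 'i * rdir ('i *: X) g y)).
  by rewrite e5 e4 e3 (rdir_cst v (2^-1) z) (rdir_cst v (- 'i) z) !mulr0 !addr0 mulNr.
by apply/funext => y; rewrite /pd mulNr.
Qed.
Opaque pd.

Lemma wirtinger_sym (t i a b c d a' b' c' d' : C) :
  a = a' -> b = c' -> c = b' -> d = d' ->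
  t * (t * (a - i * b) - i * (t * (c - i * d))) =
  t * (t * (a' - i * b') - i * (t * (c' - i * d'))).
Proof. by move=> -> -> -> ->; ring. Qed.

(** Schwarz's theorem for the real and imaginary parts, for each of the four
    pairs of real directions. *)
Lemma pd_comm g z X Y : germ false g z -> pd X (pd Y g) z = pd Y (pd X g) z.
Proof.
move=> h; pose F (a b : C) := 2^-1 * (a - 'i * b).
apply: (etrans (pdE X (pd Y g) z)); apply: (etrans _ (esym (pdE Y (pd X g) z))).
apply: (etrans (congr2 F (rdir_pd X Y h) (rdir_pd ('i *: X) Y h))).
apply: (etrans _ (esym (congr2 F (rdir_pd Y X h) (rdir_pd ('i *: Y) X h)))).
exact: (wirtinger_sym _ _ (rdir_comm _ _ h) (rdir_comm _ _ h)
  (rdir_comm _ _ h) (rdir_comm _ _ h)).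
Qed.

Lemma hol_smooth b g z : germ b g z -> germ false g z.
Proof.
case: b; last exact id.
move=> [D [oD Dz H]]; exists D; split; [exact: oD|exact: Dz|].
split=> k.
  exact: (@Ck_transfer _ _ _ _ _ _ _ (of_reals_bounded R n) (Re_bounded R) k D g oD (H k)).
exact: (@Ck_transfer _ _ _ _ _ _ _ (of_reals_bounded R n) (Im_bounded R) k D g oD (H k)).
Qed.

Lemma rdir_hol g z v : differentiable g z -> rdir v g z = 'd g z v.
Proof.
move=> dg; have zE := to_realsK z; have vE := to_realsK v.
have dg' : differentiable g (of_reals (to_reals z)) by rewrite zE.
have [d1 e1] := diff_transfer (of_reals_bounded R n) (Re_bounded R) dg'.
have [d2 e2] := diff_transfer (of_reals_bounded R n) (Im_bounded R) dg'.
apply: (etrans (rdirE v (conj d1 d2))).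
have -> : 'd g z v = (complex.Re ('d g z v) +i* complex.Im ('d g z v))%C.
  by case: ('d g z v).
congr Complex; [apply: (etrans (e1 _))|apply: (etrans (e2 _))]; by rewrite vE zE.
Qed.

Lemma pd_hol g z X : differentiable g z -> pd X g z = 'd g z X.
Proof.
move=> dg; rewrite pdE (rdir_hol X dg) (rdir_hol ('i *: X) dg).
have -> : 'd g z ('i *: X) = 'i * ('d g z X : C) :> C by exact: linearZ.
move: ('d g z X : C) => a; rewrite mulrA -expr2 sqrCi mulN1r opprK -mulr2n.
by rewrite -[X in 2^-1 * X]mulr_natl mulKf// pnatr_eq0.
Qed.

Lemma germ_diff g z : germ true g z -> differentiable g z.
Proof. by move=> [D [_ Dz H]]; have [+ _] := H 1%N; apply. Qed.

Lemma germ_pd b g z X : germ b g z -> germ b (pd X g) z.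
Proof.
case: b; last exact: germ_pd_smooth.
move=> [D [oD Dz H]]; exists D; split => // k; have [h1 h2] := H k.+1.
by apply: (Ck_eq oD _ (h2 X)) => y Dy; rewrite pd_hol//; apply: h1.
Qed.

End germs.
End Wirtinger.

(** * Composition and inversion of germs *)

Lemma pair_ext (A B : Type) (p q : A * B) : p.1 = q.1 -> p.2 = q.2 -> p = q.
Proof. by case: p q => [a b] [c d] /= -> ->. Qed.

Section coords_systems.
Variable K : numFieldType.

Lemma rV_coord_linear n (j : 'I_n) :
  exists2 L : {linear 'rV[K]_n -> K^o}, L = (fun v => v ord0 j) :> (_ -> _) &
    continuous L.
Proof.
have lL : linear (fun v : 'rV[K]_n => (v ord0 j : K^o)).
  by move=> a u v; rewrite !mxE.
have [L LE] := ex_linear lL; exists L => //; rewrite LE.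
exact: coord_continuous.
Qed.

Lemma Ck_comp_rV (V : normedModType K) n k (D : set V) (D' : set 'rV[K]_n)
    (f : 'rV[K]_n -> K) (phi : V -> 'rV[K]_n) :
  open D -> open D' -> (forall x, D x -> D' (phi x)) ->
  Ck k D phi -> Ck k D' f -> Ck k D (f \o phi).
Proof.
have /choice[l lE] (j : 'I_n) : exists L : {linear 'rV[K]_n -> K^o},
    L = (fun v => v ord0 j) :> (_ -> _) /\ continuous L.
  by have [L] := rV_coord_linear j; exists L.
apply: (@Ck_comp _ _ _ _ (fun j => delta_mx ord0 j) l) => [j|w].
  by have [] := lE j.
rewrite {1}[w]row_sum_delta; apply: eq_bigr => j _.
by have [-> _] := lE j.
Qed.

Lemma Ck_comp_rV2 (V : normedModType K) n k (D : set V)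
    (D' : set ('rV[K]_n * 'rV[K]_n)%type)
    (f : ('rV[K]_n * 'rV[K]_n)%type -> K) (phi : V -> ('rV[K]_n * 'rV[K]_n)%type) :
  open D -> open D' -> (forall x, D x -> D' (phi x)) ->
  Ck k D phi -> Ck k D' f -> Ck k D (f \o phi).
Proof.
pose c (i : 'I_n + 'I_n) (p : ('rV[K]_n * 'rV[K]_n)%type) : K^o :=
  match i with inl j => p.1 ord0 j | inr j => p.2 ord0 j end.
pose e (i : 'I_n + 'I_n) : ('rV[K]_n * 'rV[K]_n)%type :=
  match i with inl j => (delta_mx ord0 j, 0) | inr j => (0, delta_mx ord0 j) end.
have /choice[l lE] (i : 'I_n + 'I_n) :
    exists L : {linear ('rV[K]_n * 'rV[K]_n)%type -> K^o},
    L = c i :> (_ -> _) /\ continuous L.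
  have lc : linear (c i) by case: i => j a u v; rewrite /= !mxE.
  have [L LE] := ex_linear lc; exists L; split => //; rewrite LE.
  case: i {L LE lc} => j p.
    by apply: (@continuous_comp _ _ _ fst (fun v : 'rV[K]_n => v ord0 j));
      [exact: cvg_fst|exact: coord_continuous].
  by apply: (@continuous_comp _ _ _ snd (fun v : 'rV[K]_n => v ord0 j));
      [exact: cvg_snd|exact: coord_continuous].
apply: (@Ck_comp _ _ _ _ e l) => [j|w]; first by have [] := lE j.
under eq_bigr => i _ do rewrite (lE i).1.
case: w => x y; rewrite big_sumType /=.
have A (a : 'I_n -> K) : \sum_j a j *: (delta_mx ord0 j, 0) =
    (\sum_j a j *: delta_mx ord0 j, 0) :> ('rV[K]_n * 'rV[K]_n)%type.
  elim/big_rec2: _ => // j p q _ ->.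
  by apply: pair_ext; rewrite /= ?scaler0 ?add0r.
have B (a : 'I_n -> K) : \sum_j a j *: (0, delta_mx ord0 j) =
    (0, \sum_j a j *: delta_mx ord0 j) :> ('rV[K]_n * 'rV[K]_n)%type.
  elim/big_rec2: _ => // j p q _ ->.
  by apply: pair_ext; rewrite /= ?scaler0 ?add0r.
rewrite A B {1}[x]row_sum_delta {1}[y]row_sum_delta.
by apply: pair_ext; rewrite /= ?addr0 ?add0r.
Qed.

End coords_systems.

Lemma open_preimage_on (T U : topologicalType) (D : set T) (D' : set U) (f : T -> U) :
  open D -> open D' -> (forall x, D x -> {for x, continuous f}) ->
  open (D `&` f @^-1` D').
Proof.
move=> oD oD' cf; rewrite openE => x [Dx Dfx].
apply: filterI; first exact: open_nbhs_nbhs.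
by apply: (cf x Dx); exact: open_nbhs_nbhs.
Qed.

Lemma dcomp_apply (K : numFieldType) (U V W : normedModType K) (f : U -> V)
    (g : V -> W) x v : differentiable f x -> differentiable g (f x) ->
  'd (g \o f) x v = 'd g (f x) ('d f x v).
Proof. by move=> df dg; rewrite (diff_comp df dg). Qed.

Lemma open_neq0 (K : numFieldType) : open [set c : K | c != 0].
Proof.
rewrite openE => x x0; rewrite /interior /=.
have nx : 0 < `|x| by rewrite normr_gt0.
near=> y; apply/eqP => y0.
have : `|x - y| < `|x|.
  near: y; have /cvgrPdist_lt := @cvg_id _ (nbhs x); exact.
by rewrite y0 subr0 ltxx.
Unshelve. all: by end_near. Qed.

Section comp.
Variable R : realType.
Local Notation C := R[i].
Variables m n : nat.
Implicit Types (phi : 'rV[C]_m -> 'rV[C]_n).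

Definition hol_map phi z : Prop := exists D, [/\ open D, D z & Coo D phi].

Lemma hol_map_diff phi z : hol_map phi z -> differentiable phi z.
Proof. by move=> [D [_ Dz H]]; have [+ _] := H 1%N; apply. Qed.

(** In the smooth case the real coordinates of [phi] are smooth by
    [Ck_transfer], and the real chain rule applies. *)
Lemma germ_comp b g phi z : hol_map phi z -> germ b g (phi z) ->
  germ b (g \o phi) z.
Proof.
move=> [D [oD Dz Hp]] [D' [oD' Dz' Hg]].
have oD2 : open (D `&` phi @^-1` D').
  exact: (open_preimage_on oD oD' (Hp 0%N)).
exists (D `&` phi @^-1` D'); split => //.
have Hp' k : Ck k (D `&` phi @^-1` D') phi by apply: CkW (Hp k) => y [].
case: b Hg => Hg.
  by move=> k; apply: (@Ck_comp_rV _ _ _ _ _ D') => // x [].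
have oR := open_of_reals oD2; have oR' := open_of_reals oD'.
have Hphi k := Ck_transfer (of_reals_bounded R m) (to_reals_bounded R n) oD2 (Hp' k).
have [h1 h2] := Hg.
have inc p : (@of_reals R m @^-1` (D `&` phi @^-1` D')) p ->
    (@of_reals R n @^-1` D') ((@to_reals R n \o phi \o @of_reals R m) p).
  by move=> [_ /=]; rewrite to_realsK.
by split=> k; [apply: (Ck_eq oR _ (Ck_comp_rV2 oR oR' inc (Hphi k) (h1 k)))|
             apply: (Ck_eq oR _ (Ck_comp_rV2 oR oR' inc (Hphi k) (h2 k)))];
  move=> p _; rewrite /re_part /im_part /= to_realsK.
Qed.

Lemma pd_comp g phi z X : hol_map phi z -> germ false g (phi z) ->
  pd X (g \o phi) z = pd ('d phi z X) g (phi z).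
Proof.
move=> /hol_map_diff dp /germ_real_diff dg.
suff H v : rdir v (g \o phi) z = rdir ('d phi z v) g (phi z).
  by rewrite !pdE !H linearZ.
have dp' : differentiable phi (of_reals (to_reals z)) by rewrite to_realsK.
have [dP eP] := diff_transfer (of_reals_bounded R m) (to_reals_bounded R n) dp'.
set P := _ \o phi \o _ in dP eP.
have E1 : re_part (g \o phi) = re_part g \o P.
  by apply/funext => p; rewrite /re_part /P /= to_realsK.
have E2 : im_part (g \o phi) = im_part g \o P.
  by apply/funext => p; rewrite /im_part /P /= to_realsK.
have PE : P (to_reals z) = to_reals (phi z) by rewrite /P /= to_realsK.
have [d1 d2] := dg.
have d1' : differentiable (re_part g) (P (to_reals z)) by rewrite PE.
have d2' : differentiable (im_part g) (P (to_reals z)) by rewrite PE.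
have dP1 : differentiable (re_part g \o P) (to_reals z) by exact: differentiable_comp.
have dP2 : differentiable (im_part g \o P) (to_reals z) by exact: differentiable_comp.
have dgp : real_diff (g \o phi) z by split; rewrite ?E1 ?E2.
have eP' : 'd P (to_reals z) (to_reals v) = to_reals ('d phi z v).
  by apply: (etrans (eP _)); rewrite !to_realsK.
apply: (etrans (rdirE v dgp)); apply: (etrans _ (esym (rdirE _ dg))); congr Complex.
  by rewrite E1; apply: (etrans (dcomp_apply _ dP d1')); rewrite eP' PE.
by rewrite E2; apply: (etrans (dcomp_apply _ dP d2')); rewrite eP' PE.
Qed.
End comp.

Section inv.
Variables (R : realType) (n : nat).
Local Notation C := R[i].
Lemma germ_inv (g : 'rV[C]_n -> C) z : germ true g z -> g z != 0 ->
  germ true (fun y => (g y)^-1) z.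
Proof.
move=> [D [oD Dz H]] gz; pose D' := D `&` g @^-1` [set c | c != 0].
have oD' : open D' by exact: (open_preimage_on oD (@open_neq0 _) (H 0%N)).
exists D'; split; [exact: oD'|by []|].
move=> k; apply: (Ck_inv oD'); first by move=> y [].
by apply: CkW (H k) => y [].
Qed.
End inv.

(** * Holomorphic maps between coordinate spaces *)

Section more_Ck.
Variables (K : numFieldType) (V W : normedModType K).

(** The class on a set is tested at each point, since differentiability and
    derivatives refer to full neighbourhoods in the ambient space. *)
Lemma Ck_pt k (D : set V) (f : V -> W) :
  (forall x, D x -> Ck k [set x] f) -> Ck k D f.
Proof.
elim: k f => [|k ih] f H; first by move=> x /H; apply.
split=> [x /H[h _]|v]; first exact: h.
by apply: ih => x /H[_ h]; exact: h.
Qed.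

Lemma Ck_affine k (D : set V) (c : W) (L : {linear V -> W}) : continuous L ->
  Ck k D (fun x => c + L x).
Proof.
move=> cL.
have dL x : is_diff x (fun x => c + L x) L.
  have dLx : is_diff x L L.
    by split; [exact: linear_differentiable|exact: diff_lin].
  by have := is_diffD (is_diff_cst c x) dLx; rewrite add0r.
case: k => [|k] /=.
  by move=> x _; apply: differentiable_continuous; exact: ex_diff.
split=> [x _|v]; first exact: ex_diff.
rewrite (_ : (fun x => _) = fun=> L v); first exact: Ck_cst.
by apply/funext => x; rewrite diff_val.
Qed.
Lemma rV_linear_continuous n (L : {linear 'rV[K]_n -> W}) : continuous L.
Proof.
have H : Ck 0 setT (fun v : 'rV[K]_n => \sum_j v ord0 j *: L (delta_mx ord0 j)).
  apply: Ck_sum; first exact: openT.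
  move=> j x _; apply: (@continuous_comp _ _ _ (fun v : 'rV[K]_n => v ord0 j)
    (fun c : K => c *: L (delta_mx ord0 j))); first exact: coord_continuous.
  exact: scalel_continuous.
rewrite (_ : L = (fun v => \sum_j v ord0 j *: L (delta_mx ord0 j)) :> (_ -> _)).
  by move=> x; exact: H.
apply/funext => v; rewrite {1}[v]row_sum_delta linear_sum.
by apply: eq_bigr => j _; rewrite linearZ.
Qed.
End more_Ck.

Section hol_maps.
Variable R : realType.
Local Notation C := R[i].

Lemma germ_trueP n (g : 'rV[C]_n -> C) z :
  germ true g z <-> \forall y \near z, forall k, Ck k [set y] g.
Proof.
split=> [[D [oD Dz H]]|H].
  near=> y; have Dy : D y by near: y; exact: (open_near oD Dz).
  by move=> k; apply: CkW (H k) => _ ->.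
exists [set y | forall k, Ck k [set y] g]°; split.
- exact: open_interior.
- exact: H.
- by move=> k; apply: Ck_pt => y /interior_subset.
Unshelve. all: by end_near. Qed.

Lemma hol_map_coords m n (phi : 'rV[C]_m -> 'rV[C]_n) z :
  (forall j, germ true (fun y => phi y ord0 j) z) -> hol_map phi z.
Proof.
move=> H; have H' : \forall y \near z, forall j k, Ck k [set y] (fun y => phi y ord0 j).
  have Hj j := (germ_trueP _ _).1 (H j).
  exact: (@filter_forall _ _ (fun j => [set y | forall k, Ck k [set y]
    (fun y => phi y ord0 j)]) (nbhs z) (nbhs_filter z) Hj).
pose D : set 'rV[C]_m := [set y | forall j k, Ck k [set y] (fun y => phi y ord0 j)]°.
have oD : open D by exact: open_interior.
exists D; split; [exact: oD|exact: H'|] => k.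
have /choice[L LE] (j : 'I_n) : exists L : {linear C^o -> 'rV[C]_n},
    L = (fun c => c *: delta_mx ord0 j) :> (_ -> _).
  by apply: ex_linear => a u v; rewrite scalerDl scalerA.
have Hj j : Ck k D (L j \o (fun y => phi y ord0 j)).
  apply: (Ck_linl oD); first by rewrite LE; exact: scalel_continuous.
  by apply: Ck_pt => y /interior_subset /(_ j k).
apply: (Ck_eq oD _ (Ck_sum (index_enum 'I_n) oD Hj)) => y _.
by rewrite [RHS]row_sum_delta; apply: eq_bigr => j _; rewrite /= LE.
Qed.

Lemma hol_map_coord m n (phi : 'rV[C]_m -> 'rV[C]_n) z j : hol_map phi z ->
  germ true (fun y => phi y ord0 j) z.
Proof.
move=> [D [oD Dz H]]; have [L LE cL] := @rV_coord_linear C n j.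
exists D; split; [exact: oD|exact: Dz|] => k.
by have := Ck_linl oD cL (H k); rewrite LE.
Qed.

Lemma hol_map_affine m n p (phi : 'rV[C]_n -> 'rV[C]_p) (c : 'rV[C]_n)
    (L : {linear 'rV[C]_m -> 'rV[C]_n}) z : continuous L ->
  hol_map phi (c + L z) -> hol_map (fun y => phi (c + L y)) z /\
  forall X, 'd (fun y => phi (c + L y)) z X = 'd phi (c + L z) (L X).
Proof.
move=> cL hp; have [D [oD Dz H]] := hp.
pose A y := c + L y; have dA : is_diff z A L.
  have dLx : is_diff z L L by split; [exact: linear_differentiable|exact: diff_lin].
  by have := is_diffD (is_diff_cst c z) dLx; rewrite add0r.
have cA : continuous A.
  by move=> y; apply: (@Ck_affine _ _ _ 0%N setT c L cL).
split.
  exists (A @^-1` D); split; [|exact: Dz|].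
  - by have /continuousP := cA; apply.
  - by move=> k; exact: (Ck_linr c oD cL (H k)).
have dp := hol_map_diff hp.
move=> X; apply: (etrans (@dcomp_apply _ _ _ _ A phi z X (@ex_diff _ _ _ _ _ _ _ dA) dp)).
by rewrite diff_val.
Qed.

Lemma hol_map_dir m n (phi : 'rV[C]_m -> 'rV[C]_n) z X : hol_map phi z ->
  hol_map (fun y => 'd phi y X) z.
Proof.
move=> [D [oD Dz H]]; exists D; split; [exact: oD|exact: Dz|] => k.
by have [_] := H k.+1; apply.
Qed.

Lemma pd_sum n (g : 'rV[C]_n -> C) z X : germ false g z ->
  pd X g z = \sum_j X ord0 j * pd (delta_mx ord0 j) g z.
Proof.
move=> /germ_real_diff dg.
have p0 : pd 0 g z = 0.
  have := pd_lin 1 0 0 dg; rewrite scale1r mul1r addr0.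
  by move/eqP; rewrite -subr_eq subrr eq_sym => /eqP.
rewrite {1}[X]row_sum_delta; elim/big_rec2: _ => [//|j y Y _ <-].
by rewrite pd_lin.
Qed.

End hol_maps.

(** * Germs and invariant vector fields on the group *)

Section group_germs.
Variables (R : realType) (G : complexLieGroup R).
Local Notation C := R[i].
Local Notation n := (lie_dim G).
Local Notation Cn := 'rV[C]_n.
Implicit Types (c : chart R G n) (f g : G -> C) (a x : G) (b s : bool).

Lemma chart_near (P : G -> Prop) c a : cdom c a ->
  (\forall x \near a, P x) -> \forall z \near cfun c a, P (cinv c z).
Proof.
move=> ca Pa; have := @cinv_continuous _ _ _ c (cfun c a) (imageP _ ca).
by rewrite /prop_for /continuous_at (cfunK ca) => h; exact: (h _ Pa).
Qed.

Lemma chart_near_pull (P : Cn -> Prop) c a : cdom c a ->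
  (\forall z \near cfun c a, P z) -> \forall x \near a, P (cfun c x).
Proof. by move=> ca Pa; exact: (@cfun_continuous _ _ _ c a ca _ Pa). Qed.

Lemma cdom_near c a : cdom c a -> \forall x \near a, cdom c x.
Proof. by move=> ca; exact: (open_near (@cdom_open _ _ _ c) ca). Qed.

Lemma cimg_near c a : cdom c a -> \forall z \near cfun c a, cimg c z.
Proof. by move=> ca; exact: (open_near (@cimg_open _ _ _ c) (imageP _ ca)). Qed.

Lemma cinvK c z : cimg c z -> cfun c (cinv c z) = z.
Proof. by move=> [x cx <-]; rewrite cfunK. Qed.

Lemma cimg_dom c z : cimg c z -> cdom c (cinv c z).
Proof. by move=> [x cx <-]; rewrite cfunK. Qed.

Lemma img_openE c (V : set G) :
  cfun c @` (cdom c `&` V) = cimg c `&` cinv c @^-1` V.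
Proof.
apply/seteqP; split=> [_ [x [cx Vx] <-]|z [[x cx <-]]].
  by split; [exact: imageP|rewrite /= cfunK].
by rewrite /= cfunK// => Vx; exists x.
Qed.

Lemma img_open c (V : set G) : open V -> open (cfun c @` (cdom c `&` V)).
Proof.
move=> oV; rewrite img_openE.
by apply: (open_preimage_on (@cimg_open _ _ _ c) oV) => z; exact: cinv_continuous.
Qed.

(** The chart is existentially quantified; by compatibility of charts
    ([germ_at_chart]) any chart around [a] gives the same notion. *)
Definition germ_at b f a : Prop := exists c,
  [/\ lie_atlas c, cdom c a & germ b (f \o cinv c) (cfun c a)].

Lemma transition_hol c c' a : lie_atlas c -> lie_atlas c' -> cdom c a ->
  cdom c' a -> hol_map (cfun c' \o cinv c) (cfun c a).
Proof.
move=> Ac Ac' ca c'a; exists (cfun c @` (cdom c `&` cdom c')); split.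
- exact/img_open/cdom_open.
- by exists a.
- exact: lie_compat.
Qed.

Lemma germ_at_chart b f a c : germ_at b f a -> lie_atlas c -> cdom c a ->
  germ b (f \o cinv c) (cfun c a).
Proof.
move=> [c0 [A0 c0a H]] Ac ca.
have h : germ b ((f \o cinv c0) \o (cfun c0 \o cinv c)) (cfun c a).
  by apply: germ_comp; [exact: transition_hol|rewrite /= cfunK].
apply: germ_eq h; have := chart_near ca (cdom_near c0a).
by apply: filterS => z /= h; rewrite cfunK.
Qed.

Lemma germ_at_near b f a : germ_at b f a -> \forall x \near a, germ_at b f x.
Proof.
move=> [c [Ac ca H]]; have := chart_near_pull ca (germ_near H).
by move=> h; near=> x; exists c; split; [exact: Ac|near: x; exact: cdom_near|near: x; exact: h].
Unshelve. all: by end_near. Qed.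

Lemma germ_at_eq b f g a : {near a, f =1 g} -> germ_at b f a -> germ_at b g a.
Proof.
move=> fg [c [Ac ca H]]; exists c; split; [exact: Ac|exact: ca|].
exact: (germ_eq (chart_near ca (fg : \forall x \near a, f x = g x)) H).
Qed.

Lemma germ_at_cst b (z : C) a : germ_at b (fun=> z) a.
Proof.
have [c [Ac ca]] := lie_cover a; exists c; split; [exact: Ac|exact: ca|].
exact: germ_cst.
Qed.

Lemma germ_atD b f g a : germ_at b f a -> germ_at b g a -> germ_at b (fun x => f x + g x) a.
Proof.
move=> [c [Ac ca H]] /germ_at_chart/(_ Ac ca) H'; exists c; split; [exact: Ac|exact: ca|].
exact: (germD H H').
Qed.

Lemma germ_atM b f g a : germ_at b f a -> germ_at b g a -> germ_at b (fun x => f x * g x) a.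
Proof.
move=> [c [Ac ca H]] /germ_at_chart/(_ Ac ca) H'; exists c; split; [exact: Ac|exact: ca|].
exact: (germM H H').
Qed.

Lemma germ_at_sum b (I : Type) (r : seq I) (F : I -> G -> C) a :
  (forall i, germ_at b (F i) a) -> germ_at b (fun x => \sum_(i <- r) F i x) a.
Proof.
move=> H; elim: r => [|i r ih].
  by apply: germ_at_eq (germ_at_cst b 0 a); near=> x; rewrite big_nil.
by apply: germ_at_eq (germ_atD (H i) ih); near=> x; rewrite big_cons.
Unshelve. all: by end_near. Qed.

Lemma germ_at_inv f a : germ_at true f a -> f a != 0 -> germ_at true (fun x => (f x)^-1) a.
Proof.
move=> [c [Ac ca H]] fa; exists c; split; [exact: Ac|exact: ca|].
by apply: (germ_inv H); rewrite /= cfunK.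
Qed.

Lemma germ_at_smooth b f a : germ_at b f a -> germ_at false f a.
Proof.
move=> [c [Ac ca H]]; exists c; split; [exact: Ac|exact: ca|exact: hol_smooth H].
Qed.

Lemma germ_at_coord c a j : lie_atlas c -> cdom c a ->
  germ_at true (fun x => cfun c x ord0 j) a.
Proof.
move=> Ac ca; exists c; split; [exact: Ac|exact: ca|].
exact: (hol_map_coord j (transition_hol Ac Ac ca ca)).
Qed.

Lemma germ_holomorphic (D : set Cn) (g : Cn -> C) :
  (forall z, D z -> germ true g z) -> Coo D g.
Proof.
move=> H k; apply: Ck_pt => z /H[D' [_ Dz H']].
by apply: CkW (H' k) => _ ->.
Qed.

Lemma germ_csmooth_on (D : set Cn) (g : Cn -> C) :
  (forall z, D z -> germ false g z) -> csmooth_on D g.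
Proof.
move=> H; split=> k; apply: Ck_pt => p /H[D' [_ Dz [h1 h2]]].
  by apply: CkW (h1 k) => _ ->.
by apply: CkW (h2 k) => _ ->.
Qed.

Lemma holomorphic_onP (V : set G) f : open V ->
  holomorphic_on V f <-> forall a, V a -> germ_at true f a.
Proof.
move=> oV; split=> [H a Va|H c Ac].
  have [c [Ac ca]] := lie_cover a; exists c; split; [exact: Ac|exact: ca|].
  exists (cfun c @` (cdom c `&` V)); split; [exact: img_open|by exists a|].
  exact: H.
by apply: germ_holomorphic => _ [x [cx Vx] <-]; exact: germ_at_chart (H x Vx) Ac cx.
Qed.

Lemma smooth_onP (V : set G) f : open V ->
  smooth_on V f <-> forall a, V a -> germ_at false f a.
Proof.
move=> oV; split=> [H a Va|H c Ac].
  have [c [Ac ca]] := lie_cover a; exists c; split; [exact: Ac|exact: ca|].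
  exists (cfun c @` (cdom c `&` V)); split; [exact: img_open|by exists a|].
  by have := H c Ac.
have := @germ_csmooth_on (cfun c @` (cdom c `&` V)) (f \o cinv c).
by apply => _ [x [cx Vx] <-]; exact: germ_at_chart (H x Vx) Ac cx.
Qed.

(** The left and the right translations are treated together: [s] selects
    the side. *)
Definition transl s (a x : G) : G := if s then (a * x)%g else (x * a)%g.

Lemma transl1 s a : transl s a 1%g = a.
Proof. by case: s; rewrite /transl ?mulg1 ?mul1g. Qed.
Lemma transl_unit s a : transl s 1%g a = a.
Proof. by case: s; rewrite /transl ?mulg1 ?mul1g. Qed.
Lemma translA s a x y : transl s a (transl s x y) = transl s (transl s a x) y.
Proof. by case: s; rewrite /transl mulgA. Qed.
Lemma translV s a x : transl s a (transl s a^-1%g x) = x.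
Proof. by case: s; rewrite /transl ?mulgA ?mulgV ?mul1g// -mulgA mulVg mulg1. Qed.

Lemma transl_continuous s : continuous (fun p : G * G => transl s p.1 p.2).
Proof.
case: s; first exact: lie_mul_continuous.
move=> p; have := @lie_mul_continuous _ G (p.2, p.1).
have sw : continuous (fun p : G * G => (p.2, p.1)).
  by move=> q; apply: cvg_pair; [exact: cvg_snd|exact: cvg_fst].
by move=> h; apply: (continuous_comp (sw p) h).
Qed.

Lemma transl_continuous2 s a : continuous (transl s a).
Proof.
move=> x; have h := @transl_continuous s (a, x).
have pr : continuous (fun x : G => (a, x)).
  by move=> q; apply: cvg_pair; [exact: cvg_cst|exact: cvg_id].
exact: (continuous_comp (pr x) h).
Qed.

(** Both factors are packed in a single row vector, so that partial
    derivatives in either factor are instances of [pd]. *)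
Definition mulrow s c1 c2 c3 (v : 'rV[C]_(n + n)) : Cn :=
  cfun c3 (transl s (cinv c1 (lsubmx v)) (cinv c2 (rsubmx v))).

Lemma mul_pair_open c1 c2 c3 :
  open [set p : Cn * Cn | [/\ cimg c1 p.1, cimg c2 p.2 &
          cdom c3 (cinv c1 p.1 * cinv c2 p.2)%g]].
Proof.
pose D : set (Cn * Cn) := [set p | cimg c1 p.1] `&` [set p | cimg c2 p.2].
have oD : open D.
  apply: openI.
    have /continuousP : continuous (@fst Cn Cn) by move=> p; exact: cvg_fst.
    by move=> /(_ _ (@cimg_open _ _ _ c1)).
  have /continuousP : continuous (@snd Cn Cn) by move=> p; exact: cvg_snd.
  by move=> /(_ _ (@cimg_open _ _ _ c2)).
have cF p : D p -> {for p, continuous (fun p : Cn * Cn => (cinv c1 p.1 * cinv c2 p.2)%g)}.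
  move=> [d1 d2].
  apply: (@continuous_comp _ _ _ (fun p : Cn * Cn => (cinv c1 p.1, cinv c2 p.2))
    (fun q : G * G => (q.1 * q.2)%g)).
    apply: cvg_pair => /=.
      by apply: (@continuous_comp _ _ _ fst (cinv c1)); [exact: cvg_fst|exact: cinv_continuous].
    by apply: (@continuous_comp _ _ _ snd (cinv c2)); [exact: cvg_snd|exact: cinv_continuous].
  exact: lie_mul_continuous.
have := open_preimage_on oD (@cdom_open _ _ _ c3) cF.
by congr (open _); apply/seteqP; split=> p [] => [[]|] *; split.
Qed.

Lemma mul_pair_hol m (L : {linear 'rV[C]_m -> (Cn * Cn)%type}) z c1 c2 c3 a1 a2 :
  continuous L -> L z = (cfun c1 a1, cfun c2 a2) ->
  lie_atlas c1 -> lie_atlas c2 -> lie_atlas c3 ->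
  cdom c1 a1 -> cdom c2 a2 -> cdom c3 (a1 * a2)%g ->
  hol_map (fun v => cfun c3 (cinv c1 (L v).1 * cinv c2 (L v).2)%g) z.
Proof.
move=> cL Lz A1 A2 A3 d1 d2 d3.
have H := lie_mul_holomorphic A1 A2 A3; have oS := @mul_pair_open c1 c2 c3.
set S := [set p | _] in H oS.
exists (L @^-1` S); split.
- by have /continuousP := cL; apply.
- rewrite /S /= Lz /=; split; [exact: imageP|exact: imageP|by rewrite !cfunK].
- move=> k; have := Ck_linr 0 oS cL (H k).
  have E v : 0 + L v = L v by rewrite add0r.
  rewrite (_ : [set x | S (0 + L x)] = L @^-1` S); last first.
    by apply/seteqP; split=> v; rewrite /preimage /= E.
  by under eq_fun do rewrite E.
Qed.

Lemma mulrow_hol s c1 c2 c3 a1 a2 :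
  lie_atlas c1 -> lie_atlas c2 -> lie_atlas c3 ->
  cdom c1 a1 -> cdom c2 a2 -> cdom c3 (transl s a1 a2) ->
  hol_map (mulrow s c1 c2 c3) (row_mx (cfun c1 a1) (cfun c2 a2)).
Proof.
move=> A1 A2 A3 d1 d2.
case: s => d3.
  have [|L LE] := @ex_linear C 'rV[C]_(n + n) (Cn * Cn)%type (fun v => (lsubmx v, rsubmx v)).
    by move=> a u v; rewrite !linearP.
  have := @mul_pair_hol _ L (row_mx (cfun c1 a1) (cfun c2 a2)) c1 c2 c3 a1 a2.
  by rewrite LE row_mxKl row_mxKr; apply => //; rewrite -LE; exact: rV_linear_continuous.
have [|L LE] := @ex_linear C 'rV[C]_(n + n) (Cn * Cn)%type (fun v => (rsubmx v, lsubmx v)).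
  by move=> a u v; rewrite !linearP.
have := @mul_pair_hol _ L (row_mx (cfun c1 a1) (cfun c2 a2)) c2 c1 c3 a2 a1.
by rewrite LE row_mxKl row_mxKr; apply => //; rewrite -LE; exact: rV_linear_continuous.
Qed.

Lemma row_slice_l m (phi : 'rV[C]_(n + n) -> 'rV[C]_m) (z w : Cn) :
  hol_map phi (row_mx z w) -> hol_map (fun y => phi (row_mx y w)) z /\
  forall X, 'd (fun y => phi (row_mx y w)) z X = 'd phi (row_mx z w) (row_mx X 0).
Proof.
have [|L LE] := @ex_linear C Cn 'rV[C]_(n + n) (fun v => row_mx v 0).
  by move=> a u v; rewrite scale_row_mx add_row_mx scaler0 addr0.
have E y : row_mx y w = row_mx 0 w + L y by rewrite LE add_row_mx add0r addr0.
rewrite E => /(hol_map_affine (@rV_linear_continuous _ _ _ L))[h1 h2].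
have -> : (fun y => phi (row_mx y w)) = (fun y => phi (row_mx 0 w + L y)).
  by apply/funext => y; rewrite E.
by split => // X; rewrite h2 LE.
Qed.

Lemma row_slice_r m (phi : 'rV[C]_(n + n) -> 'rV[C]_m) (z w : Cn) :
  hol_map phi (row_mx z w) -> hol_map (fun y => phi (row_mx z y)) w /\
  forall X, 'd (fun y => phi (row_mx z y)) w X = 'd phi (row_mx z w) (row_mx 0 X).
Proof.
have [|L LE] := @ex_linear C Cn 'rV[C]_(n + n) (fun v => row_mx 0 v).
  by move=> a u v; rewrite scale_row_mx add_row_mx scaler0 addr0.
have E y : row_mx z y = row_mx z 0 + L y by rewrite LE add_row_mx add0r addr0.
rewrite E => /(hol_map_affine (@rV_linear_continuous _ _ _ L))[h1 h2].
have -> : (fun y => phi (row_mx z y)) = (fun y => phi (row_mx z 0 + L y)).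
  by apply/funext => y; rewrite E.
by split => // X; rewrite h2 LE.
Qed.

Lemma germ_at_translate b s f a0 a : germ_at b f (transl s a0 a) ->
  germ_at b (fun x => f (transl s a0 x)) a.
Proof.
move=> H; have [c0 [A0 d0]] := lie_cover a0; have [c [A d]] := lie_cover a.
have [c3 [A3 d3]] := lie_cover (transl s a0 a).
have [hm _] := row_slice_r (mulrow_hol A0 A A3 d0 d d3).
exists c; split; [exact: A|exact: d|].
have E : (mulrow s c0 c c3 (row_mx (cfun c0 a0) (cfun c a))) = cfun c3 (transl s a0 a).
  by rewrite /mulrow row_mxKl row_mxKr !cfunK.
have h : germ b ((f \o cinv c3) \o (fun y => mulrow s c0 c c3 (row_mx (cfun c0 a0) y))) (cfun c a).
  by apply: (germ_comp hm); rewrite E; exact: germ_at_chart H A3 d3.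
apply: germ_eq h.
have := chart_near d (@transl_continuous2 s a0 a _ (cdom_near d3)).
by apply: filterS => z /= dz; rewrite /mulrow row_mxKl row_mxKr cfunK// cfunK.
Qed.

(** Left invariant for [s = true], right invariant for [s = false]. *)
Definition ifield s (X : lie_algebra G) f a : C :=
  tangent_derive X (fun x => f (transl s a x)).

Lemma left_ifield X f : left_invariant X f = ifield true X f.
Proof. by []. Qed.
Lemma right_ifield X f : right_invariant X f = ifield false X f.
Proof. by []. Qed.

Local Notation u := (unit_chart G).
Local Notation u1 := (cfun (unit_chart G) 1%g).

Lemma unit_chartP : lie_atlas u /\ cdom u 1%g.
Proof. by rewrite /unit_chart; case: cid. Qed.
Let Au : lie_atlas u := unit_chartP.1.
Let d1 : cdom u 1%g := unit_chartP.2.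

Lemma tangent_deriveE X f : tangent_derive X f = pd X (f \o cinv u) u1.
Proof. by rewrite pdE. Qed.

Lemma tangent_derive_near X f g : {near (1%g : G), f =1 g} ->
  tangent_derive X f = tangent_derive X g.
Proof.
move=> fg; rewrite !tangent_deriveE; apply: pd_near.
exact: (chart_near d1 (fg : \forall x \near (1%g : G), f x = g x)).
Qed.

(** The field is [sum_j xi_j d_j] in the chart [c], where [xi] is the
    derivative of the multiplication in the other factor at the unit. *)
Definition ifield_coef s (X : lie_algebra G) c (z : Cn) : Cn :=
  'd (mulrow s c u c) (row_mx z u1) (row_mx 0 X).

Lemma ifield_coef_hol s X c a j : lie_atlas c -> cdom c a ->
  germ true (fun z => ifield_coef s X c z ord0 j) (cfun c a).
Proof.
move=> A d; have d' : cdom c (transl s a 1%g) by rewrite transl1.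
have h := hol_map_dir (row_mx 0 X) (mulrow_hol A Au A d d1 d').
exact: (hol_map_coord j (row_slice_l h).1).
Qed.

(** Differentiate [f] composed with the multiplication in charts, at the unit of
    the second factor, by the chain rule. *)
Lemma ifieldE s X f c a : germ_at false f a -> lie_atlas c -> cdom c a ->
  ifield s X f a = pd (ifield_coef s X c (cfun c a)) (f \o cinv c) (cfun c a).
Proof.
move=> H A d; have d' : cdom c (transl s a 1%g) by rewrite transl1.
rewrite /ifield tangent_deriveE.
have [hm he] := row_slice_r (mulrow_hol A Au A d d1 d').
have E : mulrow s c u c (row_mx (cfun c a) u1) = cfun c a.
  by rewrite /mulrow row_mxKl row_mxKr !cfunK// transl1.
have h : germ false (f \o cinv c) (mulrow s c u c (row_mx (cfun c a) u1)).
  by rewrite E; exact: germ_at_chart H A d.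
have := pd_comp X hm h; rewrite he E => <-.
apply: pd_near; have := chart_near d1 (@transl_continuous2 s a 1%g _ (cdom_near d')).
by apply: filterS => z /= dz; rewrite /mulrow row_mxKl row_mxKr cfunK// cfunK.
Qed.

Lemma ifield_sum s X f c a : germ_at false f a -> lie_atlas c -> cdom c a ->
  ifield s X f a = \sum_j ifield_coef s X c (cfun c a) ord0 j *
                   pd (delta_mx ord0 j) (f \o cinv c) (cfun c a).
Proof. by move=> H A d; rewrite (ifieldE s X H A d) (pd_sum _ (germ_at_chart H A d)). Qed.

Lemma ifield_sum_near s X f c a : germ_at false f a -> lie_atlas c -> cdom c a ->
  \forall z \near cfun c a, ifield s X f (cinv c z) =
     \sum_j ifield_coef s X c z ord0 j * pd (delta_mx ord0 j) (f \o cinv c) z.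
Proof.
move=> H A d; have h1 := chart_near d (germ_at_near H); have h2 := cimg_near d.
near=> z; have zi : cimg c z by near: z; exact: h2.
have fz : germ_at false f (cinv c z) by near: z; exact: h1.
by rewrite (ifield_sum s X fz A (cimg_dom zi)) (cinvK zi).
Unshelve. all: by end_near. Qed.

Lemma germ_sum m b (I : Type) (r : seq I) (F : I -> 'rV[C]_m -> C) z :
  (forall i, germ b (F i) z) -> germ b (fun y => \sum_(i <- r) F i y) z.
Proof.
move=> H; elim: r => [|i r ih].
  by apply: germ_eq (germ_cst b 0 z); near=> x; rewrite big_nil.
by apply: germ_eq (germD (H i) ih); near=> x; rewrite big_cons.
Unshelve. all: by end_near. Qed.

Lemma germ_true_any m b (g : 'rV[C]_m -> C) z : germ true g z -> germ b g z.
Proof. by case: b => h; [exact: h|exact: hol_smooth h]. Qed.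

(** In a chart the field has holomorphic coefficients, so it preserves both
    classes of functions. *)
Lemma germ_at_ifield b s X f a : germ_at b f a -> germ_at b (ifield s X f) a.
Proof.
move=> H; have [c [A d]] := lie_cover a.
exists c; split; [exact: A|exact: d|].
have h j : germ b (fun z => ifield_coef s X c z ord0 j * pd (delta_mx ord0 j) (f \o cinv c) z) (cfun c a).
  apply: germM; first exact: germ_true_any (ifield_coef_hol s X j A d).
  exact: germ_pd (germ_at_chart H A d).
apply: germ_eq (germ_sum (index_enum 'I_n) h).
have := ifield_sum_near s X (germ_at_smooth H) A d.
by apply: filterS => z /= ->.
Qed.

Lemma ifield_near s X f g a : {near a, f =1 g} -> ifield s X f a = ifield s X g a.
Proof.
move=> fg; apply: tangent_derive_near.
have := @transl_continuous2 s a 1%g; rewrite /continuous_at transl1 => h.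
exact: (h _ (fg : \forall x \near a, f x = g x)).
Qed.

End group_germs.

(** * Left and right invariant fields commute *)

Section fields.
Variables (R : realType) (G : complexLieGroup R).
Local Notation C := R[i].
Local Notation n := (lie_dim G).
Local Notation Cn := 'rV[C]_n.
Local Notation u := (unit_chart G).
Local Notation u1 := (cfun (unit_chart G) 1%g).
Local Notation g := (lie_algebra G).
Local Notation td := (@tangent_derive R G).
Implicit Types (c : chart R G n) (f k : G -> C) (a x : G) (b s : bool) (X Y : g).

Let Au : lie_atlas u := (unit_chartP G).1.
Let d1 : cdom u 1%g := (unit_chartP G).2.

Lemma germ_at_germ1 b f : germ_at b f 1%g -> germ b (f \o cinv u) u1.
Proof. by move=> H; exact: germ_at_chart H Au d1. Qed.

Lemma td_linX (z : C) X Y f : germ_at false f 1%g ->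
  td (z *: X + Y) f = z * td X f + td Y f.
Proof.
move=> H; rewrite !tangent_deriveE; apply: pd_lin.
exact: germ_real_diff (germ_at_germ1 H).
Qed.

Lemma tdD X f k : germ_at false f 1%g -> germ_at false k 1%g ->
  td X (fun x => f x + k x) = td X f + td X k.
Proof.
move=> H H'; rewrite !tangent_deriveE.
exact: (pdD X (germ_real_diff (germ_at_germ1 H)) (germ_real_diff (germ_at_germ1 H'))).
Qed.

Lemma tdM X f k : germ_at false f 1%g -> germ_at false k 1%g ->
  td X (fun x => f x * k x) = f 1%g * td X k + k 1%g * td X f.
Proof.
move=> H H'; rewrite !tangent_deriveE.
have := pdM X (germ_real_diff (germ_at_germ1 H)) (germ_real_diff (germ_at_germ1 H')).
by rewrite /= cfunK.
Qed.

Lemma td_cst X (z : C) : td X (fun=> z) = 0.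
Proof. by rewrite tangent_deriveE; exact: pd_cst. Qed.

Lemma td_sum X (I : Type) (r : seq I) (F : I -> G -> C) :
  (forall i, germ_at false (F i) 1%g) ->
  td X (fun x => \sum_(i <- r) F i x) = \sum_(i <- r) td X (F i).
Proof.
move=> H; elim: r => [|i r ih].
  rewrite big_nil; apply: etrans (td_cst X 0); congr (td X _).
  by apply/funext => x; rewrite big_nil.
rewrite big_cons -ih; apply: etrans (tdD X (H i) (germ_at_sum r H)).
by congr (td X _); apply/funext => x; rewrite big_cons.
Qed.

Lemma germ_at_tr s f a : germ_at false f a -> germ_at false (fun x => f (transl s a x)) 1%g.
Proof. by move=> H; apply: germ_at_translate; rewrite transl1. Qed.

Lemma ifield_linX s (z : C) X Y f a : germ_at false f a ->
  ifield s (z *: X + Y) f a = z * ifield s X f a + ifield s Y f a.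
Proof. by move=> H; apply: td_linX; exact: germ_at_tr. Qed.

Lemma ifieldD s X f k a : germ_at false f a -> germ_at false k a ->
  ifield s X (fun x => f x + k x) a = ifield s X f a + ifield s X k a.
Proof. by move=> H H'; apply: (tdD X (germ_at_tr s H) (germ_at_tr s H')). Qed.

Lemma ifieldM s X f k a : germ_at false f a -> germ_at false k a ->
  ifield s X (fun x => f x * k x) a = f a * ifield s X k a + k a * ifield s X f a.
Proof.
move=> H H'; have := tdM X (germ_at_tr s H) (germ_at_tr s H').
by rewrite transl1.
Qed.

Lemma ifield_cst s X (z : C) a : ifield s X (fun=> z) a = 0.
Proof. exact: td_cst. Qed.

Lemma ifield1 s X f : ifield s X f 1%g = td X f.
Proof. by congr (td _ _); apply/funext => x; rewrite transl_unit. Qed.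

Lemma ifield_tr s X f a x : ifield s X (fun y => f (transl s a y)) x = ifield s X f (transl s a x).
Proof. by congr (td _ _); apply/funext => y; rewrite translA. Qed.

Lemma hol_map_near m p (phi : 'rV[C]_m -> 'rV[C]_p) z (P : 'rV[C]_p -> Prop) :
  hol_map phi z -> (\forall y \near phi z, P y) -> \forall y \near z, P (phi y).
Proof. by move=> /hol_map_diff/differentiable_continuous h H; exact: (h _ H). Qed.

Lemma hol_map_id m (z : 'rV[C]_m) : hol_map id z.
Proof.
exists setT; split; [exact: openT|by []|] => k.
have [L LE] := @ex_linear C 'rV[C]_m 'rV[C]_m id (fun _ _ _ => erefl).
have := @Ck_affine _ _ _ k setT 0 L (@rV_linear_continuous _ _ _ L).
by rewrite LE; under eq_fun do rewrite add0r.
Qed.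

Lemma diff_id m (z X : 'rV[C]_m) : 'd id z X = X.
Proof. by rewrite (@diff_val _ _ _ _ _ _ _ (is_diff_id z)). Qed.

Lemma pd_row_l (H : 'rV[C]_(n + n) -> C) (z w Y : Cn) :
  germ false H (row_mx z w) ->
  pd Y (fun y => H (row_mx y w)) z = pd (row_mx Y 0) H (row_mx z w).
Proof.
move=> h; have [hm he] := row_slice_l (hol_map_id (row_mx z w)).
apply: (etrans (pd_comp Y hm h)); by rewrite he diff_id.
Qed.

Lemma pd_row_r (H : 'rV[C]_(n + n) -> C) (z w Y : Cn) :
  germ false H (row_mx z w) ->
  pd Y (fun y => H (row_mx z y)) w = pd (row_mx 0 Y) H (row_mx z w).
Proof.
move=> h; have [hm he] := row_slice_r (hol_map_id (row_mx z w)).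
apply: (etrans (pd_comp Y hm h)); by rewrite he diff_id.
Qed.

(** Let [H (z, w) = f (z w)] in charts around [a] and [1]. The right invariant
    field differentiates [H] in a direction tangent to the first factor, the
    left invariant one in a direction tangent to the second factor, and such
    derivatives commute by [pd_comm]. *)
Lemma ifield_comm X Y f a : germ_at false f a ->
  ifield true X (ifield false Y f) a = ifield false Y (ifield true X f) a.
Proof.
move=> Hf; have [c [A d]] := lie_cover a.
pose H (v : 'rV[C]_(n + n)) := f (cinv c (lsubmx v) * cinv u (rsubmx v))%g.
have d' : cdom c (transl true a 1%g) by rewrite transl1.
have hm := mulrow_hol A Au A d d1 d'.
have E : mulrow true c u c (row_mx (cfun c a) u1) = cfun c a.
  by rewrite /mulrow row_mxKl row_mxKr !cfunK// transl1.
have HG : germ false H (row_mx (cfun c a) u1).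
  have h : germ false ((f \o cinv c) \o mulrow true c u c) (row_mx (cfun c a) u1).
    by apply: (germ_comp hm); rewrite E; exact: germ_at_chart Hf A d.
  apply: germ_eq h.
  pose P v := cdom c (cinv c (lsubmx v) * cinv u (rsubmx v))%g.
  suff : \forall v \near row_mx (cfun c a) u1, P v.
    by apply: filterS => v Pv; rewrite /mulrow /= cfunK.
  have ml : {for row_mx (cfun c a) u1, continuous (fun v : 'rV[C]_(n + n) => cinv c (lsubmx v))}.
    apply: (@continuous_comp _ _ _ (@lsubmx C 1 n n) (cinv c)).
      exact: continuous_lsubmx.
    by rewrite row_mxKl; apply: cinv_continuous; exact: imageP.
  have mr : {for row_mx (cfun c a) u1, continuous (fun v : 'rV[C]_(n + n) => cinv u (rsubmx v))}.
    apply: (@continuous_comp _ _ _ (@rsubmx C 1 n n) (cinv u)).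
      exact: continuous_rsubmx.
    by rewrite row_mxKr; apply: cinv_continuous; exact: imageP.
  have := @continuous_comp _ _ _ (fun v => (cinv c (lsubmx v), cinv u (rsubmx v)))
    (fun p : G * G => (p.1 * p.2)%g) (row_mx (cfun c a) u1) _ (@lie_mul_continuous _ G _).
  move=> /(_ (cvg_pair ml mr)) cc; apply: (cc).
  rewrite /= row_mxKl row_mxKr !cfunK// mulg1.
  exact: cdom_near.
pose eta := ifield_coef false Y c (cfun c a).
have [sl _] := row_slice_l (hol_map_id (row_mx (cfun c a) u1)).
have [sr _] := row_slice_r (hol_map_id (row_mx (cfun c a) u1)).
have nl := hol_map_near sl (germ_near HG); have nr := hol_map_near sr (germ_near HG).
(* For [w] fixed the right field at [a w] differentiates [H] in the first factor,
   in the direction [eta] that does not depend on [w]. *)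
have L : ifield true X (ifield false Y f) a =
    pd (row_mx 0 X) (pd (row_mx eta 0) H) (row_mx (cfun c a) u1).
  rewrite -(pd_row_r X (germ_pd (row_mx eta 0) HG)) /ifield tangent_deriveE; apply: pd_near.
  have nf : \forall w \near u1, germ_at false f (a * cinv u w)%g.
    have := @transl_continuous2 _ G true a 1%g; rewrite /continuous_at transl1 => h.
    exact: (chart_near d1 (h _ (germ_at_near Hf))).
  near=> w; have fw : germ_at false f (transl false (cinv u w) a) by near: w; exact: nf.
  have gw : germ false H (row_mx (cfun c a) w) by near: w; exact: nr.
  rewrite -(pd_row_l eta gw) /=.
  rewrite (_ : (fun y => H _) = (fun y => f (transl false (cinv u w) y)) \o cinv c); last first.
    by apply/funext => y; rewrite /H /= row_mxKl row_mxKr.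
  rewrite -(ifieldE false Y (germ_at_translate fw) A d) /ifield; congr (td _ _).
  by apply/funext => y; rewrite /transl mulgA.
apply: (etrans L); apply: (etrans (pd_comm _ _ HG)).
apply: (etrans (esym (pd_row_l eta (germ_pd (row_mx 0 X) HG)))).
apply: (etrans _ (esym (ifieldE false Y (germ_at_ifield true X Hf) A d))); apply: pd_near.
near=> z; have gz : germ false H (row_mx z u1) by near: z; exact: nl.
apply: (etrans (esym (pd_row_r X gz))).
apply: (etrans _ (esym (tangent_deriveE X (fun x => f (transl true (cinv c z) x))))).
congr (pd X _ u1); by apply/funext => w; rewrite /H row_mxKl row_mxKr.
Unshelve. all: by end_near. Qed.

End fields.

(** * Brackets of invariant fields and the adjoint action *)

Opaque ifield germ_at tangent_derive.

Section bracket.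
Variables (R : realType) (G : complexLieGroup R).
Local Notation C := R[i].
Local Notation n := (lie_dim G).
Local Notation Cn := 'rV[C]_n.
Local Notation u := (unit_chart G).
Local Notation u1 := (cfun (unit_chart G) 1%g).
Local Notation g := (lie_algebra G).
Local Notation td := (@tangent_derive R G).
Local Notation br := (@lie_bracket R G).
Implicit Types (c : chart R G n) (f : G -> C) (a x : G) (b s : bool) (X Y : g).

Let Au : lie_atlas u := (unit_chartP G).1.
Let d1 : cdom u 1%g := (unit_chartP G).2.

Definition ucoord (j : 'I_n) : G -> C := fun x => cfun u x ord0 j.

Lemma ucoord_hol b j : germ_at b (ucoord j) 1%g.
Proof.
have h := germ_at_coord j Au d1; case: b; first exact: h.
exact: germ_at_smooth h.
Qed.

Lemma pd_bigsum m (I : Type) (r : seq I) (F : I -> 'rV[C]_m -> C) z v :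
  (forall i, germ false (F i) z) ->
  pd v (fun y => \sum_(i <- r) F i y) z = \sum_(i <- r) pd v (F i) z.
Proof.
move=> H; elim: r => [|i r ih].
  rewrite big_nil; apply: etrans (pd_cst v 0 z); congr (pd v _ z).
  by apply/funext => x; rewrite big_nil.
rewrite big_cons -ih.
apply: etrans (pdD v (germ_real_diff (H i)) (germ_real_diff (germ_sum r H))).
by congr (pd v _ z); apply/funext => x; rewrite big_cons.
Qed.

(** Second order terms are symmetric in [X] and [Y] after exchanging the two
    derivatives, so that only the first order terms will survive in the
    commutator. *)
Lemma ifield_ifield s X Y f : germ_at false f 1%g ->
  let F := f \o cinv u in
  let xi := ifield_coef s X u in let eta := ifield_coef s Y u in
  ifield s X (ifield s Y f) 1%g = pd (eta u1) (pd (xi u1) F) u1 +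
    \sum_k pd (delta_mx ord0 k) F u1 * pd (xi u1) (fun z => eta z ord0 k) u1.
Proof.
move=> Hf F xi eta; have HF : germ false F u1 := germ_at_germ1 Hf.
rewrite (ifieldE s X (germ_at_ifield s Y Hf) Au d1) -/(xi u1).
have he k : germ false (fun z => eta z ord0 k) u1.
  by apply: germ_true_any; exact: ifield_coef_hol Au d1.
have hp k : germ false (pd (delta_mx ord0 k) F) u1 by exact: germ_pd.
apply: (etrans (pd_near (xi u1) (ifield_sum_near s Y Hf Au d1))).
apply: (etrans (pd_bigsum (index_enum 'I_n) (xi u1) (fun k => germM (he k) (hp k)))).
under eq_bigr => k _ do
  rewrite (pdM (xi u1) (germ_real_diff (he k)) (germ_real_diff (hp k))).
rewrite big_split /=; congr (_ + _).
rewrite (pd_sum (eta u1) (germ_pd (xi u1) HF)); apply: eq_bigr => k _.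
exact: (congr1 (fun t => eta u1 ord0 k * t) (pd_comm (xi u1) (delta_mx ord0 k) HF)).
Qed.

(** The commutator of two fields is a derivation, hence is determined by its
    values on the coordinate functions. *)
Lemma ifield_bracket1 s X Y f : germ_at false f 1%g ->
  ifield s X (ifield s Y f) 1%g - ifield s Y (ifield s X f) 1%g =
  td (\row_j (ifield s X (ifield s Y (ucoord j)) 1%g - ifield s Y (ifield s X (ucoord j)) 1%g)) f.
Proof.
move=> Hf; pose xi := ifield_coef s X u; pose eta := ifield_coef s Y u.
pose K k := pd (xi u1) (fun z => eta z ord0 k) u1 - pd (eta u1) (fun z => xi z ord0 k) u1.
have E h : germ_at false h 1%g -> ifield s X (ifield s Y h) 1%g - ifield s Y (ifield s X h) 1%g =
    \sum_k pd (delta_mx ord0 k) (h \o cinv u) u1 * K k.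
  move=> Hh; rewrite (ifield_ifield s X Y Hh) (ifield_ifield s Y X Hh) -/xi -/eta.
  rewrite (pd_comm (eta u1) (xi u1) (germ_at_germ1 Hh)) opprD addrACA subrr add0r.
  by rewrite -sumrB; apply: eq_bigr => k _; rewrite -mulrBr.
apply: (etrans (E f Hf)); apply: (etrans _ (esym (tangent_deriveE _ f))).
apply: (etrans _ (esym (pd_sum _ (germ_at_germ1 Hf)))); apply: eq_bigr => k _.
rewrite mulrC; apply: (congr1 (fun t => t * _)); rewrite mxE.
apply: (etrans _ (esym (E (ucoord k) (ucoord_hol false k)))).
have D j : pd (delta_mx ord0 j) (ucoord k \o cinv u) u1 = (j == k)%:R.
  have nE : {near u1, ucoord k \o cinv u =1 (fun z : Cn => z ord0 k)}.
    by apply: filterS (cimg_near d1) => z zi; rewrite /ucoord /= cinvK.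
  have [L LE cL] := @rV_coord_linear C n k.
  apply: (etrans (pd_near _ nE)); rewrite -LE.
  have dL : differentiable (L : Cn -> C) u1 by exact: linear_differentiable.
  apply: (etrans (pd_hol _ dL)); rewrite diff_lin// LE mxE eqxx /=.
  by rewrite eq_sym.
rewrite (bigD1 k)//= D eqxx mul1r big1 ?addr0// => j /negbTE jk.
by rewrite D jk mul0r.
Qed.

Lemma td_bracket X Y f : germ_at false f 1%g ->
  td (br X Y) f = ifield true X (ifield true Y f) 1%g - ifield true Y (ifield true X f) 1%g.
Proof.
move=> Hf; rewrite (ifield_bracket1 true X Y Hf).
by congr (td _ f); apply/rowP => j; rewrite !mxE.
Qed.

Lemma td_coord X j : td X (ucoord j) = X ord0 j.
Proof.
have nE : {near u1, ucoord j \o cinv u =1 (fun z : Cn => z ord0 j)}.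
  by apply: filterS (cimg_near d1) => z zi; rewrite /ucoord /= cinvK.
have [L LE cL] := @rV_coord_linear C n j.
rewrite tangent_deriveE; apply: (etrans (pd_near _ nE)); rewrite -LE.
have dL : differentiable (L : Cn -> C) u1 by exact: linear_differentiable.
by apply: (etrans (pd_hol _ dL)); rewrite diff_lin// LE.
Qed.

Lemma td_inj X Y : (forall f, germ_at false f 1%g -> td X f = td Y f) -> X = Y.
Proof.
by move=> H; apply/rowP => j; rewrite -!td_coord; apply: H; exact: ucoord_hol.
Qed.

Lemma ifield_tr_fun s X f a : ifield s X (fun y => f (transl s a y)) = (fun x => ifield s X f (transl s a x)).
Proof. by apply/funext => x; exact: ifield_tr. Qed.

Lemma ifield_at s X f a : ifield s X f a = ifield s X (fun y => f (transl s a y)) 1%g.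
Proof. by rewrite ifield_tr transl1. Qed.

Lemma ifield_ifield_at s X Y f a :
  ifield s X (ifield s Y f) a = ifield s X (ifield s Y (fun y => f (transl s a y))) 1%g.
Proof.
exact: (etrans (ifield_at s X (ifield s Y f) a)
  (congr1 (fun h => ifield s X h 1%g) (esym (ifield_tr_fun s Y f a)))).
Qed.

(** Both sides commute with left translations, so it suffices to compare them at
    the unit, where this is the definition of the bracket. *)
Lemma left_bracket X Y f a : germ_at false f a ->
  ifield true (br X Y) f a = ifield true X (ifield true Y f) a - ifield true Y (ifield true X f) a.
Proof.
move=> Hf; have Hf' := germ_at_tr true Hf.
rewrite (ifield_ifield_at true X Y f a) (ifield_ifield_at true Y X f a).
apply: (etrans _ (td_bracket X Y Hf')).
exact: (etrans (ifield_at true (br X Y) f a) (ifield1 true _ _)).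
Qed.

(** At the unit the left and right fields of a vector agree, and the two kinds
    commute; hence exchanging the order of two right fields turns them into
    left fields, and the commutator changes sign. *)
Lemma right_bracket X Y f a : germ_at false f a ->
  ifield false (br X Y) f a =
  - (ifield false X (ifield false Y f) a - ifield false Y (ifield false X f) a).
Proof.
move=> Hf; have Hf' := germ_at_tr false Hf.
have S (Z W : g) (h : G -> C) : germ_at false h 1%g ->
    ifield false Z (ifield false W h) 1%g = ifield true W (ifield true Z h) 1%g.
  move=> Hh; rewrite (ifield1 false Z) -(ifield1 true Z) (ifield_comm Z W Hh).
  by rewrite (ifield1 false W) (ifield1 true W).
rewrite (ifield_ifield_at false X Y f a) (ifield_ifield_at false Y X f a).
rewrite (S X Y _ Hf') (S Y X _ Hf') opprB.
apply: (etrans _ (td_bracket X Y Hf')).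
exact: (etrans (ifield_at false (br X Y) f a) (ifield1 false _ _)).
Qed.

Definition conjg_fun a f : G -> C := fun x => f (a * x * a^-1)%g.

(** [Ad_a X], in the coordinates at the unit: the derivative of conjugation. *)
Definition Adv a X : g := \row_j td X (conjg_fun a (ucoord j)).

Lemma AdvE a X j : Adv a X ord0 j = td X (conjg_fun a (ucoord j)).
Proof. by rewrite mxE. Qed.

Lemma conjg_funE a f : conjg_fun a f =
  (fun x => (fun y => f (transl true a y)) (transl false a^-1%g x)).
Proof. by apply/funext => x; rewrite /conjg_fun /transl mulgA. Qed.

Lemma germ_at_conj b a f x : germ_at b f (a * x * a^-1)%g -> germ_at b (conjg_fun a f) x.
Proof.
move=> H; rewrite conjg_funE; apply: (@germ_at_translate _ _ b false (fun y => f (transl true a y))).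
by apply: germ_at_translate; rewrite /transl mulgA.
Qed.

Lemma conj1 a : (a * 1 * a^-1)%g = 1%g.
Proof. by rewrite mulg1 mulgV. Qed.

Lemma td_Adv a X f : germ_at false f 1%g -> td X (conjg_fun a f) = td (Adv a X) f.
Proof.
move=> Hf.
pose phi (z : Cn) : Cn := cfun u (a * cinv u z * a^-1)%g.
have hj j : germ true (fun z => phi z ord0 j) u1.
  apply: (germ_at_germ1 (f := conjg_fun a (ucoord j))).
  by apply: germ_at_conj; rewrite conj1; exact: ucoord_hol.
have hphi := hol_map_coords hj.
have phi1 : phi u1 = u1 by rewrite /phi cfunK// conj1.
have HF : germ false (f \o cinv u) (phi u1) by rewrite phi1; exact: germ_at_germ1.
rewrite tangent_deriveE; transitivity (pd X ((f \o cinv u) \o phi) u1).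
  apply: pd_near.
  have ca : {for (1%g : G), continuous (fun x : G => a * x * a^-1)%g}.
    have := @continuous_comp _ _ _ (transl true a) (transl false a^-1%g) (1%g : G)
      (@transl_continuous2 _ G true a 1%g) (@transl_continuous2 _ G false a^-1%g _).
    by [].
  have := @cdom_near _ _ u 1%g d1; rewrite -{1}(conj1 a) => /ca h.
  have := chart_near d1 h; apply: filterS => z /= dz.
  by rewrite /phi cfunK.
apply: (etrans (pd_comp X hphi HF)).
suff -> : 'd phi u1 X = Adv a X by rewrite phi1; exact: (esym (tangent_deriveE _ f)).
apply/rowP => j; rewrite [RHS]mxE.
have [L LE cL] := @rV_coord_linear C n j.
have [dL eL] := diff_linl cL (hol_map_diff hphi).
have LE' : L \o phi = (fun z => phi z ord0 j) by rewrite LE.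
apply: (etrans _ (esym (tangent_deriveE X (conjg_fun a (ucoord j))))).
apply: (etrans _ (esym (pd_hol X (germ_diff (hj j))))).
by apply: (etrans (esym _) (congr1 (fun h : Cn -> C => 'd h u1 X) LE')); rewrite eL LE.
Qed.

End bracket.

(** * The adjoint representation is holomorphic *)

Opaque Adv lie_bracket.

Section adjoint.
Variables (R : realType) (G : complexLieGroup R).
Local Notation C := R[i].
Local Notation n := (lie_dim G).
Local Notation Cn := 'rV[C]_n.
Local Notation u := (unit_chart G).
Local Notation u1 := (cfun (unit_chart G) 1%g).
Local Notation g := (lie_algebra G).
Local Notation td := (@tangent_derive R G).
Local Notation br := (@lie_bracket R G).
Implicit Types (c : chart R G n) (f : G -> C) (a x : G) (b s : bool) (X Y : g).

Let Au : lie_atlas u := (unit_chartP G).1.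
Let d1 : cdom u 1%g := (unit_chartP G).2.

Lemma germ_at_conj1 b a f : germ_at b f 1%g -> germ_at b (conjg_fun a f) 1%g.
Proof. by move=> H; apply: germ_at_conj; rewrite conj1. Qed.

Lemma Adv_linear a (z : C) X Y : Adv a (z *: X + Y) = z *: Adv a X + Adv a Y.
Proof.
apply/rowP => j; have E (v w : Cn) : (z *: v + w) ord0 j = z * v ord0 j + w ord0 j.
  by rewrite !mxE.
apply: (etrans (AdvE a _ j)); apply: (etrans _ (esym (E _ _))).
apply: (etrans _ (esym (congr2 (fun p q => z * p + q) (AdvE a X j) (AdvE a Y j)))).
exact: (td_linX z X Y (germ_at_conj1 a (ucoord_hol false j))).
Qed.

Lemma Adv_mul a x X : Adv (a * x)%g X = Adv a (Adv x X).
Proof.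
apply: td_inj => f Hf; rewrite -(td_Adv (a * x)%g X Hf) -(td_Adv a (Adv x X) Hf).
rewrite -(td_Adv x X (germ_at_conj1 a Hf)); congr (td X _).
apply/funext => y; rewrite /conjg_fun; congr (f _).
by rewrite invgM !mulgA.
Qed.

Lemma Adv1 X : Adv 1%g X = X.
Proof.
apply: td_inj => f Hf; rewrite -(td_Adv 1%g X Hf); congr (td X _).
by apply/funext => y; rewrite /conjg_fun invg1 mulg1 mul1g.
Qed.

Lemma conj_continuous a x : {for x, continuous (fun y : G => a * y * a^-1)%g}.
Proof.
have := @continuous_comp _ _ _ (transl true a) (transl false a^-1%g) x
  (@transl_continuous2 _ G true a x) (@transl_continuous2 _ G false a^-1%g _).
exact.
Qed.

Lemma left_conj a X f x : germ_at false f (a * x * a^-1)%g ->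
  ifield true X (conjg_fun a f) x = conjg_fun a (ifield true (Adv a X) f) x.
Proof.
move=> Hf; rewrite /conjg_fun (ifield_at true (Adv a X) f) ifield1.
rewrite -(td_Adv a X (germ_at_tr true Hf)) ifield_at ifield1; congr (td X _).
apply/funext => y; rewrite /conjg_fun /transl; congr (f _).
by rewrite !mulgA; congr (_ * _)%g; rewrite -!mulgA; congr (_ * (_ * _))%g; rewrite mulKg.
Qed.

(** Conjugation by [a] carries the left invariant field of [X] to that of
    [Ad_a X] ([left_conj]), hence commutators to commutators. *)
Lemma Adv_bracket a X Y : Adv a (br X Y) = br (Adv a X) (Adv a Y).
Proof.
apply: td_inj => f Hf; rewrite -(td_Adv a (br X Y) Hf).
have K Z W : ifield true Z (ifield true W (conjg_fun a f)) 1%g =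
    ifield true (Adv a Z) (ifield true (Adv a W) f) 1%g.
  transitivity (ifield true Z (conjg_fun a (ifield true (Adv a W) f)) 1%g).
    apply: ifield_near; have Hn := germ_at_near Hf.
    rewrite -(conj1 a) in Hn; have Hn' := @conj_continuous a 1%g _ Hn.
    by near=> x; apply: left_conj; near: x; exact: Hn'.
  have H2 : germ_at false (ifield true (Adv a W) f) (a * 1 * a^-1)%g.
    by rewrite conj1; exact: germ_at_ifield.
  by rewrite (left_conj Z H2) /conjg_fun conj1.
apply: (etrans (td_bracket X Y (germ_at_conj1 a Hf))).
apply: (etrans _ (esym (td_bracket (Adv a X) (Adv a Y) Hf))).
exact: (congr2 (fun p q => p - q) (K X Y) (K Y X)).
Unshelve. all: by end_near. Qed.

(** Since [x a = a (a^-1 x a)], translating on the right by [a] is conjugating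
    by [a^-1] and translating on the left. This is what lets the left action
    be rewritten at each point in terms of the right action. *)
Lemma right_leftE X f a : germ_at false f a ->
  ifield false X f a = ifield true (Adv a^-1%g X) f a.
Proof.
move=> Hf; rewrite (ifield_at true) ifield1 -(td_Adv a^-1%g X (germ_at_tr true Hf)).
rewrite ifield_at ifield1; congr (td X _); apply/funext => y.
rewrite /conjg_fun /transl; congr (f _).
by rewrite invgK !mulgA mulgV mul1g.
Qed.

Lemma ifield_basis s X f a : germ_at false f a ->
  ifield s X f a = \sum_j X ord0 j * ifield s (delta_mx ord0 j : g) f a.
Proof.
move=> Hf; have p0 : ifield s (0 : g) f a = 0.
  have := ifield_linX s 1 0 0 Hf; rewrite scale1r mul1r addr0.
  by move/eqP; rewrite -subr_eq subrr eq_sym => /eqP.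
rewrite {1}[X]row_sum_delta; elim/big_rec2: _ => [//|j y Y _ <-].
exact: ifield_linX.
Qed.

Lemma germ_at_continuous f a : germ_at true f a -> {for a, continuous f}.
Proof.
move=> H; have [c [A d]] := lie_cover a.
have cF := differentiable_continuous (germ_diff (germ_at_chart H A d)).
have cc := @continuous_comp _ _ _ (cfun c) (f \o cinv c) a
  (cfun_continuous d) cF.
have E : {near a, (f \o cinv c) \o cfun c =1 f}.
  by have := cdom_near d; apply: filterS => x dx; rewrite /= cfunK.
have Ea : ((f \o cinv c) \o cfun c) a = f a by rewrite /= (cfunK d).
rewrite /prop_for /continuous_at -[X in _ --> X]Ea.
exact: (cvg_trans (near_eq_cvg E) cc).
Qed.

Lemma germ_at_prod b (I : Type) (r : seq I) (F : I -> G -> C) a :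
  (forall i, germ_at b (F i) a) -> germ_at b (fun x => \prod_(i <- r) F i x) a.
Proof.
move=> H; elim: r => [|i r ih].
  by apply: germ_at_eq (germ_at_cst b 1 a); near=> x; rewrite big_nil.
by apply: germ_at_eq (germ_atM (H i) ih); near=> x; rewrite big_cons.
Unshelve. all: by end_near. Qed.

Lemma germ_at_det b m (M : G -> 'M[C]_m) a :
  (forall i j, germ_at b (fun x => M x i j) a) -> germ_at b (fun x => \det (M x)) a.
Proof.
move=> H; apply: (@germ_at_sum _ _ b _ _ (fun (s : 'S_m) x => (-1) ^+ s * \prod_i M x i (s i))).
move=> s; apply: germ_atM; first exact: germ_at_cst.
exact: germ_at_prod.
Qed.

(** The values at [a] of the left invariant fields of a basis, in coordinates,
    form a holomorphic matrix [M a] with [M 1 = 1]. The coordinates of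
    [Ad_(a^-1) X] solve the linear system with matrix [M a] whose right-hand
    side is the right invariant field of [X], so that Cramer's rule expresses
    them as a quotient of holomorphic functions near [1]. *)
Lemma Adv_inv_hol X j : germ_at true (fun a => Adv a^-1%g X ord0 j) 1%g.
Proof.
pose M a : 'M[C]_n := \matrix_(i, j) ifield true (delta_mx ord0 j : g) (@ucoord R G i) a.
pose N a : 'cV[C]_n := \col_i ifield false X (@ucoord R G i) a.
have HM i k : germ_at true (fun a => M a i k) 1%g.
  apply: germ_at_eq (germ_at_ifield true (delta_mx ord0 k : g) (ucoord_hol true i)).
  by near=> x; rewrite mxE.
have HN i k : germ_at true (fun a => N a i k) 1%g.
  apply: germ_at_eq (germ_at_ifield false X (ucoord_hol true i)).
  by near=> x; rewrite mxE.
have Hdet := germ_at_det HM.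
have M1 : M 1%g = 1%:M.
  by apply/matrixP => i k; rewrite !mxE ifield1 td_coord mxE eqxx /= eq_sym.
have det1 : \det (M 1%g) != 0 by rewrite M1 det1 oner_neq0.
have Hadj i k : germ_at true (fun a => (\adj (M a)) i k) 1%g.
  apply: (@germ_at_eq _ _ _ (fun a => (-1) ^+ (k + i) * \det (row' k (col' i (M a))))).
    by near=> x; rewrite mxE.
  apply: germ_atM; first exact: germ_at_cst.
  apply: germ_at_det => p q.
  apply: germ_at_eq (HM (lift k p) (lift i q)).
  by near=> x; rewrite !mxE.
have near1 : \forall a \near (1%g : G), \det (M a) != 0 /\
    forall i, germ_at false (@ucoord R G i) a.
  have hd : \forall a \near (1%g : G), \det (M a) != 0.
    exact: (germ_at_continuous Hdet (open_near (@open_neq0 _) det1)).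
  have hf : \forall a \near (1%g : G), forall i, germ_at false (@ucoord R G i) a.
    apply: (@filter_forall _ _ (fun i => [set a | germ_at false (@ucoord R G i) a])
      _ (nbhs_filter (1%g : G))) => i.
    exact: germ_at_near (ucoord_hol false i).
  by near=> a; split; near: a.
apply: (@germ_at_eq _ _ _ (fun a => (\det (M a))^-1 * \sum_k (\adj (M a)) j k * N a k ord0)).
  apply: filterS near1 => a [da Ha].
  have E : M a *m (Adv a^-1%g X)^T = N a.
    apply/matrixP => i k; rewrite !mxE (right_leftE X (Ha i)).
    rewrite (ifield_basis true _ (Ha i)); apply: eq_bigr => l _.
    by rewrite !mxE mulrC.
  have := congr1 (fun B => (\adj (M a) *m B) j ord0) E.
  rewrite mulmxA mul_adj_mx mul_scalar_mx !mxE => <-.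
  by rewrite mulKf.
apply: germ_atM; first exact: (germ_at_inv Hdet).
by apply: germ_at_sum => k; exact: germ_atM.
Unshelve. all: by end_near. Qed.

(** Differentiate at [1] along [Y] the identity [X^r x_j = sum_k A_k e_k x_j], where
    [X^r] is the right field of [X], the [e_k] are left fields and [A] is
    [Ad_(a^-1) X]. As left and right fields commute this gives
    [X Y x_j = Y X x_j + Y A_j] at [1]. *)
Lemma td_Adv_inv X Y j :
  td Y (fun a => Adv a^-1%g X ord0 j) = - br Y X ord0 j.
Proof.
pose A k a := Adv a^-1%g X ord0 k.
have HA k : germ_at false (A k) 1%g by exact: germ_at_smooth (Adv_inv_hol X k).
have Hx := ucoord_hol false j.
have E : {near (1%g : G), ifield false X (@ucoord R G j) =1
    (fun a => \sum_k A k a * ifield true (delta_mx ord0 k : g) (@ucoord R G j) a)}.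
  have := germ_at_near Hx; apply: filterS => a Ha.
  by rewrite (right_leftE X Ha) (ifield_basis true _ Ha).
have HF k : germ_at false (ifield true (delta_mx ord0 k : g) (@ucoord R G j)) 1%g.
  exact: germ_at_ifield.
pose e k : g := delta_mx ord0 k.
have A1 k : A k 1%g = X ord0 k by rewrite /A invg1 Adv1.
have E2 := etrans (tangent_derive_near Y E)
  (td_sum Y (index_enum 'I_n) (fun k => germ_atM (HA k) (HF k))).
have E2' : td Y (ifield false X (@ucoord R G j)) =
    \sum_k A k 1%g * td Y (ifield true (e k) (@ucoord R G j)) +
    \sum_k ifield true (e k) (@ucoord R G j) 1%g * td Y (A k).
  rewrite -big_split; apply: (etrans E2); apply: eq_bigr => k _.
  exact: (tdM Y (HA k) (HF k)).
have S1 : td Y (ifield true X (@ucoord R G j)) =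
    \sum_k A k 1%g * td Y (ifield true (e k) (@ucoord R G j)).
  have E3 : {near (1%g : G), ifield true X (@ucoord R G j) =1
      (fun a => \sum_k X ord0 k * ifield true (delta_mx ord0 k : g) (@ucoord R G j) a)}.
    by have := germ_at_near Hx; apply: filterS => a Ha; exact: ifield_basis.
  apply: (etrans (tangent_derive_near Y E3)).
  apply: (etrans (td_sum Y (index_enum 'I_n) (fun k => germ_atM (germ_at_cst false (X ord0 k) _) (HF k)))).
  apply: eq_bigr => k _; apply: (etrans (tdM Y (germ_at_cst false (X ord0 k) _) (HF k))).
  by rewrite (td_cst Y (X ord0 k)) mulr0 addr0 (A1 k).
have S2 : \sum_k ifield true (e k) (@ucoord R G j) 1%g * td Y (A k) = td Y (A j).
  have D k : ifield true (e k) (@ucoord R G j) 1%g = (k == j)%:R.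
    apply: (etrans (ifield1 true (e k) _)); apply: (etrans (td_coord (e k) j)).
    by rewrite mxE eqxx /= eq_sym.
  rewrite (bigD1 j)//= D eqxx mul1r big1 ?addr0// => k kj.
  by rewrite D (negbTE kj) mul0r.
have C1 : td Y (ifield false X (@ucoord R G j)) = td X (ifield true Y (@ucoord R G j)).
  apply: (etrans (esym (ifield1 true Y _))); apply: (etrans (ifield_comm Y X Hx)).
  exact: (ifield1 false X).
have B : br Y X ord0 j = td Y (ifield true X (@ucoord R G j)) - td X (ifield true Y (@ucoord R G j)).
  apply: (etrans (esym (td_coord _ j))); apply: (etrans (td_bracket Y X Hx)).
  exact: (congr2 (fun p q => p - q) (ifield1 true Y _) (ifield1 true X _)).
rewrite B -C1 E2' -S1 S2 opprB; move: (td Y _) (td Y _) => p q.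
by rewrite addrC addKr.
Qed.

End adjoint.

(** * Functions annihilated by the invariant fields *)

(** Mean value theorem along segments. *)
Lemma zero_diff_constant (R : realType) (E : normedModType R) (h : E -> R) p0 :
  (\forall p \near p0, differentiable h p /\ forall v, 'd h p v = 0) ->
  \forall p \near p0, h p = h p0.
Proof.
move=> /nbhs_ballP[r /= r0 rD]; apply/nbhs_ballP; exists r => //= p pr.
have inb (s : R) : 0 <= s <= 1 -> ball p0 r (p0 + s *: (p - p0)).
  move=> /andP[s0 s1]; rewrite -ball_normE /= opprD addrA subrr add0r normrN normrZ.
  rewrite ger0_norm//; move: pr; rewrite -ball_normE /= distrC; apply: le_lt_trans.
  by rewrite -[leRHS]mul1r ler_wpM2r.
have [|s s01 E1] := @line_MVT R E h p0 (p - p0) 1 ltr01.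
  by move=> s /inb /rD[].
have pE : p0 + (p - p0) = p by rewrite addrC subrK.
move: E1; rewrite scale1r pE (rD _ (inb s s01)).2 mulr0 => /eqP.
by rewrite subr_eq0 => /eqP.
Qed.

Section constancy.
Variables (R : realType) (G : complexLieGroup R).
Local Notation C := R[i].
Local Notation n := (lie_dim G).
Local Notation Cn := 'rV[C]_n.
Local Notation E := ('rV[R]_n * 'rV[R]_n)%type.
Local Notation u := (unit_chart G).
Local Notation u1 := (cfun (unit_chart G) 1%g).
Local Notation g := (lie_algebra G).
Local Notation td := (@tangent_derive R G).
Implicit Types (c : chart R G n) (q f : G -> C) (a x : G).

Let Au : lie_atlas u := (unit_chartP G).1.
Let d1 : cdom u 1%g := (unit_chartP G).2.

(** Right translation by [a^-1] is a local isomorphism from a neighbourhood of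
    [a] to a neighbourhood of [1], so that every coordinate derivative at [a]
    is the value of a right invariant field. *)
Lemma pd_ifield q a c (v : Cn) : germ_at false q a -> lie_atlas c -> cdom c a ->
  exists X : g, pd v (q \o cinv c) (cfun c a) = ifield false X q a.
Proof.
move=> Hq A d; pose psi (z : Cn) : Cn := cfun u (transl false a^-1%g (cinv c z)).
have E1 : transl false a^-1%g a = 1%g by rewrite /transl mulgV.
have hj j : germ true (fun z => psi z ord0 j) (cfun c a).
  apply: (@germ_at_chart R G true (fun x => @ucoord R G j (transl false a^-1%g x)) a c _ A d).
  by apply: germ_at_translate; rewrite E1; exact: ucoord_hol.
have hpsi := hol_map_coords hj.
have psi1 : psi (cfun c a) = u1 by rewrite /psi cfunK// E1.
exists ('d psi (cfun c a) v).
have HQ := germ_at_germ1 (germ_at_tr false Hq).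
have HQ' : germ false ((fun x => q (transl false a x)) \o cinv u) (psi (cfun c a)).
  by rewrite psi1.
apply: (etrans _ (esym (tangent_deriveE _ (fun x => q (transl false a x))))).
apply: (etrans _ (congr1 (pd ('d psi (cfun c a) v) ((fun x => q (transl false a x)) \o cinv u)) psi1)).
apply: (etrans _ (pd_comp v hpsi HQ')).
apply: pd_near.
have ca := @transl_continuous2 R G false a^-1%g a.
have h := cdom_near d1; rewrite -{1}E1 in h.
have := chart_near d (ca _ h); apply: filterS => z /= dz.
rewrite /psi (cfunK dz); congr (q _).
by rewrite /transl -mulgA mulVg mulg1.
Qed.

Lemma ifield_zero_near q a : (forall x, germ_at true q x) ->
  (forall X x, ifield false X q x = 0) -> \forall x \near a, q x = q a.
Proof.
move=> Hq Zq; have [c [A d]] := lie_cover a.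
pose F := q \o cinv c.
have nF : \forall z \near cfun c a, germ true F z /\ forall v, pd v F z = 0.
  have h := cimg_near d; near=> z; have zi : cimg c z by near: z; exact: h.
  have dz := cimg_dom zi; have zE := cinvK zi.
  split; first by rewrite -zE; exact: (germ_at_chart (Hq _) A dz).
  move=> v; rewrite -zE.
  by have [X ->] := pd_ifield v (germ_at_smooth (Hq (cinv c z))) A dz; exact: Zq.
have nR : \forall p \near to_reals (cfun c a),
    [/\ real_diff F (of_reals p), forall v, 'd (re_part F) p v = 0 &
        forall v, 'd (im_part F) p v = 0].
  have cr := @real_bounded_continuous _ _ _ _ (of_reals_bounded R n) (to_reals (cfun c a)).
  rewrite /continuous_at to_realsK in cr.
  have nF' : \forall p \near to_reals (cfun c a),
    germ true F (of_reals p) /\ forall v, pd v F (of_reals p) = 0 := cr _ nF.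
  near=> p; have [gp zp] : germ true F (of_reals p) /\ forall v, pd v F (of_reals p) = 0.
    by near: p; exact: nF'.
  have rd := germ_real_diff (hol_smooth gp).
  have Z v : rdir v F (of_reals p) = 0.
    by rewrite (rdir_hol v (germ_diff gp)) -(pd_hol v (germ_diff gp)) zp.
  have P v : ('d (re_part F) p v +i* 'd (im_part F) p v)%C = 0.
    by have := rdirE (of_reals v) rd; rewrite Z (of_realsK p) (of_realsK v) => <-.
  by split => // v; have := P v => -[].
have dE h p : differentiable h (to_reals (of_reals p)) -> differentiable (h : E -> R) p.
  by rewrite of_realsK.
have n1 : \forall p \near to_reals (cfun c a), re_part F p = re_part F (to_reals (cfun c a)).
  apply: zero_diff_constant; move: nR; apply: filterS => p [[r1 r2] z1 z2].
  by split => //; exact: dE.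
have n2 : \forall p \near to_reals (cfun c a), im_part F p = im_part F (to_reals (cfun c a)).
  apply: zero_diff_constant; move: nR; apply: filterS => p [[r1 r2] z1 z2].
  by split => //; exact: dE.
have cr := @bounded_real_continuous _ _ _ _ (to_reals_bounded R n) (cfun c a).
have n3 : \forall z \near cfun c a, F z = q a.
  have m1 : \forall z \near cfun c a,
    re_part F (to_reals z) = re_part F (to_reals (cfun c a)) := cr _ n1.
  have m2 : \forall z \near cfun c a,
    im_part F (to_reals z) = im_part F (to_reals (cfun c a)) := cr _ n2.
  near=> z; have e1 : re_part F (to_reals z) = re_part F (to_reals (cfun c a)).
    by near: z; exact: m1.
  have e2 : im_part F (to_reals z) = im_part F (to_reals (cfun c a)).
    by near: z; exact: m2.
  have P1 w : re_part F (to_reals w) = complex.Re (F w) by rewrite /re_part /= to_realsK.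
  have P2 w : im_part F (to_reals w) = complex.Im (F w) by rewrite /im_part /= to_realsK.
  have FA : F (cfun c a) = q a by rewrite /F /= (cfunK d).
  rewrite (P1 z) (P1 (cfun c a)) FA in e1; rewrite (P2 z) (P2 (cfun c a)) FA in e2.
  by apply/eqP; rewrite eq_complex e1 e2 !eqxx.
have n4 : \forall x \near a, F (cfun c x) = q a := chart_near_pull d n3.
have n5 := cdom_near d; near=> x.
have dx : cdom c x by near: x; exact: n5.
have <- : F (cfun c x) = q a by near: x; exact: n4.
by rewrite /F /= (cfunK dx).
Unshelve. all: by end_near. Qed.

(** The set where [q] takes its value at [1] is open because [q] is locally
    constant, and so is its complement. *)
Lemma connected_constant q : connected [set: G] -> (forall x, germ_at true q x) ->
  (forall X x, ifield false X q x = 0) -> forall a, q a = q 1%g.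
Proof.
move=> cG Hq Zq a.
have cq : continuous q by move=> x; exact: germ_at_continuous (Hq x).
pose B := [set x | q x = q 1%g].
suff : B = setT by move=> BT; have : B a by rewrite BT.
apply: cG; first by exists 1%g.
- exists B; last by rewrite setTI.
  rewrite openE => x Bx; rewrite /interior.
  by have := ifield_zero_near x Hq Zq; apply: filterS => y; rewrite /B /= => ->.
- exists B; last by rewrite setTI.
  rewrite -(setCK B); apply: open_closedC; rewrite openE => x Bx; rewrite /interior.
  by have := ifield_zero_near x Hq Zq; apply: filterS => y; rewrite /B /= => ->.
Qed.
End constancy.

(** * Sections over an open set *)

Section sections.
Variables (R : realType) (G : complexLieGroup R).
Local Notation C := R[i].
Local Notation n := (lie_dim G).
Local Notation g := (lie_algebra G).
Local Notation td := (@tangent_derive R G).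
Implicit Types (f k p q : G -> C) (a x : G) (V W : set G) (cls : function_class).

Lemma restrT V f a : V a -> restr V f a = f a.
Proof. by move=> Va; rewrite /restr patchT// inE. Qed.
Lemma restrC V f a : ~ V a -> restr V f a = 0.
Proof. by move=> Va; rewrite /restr patchC// inE. Qed.

Lemma restr_near V f a : open V -> V a -> {near a, restr V f =1 f}.
Proof.
move=> oV Va; near=> x; apply: restrT; near: x; exact: (open_near oV Va).
Unshelve. all: by end_near. Qed.

Lemma regular_hol p a : regular p -> germ_at true p a.
Proof.
elim=> [N rho i j [_ _ H]|z|f k _ hf _ hk|f k _ hf _ hk].
- exact: ((holomorphic_onP _ openT).1 (H i j) a I).
- exact: germ_at_cst.
- exact: germ_atD.
- exact: germ_atM.
Qed.

Lemma regular_sum (I : Type) (r : seq I) (F : I -> G -> C) :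
  (forall i, regular (F i)) -> regular (fun x => \sum_(i <- r) F i x).
Proof.
move=> H; elim: r => [|i r ih].
  by rewrite (_ : (fun x => _) = fun=> 0); [exact: regular_cst|apply/funext => x; rewrite big_nil].
rewrite (_ : (fun x => _) = fun x => F i x + \sum_(i <- r) F i x); first exact: regular_add.
by apply/funext => x; rewrite big_cons.
Qed.

(** A matrix coefficient satisfies [rho (a x) = rho a rho x], so that its
    derivative along an invariant field is a combination of matrix coefficients
    of the same representation with coefficients the derivatives at [1]. *)
Lemma regular_ifield s (X : g) p : regular p -> regular (ifield s X p).
Proof.
elim=> [N rho i j hrho|z|f k rf hf rk hk|f k rf hf rk hk].
- have [r1 rM rh] := hrho.
  have S (l1 l2 : 'I_N) : germ_at false (fun x => rho x l1 l2) 1%g.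
    by apply: germ_at_smooth; apply: regular_hol; exact: regular_coef.
  have E a : ifield s X (fun x => rho x i j) a =
     \sum_l (if s then rho a i l * td X (fun x => rho x l j)
             else rho a l j * td X (fun x => rho x i l)).
    transitivity (td X (fun x => \sum_l (if s then rho a i l * rho x l j
                                          else rho a l j * rho x i l))).
      congr (td X _); apply/funext => x; rewrite /transl; case: s.
        by rewrite rM mxE.
      by rewrite rM mxE; apply: eq_bigr => ? _; rewrite mulrC.
    case: s => /=.
      apply: (etrans (td_sum X (index_enum 'I_N) (fun l : 'I_N => germ_atM (germ_at_cst false (rho a i l) _) (S l j)))).
      apply: eq_bigr => l _; apply: (etrans (tdM X (germ_at_cst false (rho a i l) _) (S l j))).
      by rewrite (td_cst X (rho a i l)) mulr0 addr0.
    apply: (etrans (td_sum X (index_enum 'I_N) (fun l : 'I_N => germ_atM (germ_at_cst false (rho a l j) _) (S i l)))).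
    apply: eq_bigr => l _; apply: (etrans (tdM X (germ_at_cst false (rho a l j) _) (S i l))).
    by rewrite (td_cst X (rho a l j)) mulr0 addr0.
  rewrite (funext E); apply: regular_sum => l; case: s {E}.
    by apply: regular_mul; [exact: regular_coef|exact: regular_cst].
  by apply: regular_mul; [exact: regular_coef|exact: regular_cst].
- rewrite (_ : ifield s X _ = fun=> 0); first exact: regular_cst.
  by apply/funext => a; exact: ifield_cst.
- rewrite (_ : ifield s X _ = fun a => ifield s X f a + ifield s X k a); first exact: regular_add.
  by apply/funext => a; apply: ifieldD; apply: germ_at_smooth; exact: regular_hol.
- rewrite (_ : ifield s X _ = fun a => f a * ifield s X k a + k a * ifield s X f a).
    by apply: regular_add; apply: regular_mul.
  by apply/funext => a; apply: ifieldM; apply: germ_at_smooth; exact: regular_hol.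
Qed.

(** Regular functions are continuous for the analytic topology. *)
Lemma cls_open_open cls V : cls_open cls V -> open V.
Proof.
case: cls => //= H; rewrite openE => a /H[q [rq qa Vq]]; rewrite /interior.
have nq : \forall x \near a, q x != 0.
  exact: (germ_at_continuous (regular_hol a rq) (open_near (@open_neq0 _) qa)).
by near=> x; apply: Vq; near: x; exact: nq.
Unshelve. all: by end_near. Qed.

Lemma regular_quot_near V f a p q : open V -> V a -> regular q -> q a != 0 ->
  (forall b, V b -> q b != 0 -> f b = p b / q b) ->
  {near a, f =1 (fun x => p x * (q x)^-1)}.
Proof.
move=> oV Va rq qa H.
have nq : \forall x \near a, q x != 0.
  exact: (germ_at_continuous (regular_hol a rq) (open_near (@open_neq0 _) qa)).
have nV := open_near oV Va.
near=> x; apply: H; [near: x; exact: nV|near: x; exact: nq].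
Unshelve. all: by end_near. Qed.

Lemma regular_on_hol V f a : open V -> V a -> regular_on V f -> germ_at true f a.
Proof.
move=> oV Va /(_ a Va)[p [q [rp rq qa H]]].
have E := regular_quot_near oV Va rq qa H.
have E' : {near a, (fun x => p x * (q x)^-1) =1 f}.
  by move: E; apply: filterS => x.
apply: germ_at_eq E' _; apply: germ_atM; first exact: regular_hol.
by apply: germ_at_inv => //; exact: regular_hol.
Qed.

(** Algebraic sections are holomorphic, so that only smooth sections are of the
    weaker class. *)
Definition hol_class cls := if cls is Smooth then false else true.

Lemma section_germ cls V f a : cls_open cls V -> section_on cls V f -> V a ->
  germ_at (hol_class cls) f a.
Proof.
move=> hV; have oV := cls_open_open hV; case: cls hV => /= hV [_ H] Va.
- exact: ((holomorphic_onP f oV).1 H).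
- exact: ((smooth_onP f oV).1 H).
- exact: (regular_on_hol oV Va H).
Qed.

Lemma section_smooth cls V f a : cls_open cls V -> section_on cls V f -> V a ->
  germ_at false f a.
Proof. by move=> hV Hf Va; exact: germ_at_smooth (section_germ hV Hf Va). Qed.

(** Reduces each closure property of sections to a pointwise property of germs
    and, for the algebraic class, to an explicit quotient. *)
Lemma section_intro cls V f : cls_open cls V -> (forall a, ~ V a -> f a = 0) ->
  (forall a, V a -> germ_at (hol_class cls) f a) ->
  (cls = Algebraic -> regular_on V f) -> section_on cls V f.
Proof.
move=> hV; have oV := cls_open_open hV; case: cls hV => /= hV f0 H1 H2; split=> //.
- exact: ((holomorphic_onP f oV).2 H1).
- exact: ((smooth_onP f oV).2 H1).
- exact: H2.
Qed.

Lemma section_out cls V f a : section_on cls V f -> ~ V a -> f a = 0.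
Proof. by move=> [H _]; exact: H. Qed.

Lemma section_regular V f : section_on Algebraic V f -> regular_on V f.
Proof. by move=> []. Qed.

Lemma section_add cls V f k : cls_open cls V -> section_on cls V f ->
  section_on cls V k -> section_on cls V (fun x => f x + k x).
Proof.
move=> hV Hf Hk; apply: section_intro => //.
- by move=> a Va; rewrite (section_out Hf Va) (section_out Hk Va) addr0.
- by move=> a Va; apply: germ_atD; [exact: (section_germ hV Hf)|exact: (section_germ hV Hk)].
move=> E a Va; rewrite {}E in hV Hf Hk.
have [p [q [rp rq qa H]]] := section_regular Hf Va.
have [p' [q' [rp' rq' qa' H']]] := section_regular Hk Va.
exists (fun x => p x * q' x + p' x * q x), (fun x => q x * q' x); split.
- by apply: regular_add; apply: regular_mul.
- exact: regular_mul.
- by rewrite mulf_neq0.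
move=> b Vb; rewrite mulf_eq0 negb_or => /andP[qb qb'].
by rewrite H// H'// addf_div.
Qed.

Lemma section_mul cls V f k : cls_open cls V -> section_on cls V f ->
  section_on cls V k -> section_on cls V (fun x => f x * k x).
Proof.
move=> hV Hf Hk; apply: section_intro => //.
- by move=> a Va; rewrite (section_out Hf Va) mul0r.
- by move=> a Va; apply: germ_atM; [exact: (section_germ hV Hf)|exact: (section_germ hV Hk)].
move=> E a Va; rewrite {}E in hV Hf Hk.
have [p [q [rp rq qa H]]] := section_regular Hf Va.
have [p' [q' [rp' rq' qa' H']]] := section_regular Hk Va.
exists (fun x => p x * p' x), (fun x => q x * q' x); split.
- exact: regular_mul.
- exact: regular_mul.
- by rewrite mulf_neq0.
move=> b Vb; rewrite mulf_eq0 negb_or => /andP[qb qb'].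
by rewrite H// H'// mulf_div.
Qed.

Lemma section_cst cls V (z : C) : cls_open cls V ->
  section_on cls V (restr V (fun=> z)).
Proof.
move=> hV; have oV := cls_open_open hV; apply: section_intro => //.
- by move=> a; exact: restrC.
- move=> a Va; apply: germ_at_eq (germ_at_cst _ z a).
  by have := restr_near (fun=> z) oV Va; apply: filterS => x ->.
- move=> _ a Va; exists (fun=> z), (fun=> 1); split;
    [exact: regular_cst|exact: regular_cst|exact: oner_neq0|].
  by move=> b Vb _; rewrite restrT// divr1.
Qed.

(** In the algebraic case a section is locally [p / q], and the quotient rule
    exhibits its derivative as [(p' q - p q') / q^2]. *)
Lemma section_ifield cls V s (X : g) f : cls_open cls V -> section_on cls V f ->
  section_on cls V (restr V (ifield s X f)).
Proof.
move=> hV Hf; have oV := cls_open_open hV; apply: section_intro => //.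
- by move=> a; exact: restrC.
- move=> a Va; apply: germ_at_eq (germ_at_ifield s X (section_germ hV Hf Va)).
  by have := restr_near (ifield s X f) oV Va; apply: filterS => x ->.
- move=> E a Va; rewrite {}E in hV Hf.
  have [p [q [rp rq qa H]]] := section_regular Hf Va.
  exists (fun x => ifield s X p x * q x + (-1) * (p x * ifield s X q x)), (fun x => q x * q x).
  have rp' := regular_ifield s X rp; have rq' := regular_ifield s X rq; split.
  + apply: regular_add; first exact: regular_mul.
    by apply: regular_mul; [exact: regular_cst|exact: regular_mul].
  + exact: regular_mul.
  + by rewrite mulf_neq0.
  move=> b Vb; rewrite mulf_eq0 orbb => qb; rewrite restrT//.
  have nq : \forall x \near b, q x != 0.
    exact: (germ_at_continuous (regular_hol b rq) (open_near (@open_neq0 _) qb)).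
  have nV := open_near oV Vb.
  have N : {near b, (fun x => f x * q x) =1 p}.
    near=> x; have qx : q x != 0 by near: x; exact: nq.
    by rewrite H ?divfK//; near: x; exact: nV.
  have L := ifieldM s X (section_smooth hV Hf Vb) (germ_at_smooth (regular_hol b rq)).
  have := etrans (esym L) (ifield_near s X N).
  rewrite (H b Vb qb) => e.
  have -> : ifield s X p b = p b / q b * ifield s X q b + q b * ifield s X f b by rewrite e.
  move: (ifield s X f b) (ifield s X q b) (p b) (q b) qb => F Q P q' qb {e L}.
  by field.
Unshelve. all: by end_near. Qed.

End sections.

(** * Morphisms out of the enveloping algebra *)

Section linear_preds.
Variables (K : fieldType) (V W : lmodType K) (f : V -> W).
Hypothesis lf : linear f.

Lemma lin0 : f 0 = 0.
Proof.
by have := lf 1 0 0; rewrite !scale1r addr0 => /eqP; rewrite -subr_eq subrr eq_sym => /eqP.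
Qed.
Lemma linD x y : f (x + y) = f x + f y.
Proof. by have := lf 1 x y; rewrite !scale1r. Qed.
Lemma linZ a x : f (a *: x) = a *: f x.
Proof. by have := lf a x 0; rewrite !addr0 lin0 addr0. Qed.
Lemma linN x : f (- x) = - f x.
Proof. by rewrite -scaleN1r linZ scaleN1r. Qed.
Lemma lin_sum (I : Type) (r : seq I) (P : pred I) (F : I -> V) :
  f (\sum_(i <- r | P i) F i) = \sum_(i <- r | P i) f (F i).
Proof. by elim/big_rec2: _ => [|i y x _ <-]; rewrite ?lin0 ?linD. Qed.
End linear_preds.

Section Endo.
Variables (K : fieldType) (M : lmodType K).

(** Linear endomorphisms of [M], paired with a scalar so that [1 != 0] even
    when [M = 0]: the target of the universal property of [uea] has to be a
    nonzero algebra. *)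
Record endo := Endo { efun : M -> M; escal : K; efun_linear : linear efun }.

Lemma endo_ext (a b : endo) : (forall x, efun a x = efun b x) -> escal a = escal b ->
  a = b.
Proof.
case: a b => f c lf [h d lh] /= /funext fh cd; rewrite {}fh {}cd in lf *.
by congr Endo; exact: Prop_irrelevance.
Qed.

HB.instance Definition _ := gen_eqMixin endo.
HB.instance Definition _ := gen_choiceMixin endo.

Lemma elin0 : linear (fun _ : M => 0 : M).
Proof. by move=> a x y; rewrite scaler0 addr0. Qed.
Lemma elinD (a b : endo) : linear (fun x => efun a x + efun b x).
Proof. by move=> c x y; rewrite !efun_linear scalerDr addrACA. Qed.
Lemma elinZ c (a : endo) : linear (fun x => c *: efun a x).
Proof. by move=> d x y; rewrite efun_linear scalerDr !scalerA mulrC. Qed.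
Lemma elinM (a b : endo) : linear (fun x => efun a (efun b x)).
Proof. by move=> d x y; rewrite !efun_linear. Qed.

Definition ezero := Endo 0 elin0.
Definition eadd a b := Endo (escal a + escal b) (elinD a b).
Definition escale c a := Endo (c * escal a) (elinZ c a).
Definition emul a b := Endo (escal a * escal b) (elinM a b).
Definition eone := @Endo id 1 (fun _ _ _ => erefl).

Lemma eaddA : associative eadd.
Proof. by move=> a b c; apply: endo_ext => [x|] /=; rewrite addrA. Qed.
Lemma eaddC : commutative eadd.
Proof. by move=> a b; apply: endo_ext => [x|] /=; rewrite addrC. Qed.
Lemma eadd0 : left_id ezero eadd.
Proof. by move=> a; apply: endo_ext => [x|] /=; rewrite add0r. Qed.
Lemma eaddN : left_inverse ezero (escale (-1)) eadd.
Proof. by move=> a; apply: endo_ext => [x|] /=; rewrite ?scaleN1r ?mulN1r addNr. Qed.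
HB.instance Definition _ := GRing.isZmodule.Build endo eaddA eaddC eadd0 eaddN.

Lemma emulA : associative emul.
Proof. by move=> a b c; apply: endo_ext => [x|] //=; rewrite mulrA. Qed.
Lemma emul1 : right_id eone emul.
Proof. by move=> a; apply: endo_ext => [x|] //=; rewrite mulr1. Qed.
Lemma e1mul : left_id eone emul.
Proof. by move=> a; apply: endo_ext => [x|] //=; rewrite mul1r. Qed.
Lemma emulDl : left_distributive emul eadd.
Proof. by move=> a b c; apply: endo_ext => [x|] //=; rewrite mulrDl. Qed.
Lemma emulDr : right_distributive emul eadd.
Proof.
by move=> a b c; apply: endo_ext => [x|] /=; rewrite ?mulrDr// (linD (efun_linear a)).
Qed.
Lemma eone_neq0 : eone != ezero.
Proof. by apply/eqP => /(congr1 escal) /eqP; rewrite oner_eq0. Qed.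
HB.instance Definition _ := GRing.Zmodule_isNzRing.Build endo
  emulA e1mul emul1 emulDl emulDr eone_neq0.

Lemma escaleA a b x : escale a (escale b x) = escale (a * b) x.
Proof. by apply: endo_ext => [y|] /=; rewrite ?scalerA ?mulrA. Qed.
Lemma escale1 : left_id 1 escale.
Proof. by move=> a; apply: endo_ext => [y|] /=; rewrite ?scale1r ?mul1r. Qed.
Lemma escaleDr : right_distributive escale +%R.
Proof. by move=> a x y; apply: endo_ext => [z|] /=; rewrite ?scalerDr ?mulrDr. Qed.
Lemma escaleDl x : {morph escale^~ x : a b / a + b}.
Proof. by move=> a b; apply: endo_ext => [z|] /=; rewrite ?scalerDl ?mulrDl. Qed.
HB.instance Definition _ := GRing.Zmodule_isLmodule.Build K endo
  escaleA escale1 escaleDr escaleDl.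
Lemma escaleAl (a : K) (x y : endo) : a *: (x * y) = (a *: x) * y.
Proof. by apply: endo_ext => [z|] //=; rewrite mulrA. Qed.
Lemma escaleAr (a : K) (x y : endo) : a *: (x * y) = x * (a *: y).
Proof.
by apply: endo_ext => [z|] /=; rewrite ?(linZ (efun_linear x))// mulrCA.
Qed.
HB.instance Definition _ := GRing.Lmodule_isLalgebra.Build K endo escaleAl.
HB.instance Definition _ := GRing.Lalgebra_isAlgebra.Build K endo escaleAr.

Lemma efun_sum (I : Type) (r : seq I) (F : I -> endo) x :
  efun (\sum_(i <- r) F i) x = \sum_(i <- r) efun (F i) x.
Proof. by elim/big_rec2: _ => // i a b _ <-. Qed.
End Endo.

Section Uact.
Variables (K : fieldType) (g : lmodType K) (br : g -> g -> g).
Local Notation U := (uea br).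

Lemma uea_expand (u : U) :
  u = \sum_(p <- repr u) p.1 *: \prod_(x <- p.2) (uinj br x).
Proof.
apply: uea_ext => A f hf.
have E0 : ulift f (0 : U) = 0 by exact: ulift_zero.
have ED v w : ulift f (v + w : U) = ulift f v + ulift f w by exact: ulift_add.
have EZ a v : ulift f (a *: v : U) = a *: ulift f v by exact: ulift_scale.
have E1 : ulift f (1 : U) = 1 by exact: ulift_one.
have EM v w : ulift f (v * w : U) = ulift f v * ulift f w by exact: ulift_mul.
rewrite [LHS]/ulift /weval; elim: (repr u) => [|p s ih]; first by rewrite !big_nil E0.
rewrite !big_cons ED EZ ih; congr (_ *: _ + _).
elim: p.2 => [|x r ihr]; first by rewrite !big_nil E1.
by rewrite !big_cons EM ihr ulift_inj.
Qed.

(** Every element is a combination of words, and words are built by left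
    multiplication. *)
Lemma uea_ind (Q : U -> Prop) : Q 1 -> (forall a u v, Q u -> Q v -> Q (a *: u + v)) ->
  (forall x u, Q u -> Q (uinj br x * u)) -> forall u, Q u.
Proof.
move=> Q1 QL QM u; have Q0 : Q 0.
  by have := QL (-1) 1 1 Q1 Q1; rewrite scaleN1r addNr.
rewrite [u]uea_expand; elim: (repr u) => [|p s ih]; first by rewrite big_nil.
rewrite big_cons; apply: QL => //; elim: p.2 => [|x r ihr]; first by rewrite big_nil.
by rewrite big_cons; apply: QM.
Qed.

Section ulift_hom.
Variables (A : algType K) (f : g -> A).
Hypothesis hf : lie_map br f.
Local Notation lf := (@ulift K g br A f).
Lemma uliftP a (u v : U) : lf (a *: u + v) = a *: lf u + lf v.
Proof.
have -> : a *: u + v = uadd (uscale a u) v by [].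
by rewrite ulift_add// ulift_scale.
Qed.
Lemma uliftM (u v : U) : lf (u * v) = lf u * lf v.
Proof. exact: ulift_mul. Qed.
Lemma ulift1 : lf (1 : U) = 1.
Proof. exact: ulift_one. Qed.
End ulift_hom.

Section uact.
Variables (M : lmodType K) (rho : g -> M -> M).
Hypotheses (rho_linl : forall m, linear (rho^~ m)) (rho_linr : forall x, linear (rho x)).
Hypothesis rho_rep : forall x y m,
  rho (br x y) m = rho x (rho y m) - rho y (rho x m).

(* The scalar component is zero, as it is for every commutator. *)
Let erho (x : g) : endo M := Endo 0 (rho_linr x).

Lemma erho_lie : lie_map br erho.
Proof.
split=> [a x y|x y]; apply: endo_ext => [m|] /=.
- exact: (rho_linl m).
- by rewrite mulr0 addr0.
- by rewrite rho_rep scaleN1r.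
- by rewrite mul0r mulr0 addr0.
Qed.

(** The action defined on words is the one induced by the universal property,
    hence does not depend on the chosen representative. *)
Lemma uactE (u : U) m : uact rho u m = efun (ulift erho u) m.
Proof.
rewrite /uact /ulift /weval efun_sum; apply: eq_bigr => p _ /=; congr (_ *: _).
by elim: p.2 => [|x r ih]; rewrite ?big_nil// big_cons /= ih.
Qed.

Lemma uact_linr (u : U) : linear (uact rho u).
Proof. by move=> a x y; rewrite !uactE efun_linear. Qed.
Lemma uact_linl m : linear (fun u : U => uact rho u m).
Proof. by move=> a x y; rewrite !uactE (uliftP erho_lie). Qed.
Lemma uact1 m : uact rho (1 : U) m = m.
Proof. by rewrite uactE (ulift1 erho_lie). Qed.
Lemma uactM (u v : U) m : uact rho (u * v) m = uact rho u (uact rho v m).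
Proof. by rewrite !uactE (uliftM erho_lie). Qed.
Lemma uact_inj x m : uact rho (uinj br x) m = rho x m.
Proof. by rewrite uactE (ulift_inj erho_lie). Qed.
End uact.

(* The antipode is defined on words. It is also the value at [1] of the
   representation of [g] on [U] by [u |-> - u x], which makes it well behaved
   with respect to sums and products. *)
Let opp_act (x : g) (u : U) : U := - (u * uinj br x).

Lemma opp_act_linl m : linear (opp_act^~ m).
Proof.
move=> a x y; rewrite /opp_act (uinj_lie_map br).1 mulrDr -scalerAr opprD.
by rewrite scalerN.
Qed.
Lemma opp_act_linr x : linear (opp_act x).
Proof. by move=> a u v; rewrite /opp_act mulrDl -scalerAl opprD scalerN. Qed.
Lemma opp_act_rep x y m :
  opp_act (br x y) m = opp_act x (opp_act y m) - opp_act y (opp_act x m).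
Proof.
rewrite /opp_act (uinj_lie_map br).2 mulrBr !mulrA !mulNr !opprK opprB.
by [].
Qed.

Local Notation s := (@antipode K g br).

Lemma antipode_uact (u : U) : s u = uact opp_act u 1.
Proof.
rewrite /antipode /uact; apply: eq_bigr => p _; congr (_ *: _).
elim: p.2 => [|x r ih] /=; first by rewrite big_nil.
by rewrite rev_cons -cats1 big_cat big_seq1 /= ih {1}/opp_act mulrN.
Qed.

Let olinl := uact_linl opp_act_linl opp_act_linr opp_act_rep.
Let o1 := uact1 opp_act_linl opp_act_linr opp_act_rep.
Let oM := uactM opp_act_linl opp_act_linr opp_act_rep.
Let oinj := uact_inj opp_act_linl opp_act_linr opp_act_rep.

Lemma opp_act_antipode (u w : U) : uact opp_act u w = w * s u.
Proof.
elim/uea_ind: u w => [|a u v hu hv|x u hu] w.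
- by rewrite antipode_uact !o1 mulr1.
- rewrite antipode_uact !olinl hu hv mulrDr -scalerAr.
  by rewrite -(antipode_uact u) -(antipode_uact v).
- by rewrite antipode_uact !oM !oinj hu -antipode_uact /opp_act mulrN mulrA.
Qed.

Lemma antipode_linear : linear s.
Proof. by move=> a u v; rewrite !antipode_uact olinl. Qed.
Lemma antipode1 : s 1 = 1.
Proof. by rewrite antipode_uact o1. Qed.
Lemma antipodeM u v : s (u * v) = s v * s u.
Proof. by rewrite antipode_uact oM -antipode_uact opp_act_antipode. Qed.
Lemma antipode_inj x : s (uinj br x) = - uinj br x.
Proof. by rewrite antipode_uact oinj /opp_act mul1r. Qed.

Local Notation Delta := (@comul K g br).

Lemma comul_lie : lie_map br (fun x => uinj br x ⊗ 1 + 1 ⊗ uinj br x : U ⊗ U).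
Proof.
have [pl pr] := pure_bilinear U U.
have [il ib] := uinj_lie_map br.
have mE (a b c d : U) : (a ⊗ b) * (c ⊗ d) = (a * c) ⊗ (b * d) :> U ⊗ U by exact: tmul_pure.
split=> [a x y|x y].
  by rewrite il pl pr scalerDr addrACA.
have D2 z w : (uinj br z ⊗ 1 + 1 ⊗ uinj br z) * (uinj br w ⊗ 1 + 1 ⊗ uinj br w) =
    ((uinj br z * uinj br w) ⊗ 1 + 1 ⊗ (uinj br z * uinj br w)) +
    (uinj br z ⊗ uinj br w + uinj br w ⊗ uinj br z) :> U ⊗ U.
  rewrite mulrDl !mulrDr !mE !mul1r !mulr1.
  by rewrite [X in _ + X]addrC addrACA.
rewrite !D2 [uinj br y ⊗ _ + _]addrC opprD addrACA subrr addr0 ib.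
rewrite (linD (pl 1)) (linN (pl 1)) (linD (pr 1)) (linN (pr 1)) opprD.
by rewrite addrACA.
Qed.

Lemma comul_linear : linear Delta.
Proof. by move=> a u v; exact: (uliftP comul_lie). Qed.
Lemma comulM u v : Delta (u * v) = Delta u * Delta v.
Proof. exact: (uliftM comul_lie). Qed.
Lemma comul1 : Delta 1 = 1.
Proof. exact: (ulift1 comul_lie). Qed.
Lemma comul_inj x : Delta (uinj br x) = uinj br x ⊗ 1 + 1 ⊗ uinj br x.
Proof. exact: (ulift_inj comul_lie). Qed.

Lemma counit_lie : lie_map br (fun _ : g => 0 : K^o).
Proof. by split=> [a x y|x y]; rewrite ?scaler0 ?addr0// mul0r subrr. Qed.
Local Notation eps := (@counit K g br).
Lemma counit_linear : linear eps.
Proof. by move=> a u v; exact: (uliftP counit_lie). Qed.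
Lemma counit1 : eps 1 = 1.
Proof. exact: (ulift1 counit_lie). Qed.
Lemma counitM u v : eps (u * v) = eps u * eps v.
Proof. exact: (uliftM counit_lie). Qed.
Lemma counit_inj x : eps (uinj br x) = 0.
Proof. exact: (ulift_inj counit_lie). Qed.

End Uact.

(** * Tensor products and formal power series *)

Section TensorFacts.
Variable K : fieldType.

Lemma lin_id (V : lmodType K) : linear (@id V).
Proof. by []. Qed.

Lemma lin_comp (V W P : lmodType K) (f : V -> W) (h : W -> P) :
  linear f -> linear h -> linear (fun x => h (f x)).
Proof. by move=> lf lh a x y; rewrite lf lh. Qed.

Lemma mul_linl (A : algType K) (y : A) : linear (fun x => x * y).
Proof. by move=> a u v; rewrite mulrDl scalerAl. Qed.
Lemma mul_linr (A : algType K) (x : A) : linear (fun y => x * y).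
Proof. by move=> a u v; rewrite mulrDr scalerAr. Qed.

Lemma pure_linl (N M : lmodType K) (n : N) : linear (fun m : M => m ⊗ n).
Proof. exact: (pure_bilinear M N).1. Qed.
Lemma pure_linr (M N : lmodType K) (m : M) : linear (fun n : N => m ⊗ n).
Proof. exact: (pure_bilinear M N).2. Qed.

Arguments pure_linl {N M} n.
Arguments pure_linr {M N} m.

Lemma tensor_lin_ext (M N P : lmodType K) (f h : M ⊗ N -> P) :
  linear f -> linear h -> (forall a b, f (a ⊗ b) = h (a ⊗ b)) -> forall t, f t = h t.
Proof.
move=> lf lh H t; rewrite [t]tensor_pureE (lin_sum lf) (lin_sum lh).
by apply: eq_bigr => p _; exact: H.
Qed.

(** [tlift] is a sum over a representative, so that linearity in a parameter
    holds without any condition of bilinearity in the other arguments. *)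
Lemma tlift_lin_param (V M N P : lmodType K) (F : V -> M -> N -> P) t :
  (forall a b, linear (fun v => F v a b)) -> linear (fun v => tlift (F v) t).
Proof.
move=> H c u v; rewrite /tlift /tsum scaler_sumr -big_split.
by apply: eq_bigr => p _; exact: H.
Qed.

Lemma tmap_bil (M N M' N' : lmodType K) (f : M -> M') (h : N -> N') :
  linear f -> linear h -> bilinear_map (fun m n => f m ⊗ h n).
Proof.
move=> lf lh; split=> [n|m] a u v /=; first by rewrite lf; exact: pure_linl.
by rewrite lh; exact: pure_linr.
Qed.

Lemma tmap_linear (M N M' N' : lmodType K) (f : M -> M') (h : N -> N') :
  linear f -> linear h -> linear (tmap f h).
Proof. by move=> lf lh; apply: tlift_linear; exact: tmap_bil. Qed.

Lemma tmap_pure (M N M' N' : lmodType K) (f : M -> M') (h : N -> N') m n :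
  linear f -> linear h -> tmap f h (m ⊗ n) = f m ⊗ h n.
Proof. by move=> lf lh; rewrite /tmap (tlift_pure _ _ (tmap_bil lf lh)). Qed.

Lemma tassoc_bil1 (M N P : lmodType K) (m : M) :
  bilinear_map (fun (n : N) (p : P) => (m ⊗ n) ⊗ p).
Proof.
split=> [p|n] a u v /=; last exact: pure_linr.
by rewrite (pure_linr m) (pure_linl p).
Qed.

Lemma tassoc_bil (M N P : lmodType K) :
  bilinear_map (fun (m : M) (np : N ⊗ P) => tlift (fun n p => (m ⊗ n) ⊗ p) np).
Proof.
split=> [np|m]; last exact: (tlift_linear (tassoc_bil1 N P m)).
apply: tlift_lin_param => n p a u v.
by rewrite (pure_linl n) (pure_linl p).
Qed.

Lemma tassoc_linear (M N P : lmodType K) : linear (@tassoc K M N P).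
Proof. exact: (tlift_linear (tassoc_bil M N P)). Qed.

Lemma tassoc_pure (M N P : lmodType K) (m : M) (n : N) (p : P) :
  tassoc (m ⊗ (n ⊗ p)) = (m ⊗ n) ⊗ p.
Proof. by rewrite /tassoc (tlift_pure _ _ (tassoc_bil M N P)) (tlift_pure _ _ (tassoc_bil1 N P m)). Qed.

Lemma tensorM (A B : algType K) (a c : A) (b d : B) :
  ((a ⊗ b : A ⊗ B) * (c ⊗ d : A ⊗ B) = (a * c) ⊗ (b * d)).
Proof. exact: tmul_pure. Qed.

Section algebras.
Variables A B A' B' : algType K.

Lemma tmapM (f : A -> A') (h : B -> B') : linear f -> linear h ->
  (forall x y, f (x * y) = f x * f y) -> (forall x y, h (x * y) = h x * h y) ->
  forall x y, tmap f h (x * y) = tmap f h x * tmap f h y.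
Proof.
move=> lf lh fM hM x y; have lt := tmap_linear lf lh.
move: x; apply: tensor_lin_ext => [||a b].
- exact: (lin_comp (mul_linl y) lt).
- exact: (lin_comp lt (mul_linl (tmap f h y))).
move: y; apply: tensor_lin_ext => [||c d].
- exact: (lin_comp (mul_linr _) lt).
- exact: (lin_comp lt (mul_linr _)).
by rewrite tensorM !(tmap_pure _ _ lf lh) tensorM fM hM.
Qed.

Lemma tmap_anti (f : A -> A') (h : B -> B') : linear f -> linear h ->
  (forall x y, f (x * y) = f y * f x) -> (forall x y, h (x * y) = h y * h x) ->
  forall x y, tmap f h (x * y) = tmap f h y * tmap f h x.
Proof.
move=> lf lh fM hM x y; have lt := tmap_linear lf lh.
move: x; apply: tensor_lin_ext => [||a b].
- exact: (lin_comp (mul_linl y) lt).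
- exact: (lin_comp lt (mul_linr (tmap f h y))).
move: y; apply: tensor_lin_ext => [||c d].
- exact: (lin_comp (mul_linr _) lt).
- exact: (lin_comp lt (mul_linl _)).
by rewrite tensorM !(tmap_pure _ _ lf lh) tensorM fM hM.
Qed.

Lemma pure1M (x y : A) : (x * y) ⊗ (1 : B) = (x ⊗ 1) * (y ⊗ 1).
Proof. by rewrite tensorM mulr1. Qed.
Lemma pureM1 (x y : B) : (1 : A) ⊗ (x * y) = (1 ⊗ x) * (1 ⊗ y).
Proof. by rewrite tensorM mulr1. Qed.
End algebras.

Lemma tassocM (A B C : algType K) (x y : A ⊗ (B ⊗ C)) :
  tassoc (x * y) = tassoc x * tassoc y.
Proof.
have lt := @tassoc_linear A B C.
move: x; apply: tensor_lin_ext => [||a t].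
- exact: (lin_comp (mul_linl y) lt).
- exact: (lin_comp lt (mul_linl (tassoc y))).
move: t; apply: tensor_lin_ext => [||b c].
- exact: (lin_comp (lin_comp (pure_linr a) (mul_linl y)) lt).
- exact: (lin_comp (lin_comp (pure_linr a) lt) (mul_linl (tassoc y))).
move: y; apply: tensor_lin_ext => [||a' t'].
- exact: (lin_comp (mul_linr _) lt).
- exact: (lin_comp lt (mul_linr _)).
move: t'; apply: tensor_lin_ext => [||b' c'].
- exact: (lin_comp (lin_comp (pure_linr a') (mul_linr _)) lt).
- exact: (lin_comp (lin_comp (pure_linr a') lt) (mul_linr _)).
by rewrite !tensorM !tassoc_pure !tensorM.
Qed.

End TensorFacts.

Section S2.
Variable Z : nmodType.

(** Convolution is iterated below up to four times; keeping the summation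
    domain [i + j = N] symbolic reduces all rearrangements to [S2C], [S2A] and
    [S2ACA]. *)
Definition S2 (N : nat) (F : nat -> nat -> Z) : Z := \sum_(i < N.+1) F i (N - i)%N.

Lemma eq_S2 N F F' : (forall i j, (i + j)%N = N -> F i j = F' i j) -> S2 N F = S2 N F'.
Proof. by move=> H; apply: eq_bigr => i _; apply: H; rewrite subnKC// -ltnS. Qed.

Lemma S2C N F : S2 N F = S2 N (fun i j => F j i).
Proof.
rewrite /S2 (reindex_inj rev_ord_inj) /=; apply: eq_bigr => i _.
by rewrite subSS subKn// -ltnS.
Qed.

Lemma S2A N (H : nat -> nat -> nat -> Z) :
  S2 N (fun i j => S2 i (fun a b => H a b j)) =
  S2 N (fun a k => S2 k (fun b j => H a b j)).
Proof.
pose G i a := H a (i - a)%N (N - i)%N.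
transitivity (\sum_(0 <= i < N.+1) \sum_(0 <= a < N.+1 | (a < i.+1)%N) G i a).
  rewrite /S2 big_mkord; apply: eq_bigr => i _.
  rewrite -(big_mkord xpredT (fun a => H a (i - a)%N (N - i)%N)).
  by rewrite (big_nat_widen 0 i.+1 N.+1)//.
rewrite (exchange_big_dep_nat xpredT)//=.
rewrite /S2 -(big_mkord xpredT (fun a => \sum_(b < (N - a).+1) H a b (N - a - b)%N)).
rewrite !big_nat; apply: eq_bigr => a /andP[_ aN].
rewrite -(big_mkord xpredT (fun b => H a b (N - a - b)%N)).
rewrite (_ : \sum_(0 <= i < N.+1 | (a < i.+1)%N) G i a = \sum_(a <= i < N.+1) G i a); last first.
  by rewrite [RHS](big_nat_widenl _ 0).
rewrite -{1}[a]add0n big_addn -subSn; last by rewrite -ltnS.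
apply: eq_bigr => b _; rewrite /G addnK; congr (H _ _ _).
by rewrite [(b + a)%N]addnC subnDA.
Qed.

End S2.

Lemma S2_lin (K : fieldType) (V W : lmodType K) (f : V -> W) N F : linear f ->
  f (S2 N F) = S2 N (fun i j => f (F i j)).
Proof. by move=> lf; rewrite /S2 (lin_sum lf). Qed.

Lemma S2ACA (Z : nmodType) N (H : nat -> nat -> nat -> nat -> Z) :
  S2 N (fun i j => S2 i (fun a b => S2 j (fun c d => H a b c d))) =
  S2 N (fun i j => S2 i (fun a c => S2 j (fun b d => H a b c d))).
Proof.
have E (T : nat -> nat -> nat -> nat -> Z) :
    S2 N (fun i j => S2 i (fun a b => S2 j (fun c d => T a b c d))) =
    S2 N (fun a k => S2 k (fun i d => S2 i (fun b c => T a b c d))).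
  rewrite S2A; apply: eq_S2 => a k _.
  by rewrite -(S2A k (fun b c d => T a b c d)).
rewrite E [RHS]E; apply: eq_S2 => a k _; apply: eq_S2 => i d _.
by rewrite S2C.
Qed.

Section Series.
Variable K : fieldType.

Lemma hconvE (A B : Type) (C : zmodType) (op : A -> B -> C) a b N :
  hconv op a b N = S2 N (fun i j => op (a i) (b j)).
Proof. by []. Qed.

Section ring.
Variable A : algType K.
Implicit Types a b c : nat -> A.

Lemma hmulE a b N : hmul a b N = S2 N (fun i j => a i * b j).
Proof. by []. Qed.

Lemma hmulA a b c : hmul (hmul a b) c = hmul a (hmul b c).
Proof.
apply/funext => N; rewrite !hmulE.
rewrite (eq_S2 (F' := fun i j => S2 i (fun k l => a k * b l * c j))); last first.
  by move=> i j _; rewrite hmulE (S2_lin _ _ (mul_linl (c j))).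
rewrite (S2A N (fun k l j => a k * b l * c j)); apply: eq_S2 => i j _.
rewrite hmulE (S2_lin _ _ (mul_linr (a i))); apply: eq_S2 => k l _.
by rewrite mulrA.
Qed.

Lemma hmulr1 a : hmul a (hcst 1) = a.
Proof.
apply/funext => N; rewrite /hmul /hconv big_ord_recr /= subnn mulr1 big1 ?add0r// => i _.
have := ltn_ord i; rewrite -subn_gt0.
by case: (N - i)%N => // m _; rewrite mulr0.
Qed.

Lemma hmul1r a : hmul (hcst 1) a = a.
Proof.
apply/funext => N; rewrite /hmul /hconv big_ord_recl /= subn0 mul1r big1 ?addr0// => i _.
by rewrite mul0r.
Qed.

Lemma hmulB a b c : hmul a (fun n => b n - c n) = (fun n => hmul a b n - hmul a c n).
Proof.
apply/funext => N; rewrite /hmul /hconv -sumrB; apply: eq_bigr => i _.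
by rewrite mulrBr.
Qed.

(** Induction on the degree: the coefficient of degree [n] of [a b] is [b n]
    plus terms involving [b] in lower degrees. *)
Lemma hmul_cancel a b : a 0%N = 1 -> (forall n, hmul a b n = 0) -> forall n, b n = 0.
Proof.
move=> a0 H n; have [m] := ubnP n; elim: m n => // m ih n nm.
have := H n; rewrite /hmul /hconv big_ord_recl /= subn0 a0 mul1r big1 ?addr0// => i _.
rewrite ih ?mulr0// /bump /= add1n; case: n nm {H} i => [|n] nm [i hi] //=.
by rewrite subSS; apply: leq_ltn_trans (leq_subr _ _) _; rewrite -ltnS.
Qed.

(** A series with leading coefficient [1] is left cancellable, so that a right
    inverse is also a left inverse. *)
Lemma hmul_inverse a b : a 0%N = 1 -> hmul a b = hcst 1 -> hmul b a = hcst 1.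
Proof.
move=> a0 ab; apply/funext => n; apply/eqP; rewrite -subr_eq0; apply/eqP.
apply: (hmul_cancel a0 (b := fun n => hmul b a n - hcst 1 n)) => m.
by rewrite hmulB -hmulA ab hmul1r hmulr1 subrr.
Qed.

End ring.

Lemma hmul_morph (A B : algType K) (f : A -> B) a b : linear f ->
  (forall x y, f (x * y) = f x * f y) -> f \o hmul a b = hmul (f \o a) (f \o b).
Proof.
move=> lf fM; apply/funext => N; rewrite /= !hmulE (S2_lin _ _ lf).
by apply: eq_S2 => i j _; rewrite fM.
Qed.

Lemma hmul_anti (A B : algType K) (f : A -> B) a b : linear f ->
  (forall x y, f (x * y) = f y * f x) -> f \o hmul a b = hmul (f \o b) (f \o a).
Proof.
move=> lf fM; apply/funext => N; rewrite /= !hmulE (S2_lin _ _ lf) S2C.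
by apply: eq_S2 => i j _; rewrite fM.
Qed.

Lemma hcst_morph (A B : algType K) (f : A -> B) : linear f -> f 1 = 1 ->
  f \o hcst 1 = hcst 1.
Proof. by move=> lf f1; apply/funext => -[|n] /=; rewrite ?f1 ?(lin0 lf). Qed.

End Series.

(** * Twisting the product of a module algebra on both sides *)

Section BiModuleAlgebra.
Variables (K : fieldType) (g : lmodType K) (br : g -> g -> g).
Local Notation U := (uea br).
Local Notation U2 := (U ⊗ U)%type.
Local Notation U3 := (U2 ⊗ U)%type.
Local Notation Delta := (@comul K g br).
Local Notation s := (@antipode K g br).

(** A module algebra over [uea br], presented infinitesimally. *)
Record rep_by_derivations (M : lmodType K) (mu : M -> M -> M) (rho : g -> M -> M) : Prop := {
  rd_linl : forall m, linear (rho^~ m);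
  rd_linr : forall x, linear (rho x);
  rd_rep : forall x y m, rho (br x y) m = rho x (rho y m) - rho y (rho x m);
  rd_der : forall x a b, rho x (mu a b) = mu (rho x a) b + mu a (rho x b)
}.

Variables (M : lmodType K) (mu : M -> M -> M) (L R : g -> M -> M).
Hypotheses (mu_linl : forall b, linear (mu^~ b)) (mu_linr : forall a, linear (mu a))
  (muA : forall a b c, mu (mu a b) c = mu a (mu b c))
  (LD : rep_by_derivations mu L) (RD : rep_by_derivations mu R)
  (LR : forall x y m, L x (R y m) = R y (L x m)).

Local Notation ul := (uact L : U -> M -> M).
Local Notation ur := (uact R : U -> M -> M).

Let ulD := uact_linl (rd_linl LD) (rd_linr LD) (rd_rep LD).
Let urD := uact_linl (rd_linl RD) (rd_linr RD) (rd_rep RD).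
Let ulr := uact_linr (br := br) (rd_linr LD).
Let urr := uact_linr (br := br) (rd_linr RD).
Let ul1 := uact1 (rd_linl LD) (rd_linr LD) (rd_rep LD).
Let ur1 := uact1 (rd_linl RD) (rd_linr RD) (rd_rep RD).
Let ulM := uactM (rd_linl LD) (rd_linr LD) (rd_rep LD).
Let urM := uactM (rd_linl RD) (rd_linr RD) (rd_rep RD).
Let uli := uact_inj (rd_linl LD) (rd_linr LD) (rd_rep LD).
Let uri := uact_inj (rd_linl RD) (rd_linr RD) (rd_rep RD).

Lemma L_ur x v m : L x (ur v m) = ur v (L x m).
Proof.
elim/uea_ind: v m => [|a u v hu hv|y u hu] m; first by rewrite !ur1.
- by rewrite !urD (rd_linr LD) hu hv.
- by rewrite !urM !uri LR hu.
Qed.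

Lemma ul_ur u v m : ul u (ur v m) = ur v (ul u m).
Proof.
elim/uea_ind: u m => [|a u w hu hw|y u hu] m; first by rewrite !ul1.
- by rewrite !ulD hu hw urr.
- by rewrite !ulM !uli hu L_ur.
Qed.

Lemma ul_R u x m : ul u (R x m) = R x (ul u m).
Proof. by rewrite -!uri ul_ur. Qed.

Definition lr (u v : U) (m : M) : M := ul u (ur v m).

Lemma lr_linl v m : linear (fun u => lr u v m).
Proof. exact: ulD. Qed.
Lemma lr_linm u m : linear (fun v => lr u v m).
Proof. by move=> a v w; rewrite /lr urD ulr. Qed.
Lemma lr_linr u v : linear (lr u v).
Proof. by move=> a x y; rewrite /lr urr ulr. Qed.
Lemma lrM u u' v v' m : lr (u * u') (v * v') m = lr u v (lr u' v' m).
Proof. by rewrite /lr ulM urM (ul_ur u' v). Qed.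
Lemma lr1 m : lr 1 1 m = m.
Proof. by rewrite /lr ur1 ul1. Qed.

(** The operator [mu o (p through L) o (q through R)] on [a ⊗ b]; [P3] below is
    its analogue for three factors. The star product is [P2] at the inverse
    twists. *)
Definition P2 (p q : U2) (a b : M) : M :=
  tlift (fun p1 p2 => tlift (fun q1 q2 => mu (lr p1 q1 a) (lr p2 q2 b)) q) p.

Lemma P2_bil1 p1 p2 a b : bilinear_map (fun q1 q2 => mu (lr p1 q1 a) (lr p2 q2 b)).
Proof.
split=> [q2|q1] c u v /=; first by rewrite (lr_linm p1 a) mu_linl.
by rewrite (lr_linm p2 b) mu_linr.
Qed.

Lemma P2_bil q a b :
  bilinear_map (fun p1 p2 => tlift (fun q1 q2 => mu (lr p1 q1 a) (lr p2 q2 b)) q).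
Proof.
split=> [p2|p1]; apply: tlift_lin_param => q1 q2 c u v /=.
  by rewrite (lr_linl q1 a) mu_linl.
by rewrite (lr_linl q2 b) mu_linr.
Qed.

Lemma P2_linp q a b : linear (fun p => P2 p q a b).
Proof. exact: (tlift_linear (P2_bil q a b)). Qed.
Lemma P2_linq p a b : linear (fun q => P2 p q a b).
Proof.
by apply: tlift_lin_param => p1 p2; exact: (tlift_linear (P2_bil1 p1 p2 a b)).
Qed.
Lemma P2_lina p q b : linear (fun a => P2 p q a b).
Proof.
apply: tlift_lin_param => p1 p2; apply: tlift_lin_param => q1 q2 c u v.
by rewrite lr_linr mu_linl.
Qed.
Lemma P2_linb p q a : linear (P2 p q a).
Proof.
apply: tlift_lin_param => p1 p2; apply: tlift_lin_param => q1 q2 c u v.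
by rewrite lr_linr mu_linr.
Qed.
Lemma P2_pure p1 p2 q1 q2 a b :
  P2 (p1 ⊗ p2) (q1 ⊗ q2) a b = mu (lr p1 q1 a) (lr p2 q2 b).
Proof. by rewrite /P2 (tlift_pure _ _ (P2_bil _ _ _)) (tlift_pure _ _ (P2_bil1 _ _ _ _)). Qed.

Lemma tensor2_ext (A B A' B' P : lmodType K) (F H : A ⊗ B -> A' ⊗ B' -> P) :
  (forall q, linear (F^~ q)) -> (forall p, linear (F p)) ->
  (forall q, linear (H^~ q)) -> (forall p, linear (H p)) ->
  (forall a b a' b', F (a ⊗ b) (a' ⊗ b') = H (a ⊗ b) (a' ⊗ b')) ->
  forall p q, F p q = H p q.
Proof.
move=> F1 F2 H1 H2 E p q; apply: (tensor_lin_ext (F1 q) (H1 q)) => a b.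
by apply: (tensor_lin_ext (F2 _) (H2 _)) => a' b'.
Qed.

Lemma P2_mulr p q u1 u2 v1 v2 a b :
  P2 (p * (u1 ⊗ u2)) (q * (v1 ⊗ v2)) a b = P2 p q (lr u1 v1 a) (lr u2 v2 b).
Proof.
move: p q; apply: tensor2_ext => [q|p|q|p|p1 p2 q1 q2].
- exact: (lin_comp (mul_linl _) (P2_linp _ a b)).
- exact: (lin_comp (mul_linl _) (P2_linq _ a b)).
- exact: P2_linp.
- exact: P2_linq.
- by rewrite !tensorM !P2_pure !lrM.
Qed.

Lemma P2_comul_l u p q a b : P2 (Delta u * p) q a b = ul u (P2 p q a b).
Proof.
elim/uea_ind: u p => [|c u v hu hv|x u hu] p.
- by rewrite comul1 mul1r ul1.
- by rewrite comul_linear mulrDl -scalerAl (P2_linp q a b) hu hv ulD.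
rewrite comulM -mulrA ulM -hu uli; move: (Delta u * p) => {u hu}p.
move: p q; apply: tensor2_ext => [q|p|q|p|p1 p2 q1 q2].
- exact: (lin_comp (mul_linr _) (P2_linp _ a b)).
- exact: P2_linq.
- exact: (lin_comp (P2_linp q a b) (rd_linr LD x)).
- exact: (lin_comp (P2_linq p a b) (rd_linr LD x)).
rewrite comul_inj mulrDl !tensorM !mul1r (linD (P2_linp _ a b)) !P2_pure.
by rewrite (rd_der LD) /lr !ulM !uli.
Qed.

Lemma P2_comul_r v p q a b : P2 p (Delta v * q) a b = ur v (P2 p q a b).
Proof.
elim/uea_ind: v q => [|c u v hu hv|x u hu] q.
- by rewrite comul1 mul1r ur1.
- by rewrite comul_linear mulrDl -scalerAl (P2_linq p a b) hu hv urD.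
rewrite comulM -mulrA urM -hu uri; move: (Delta u * q) => {u hu}q.
move: p q; apply: tensor2_ext => [q|p|q|p|p1 p2 q1 q2].
- exact: P2_linp.
- exact: (lin_comp (mul_linr _) (P2_linq _ a b)).
- exact: (lin_comp (P2_linp q a b) (rd_linr RD x)).
- exact: (lin_comp (P2_linq p a b) (rd_linr RD x)).
rewrite comul_inj mulrDl !tensorM !mul1r (linD (P2_linq _ a b)) !P2_pure.
by rewrite (rd_der RD) /lr !urM !uri !ul_R.
Qed.

(** For [u] in the Lie algebra this is the Leibniz rule; the general case
    follows by induction on words, as [Delta] is multiplicative. *)
Lemma P2_comul u v p q a b : P2 (Delta u * p) (Delta v * q) a b = lr u v (P2 p q a b).
Proof. by rewrite P2_comul_l P2_comul_r. Qed.

Definition P3 (p q : U3) (a b c : M) : M :=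
  tlift (fun p12 p3 => tlift (fun q12 q3 => mu (P2 p12 q12 a b) (lr p3 q3 c)) q) p.

Lemma P3_bil1 p12 p3 a b c :
  bilinear_map (fun q12 q3 => mu (P2 p12 q12 a b) (lr p3 q3 c)).
Proof.
split=> [q3|q12] d u v /=; first by rewrite (P2_linq p12 a b) mu_linl.
by rewrite (lr_linm p3 c) mu_linr.
Qed.
Lemma P3_bil q a b c : bilinear_map
  (fun p12 p3 => tlift (fun q12 q3 => mu (P2 p12 q12 a b) (lr p3 q3 c)) q).
Proof.
split=> [p3|p12]; apply: tlift_lin_param => q12 q3 d u v /=.
  by rewrite (P2_linp q12 a b) mu_linl.
by rewrite (lr_linl q3 c) mu_linr.
Qed.
Lemma P3_linp q a b c : linear (fun p => P3 p q a b c).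
Proof. exact: (tlift_linear (P3_bil q a b c)). Qed.
Lemma P3_linq p a b c : linear (fun q => P3 p q a b c).
Proof.
by apply: tlift_lin_param => p1 p2; exact: (tlift_linear (P3_bil1 p1 p2 a b c)).
Qed.
Lemma P3_pure p12 p3 q12 q3 a b c :
  P3 (p12 ⊗ p3) (q12 ⊗ q3) a b c = mu (P2 p12 q12 a b) (lr p3 q3 c).
Proof. by rewrite /P3 (tlift_pure _ _ (P3_bil _ _ _ _)) (tlift_pure _ _ (P3_bil1 _ _ _ _ _)). Qed.

(** Operators acting on a product act on its factors through [Delta]. The same
    rule on the other side gives [P2_P2r]. *)
Lemma P2_P2l p q p' q' a b c :
  P2 p q (P2 p' q' a b) c =
  P3 (tmap Delta id p * (p' ⊗ 1)) (tmap Delta id q * (q' ⊗ 1)) a b c.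
Proof.
have lD := tmap_linear (@comul_linear _ _ br) (@lin_id _ U).
move: p q; apply: tensor2_ext => [q|p|q|p|p1 p2 q1 q2].
- exact: P2_linp.
- exact: P2_linq.
- exact: (lin_comp (lin_comp lD (mul_linl _)) (P3_linp _ a b c)).
- exact: (lin_comp (lin_comp lD (mul_linl _)) (P3_linq _ a b c)).
rewrite !(tmap_pure _ _ (@comul_linear _ _ br) (@lin_id _ U)) !tensorM !mulr1.
by rewrite P3_pure P2_comul P2_pure.
Qed.

Lemma P3_assoc u v s' t a b c :
  P3 (tassoc (u ⊗ s')) (tassoc (v ⊗ t)) a b c = mu (lr u v a) (P2 s' t b c).
Proof.
have la (x : U) : linear (fun y : U2 => tassoc (x ⊗ y)).
  exact: (lin_comp (pure_linr x) (@tassoc_linear _ _ _ _)).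
move: s' t; apply: tensor2_ext => [q|p|q|p|p1 p2 q1 q2].
- exact: (lin_comp (la u) (P3_linp _ a b c)).
- exact: (lin_comp (la v) (P3_linq _ a b c)).
- exact: (lin_comp (P2_linp q b c) (mu_linr _)).
- exact: (lin_comp (P2_linq p b c) (mu_linr _)).
by rewrite !tassoc_pure P3_pure !P2_pure muA.
Qed.

Lemma P2_P2r p q p' q' a b c :
  P2 p q a (P2 p' q' b c) =
  P3 (id_comul p * one_tensor p') (id_comul q * one_tensor q') a b c.
Proof.
have lD : linear (@id_comul K g br U).
  exact: (lin_comp (tmap_linear (@lin_id _ U) (@comul_linear _ _ br)) (@tassoc_linear _ _ _ _)).
move: p q; apply: tensor2_ext => [q|p|q|p|p1 p2 q1 q2].
- exact: P2_linp.
- exact: P2_linq.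
- exact: (lin_comp (lin_comp lD (mul_linl _)) (P3_linp _ a b c)).
- exact: (lin_comp (lin_comp lD (mul_linl _)) (P3_linq _ a b c)).
rewrite /id_comul /one_tensor !(tmap_pure _ _ (@lin_id _ U) (@comul_linear _ _ br)).
by rewrite -!tassocM !tensorM !mulr1 P3_assoc P2_comul P2_pure.
Qed.

(* At a point [e], the vector field [L x] is the opposite of [R (B x)] for some
   endomorphism [B] of the Lie algebra. As [L] and [R] commute, an element [u]
   acting through [L] can therefore be replaced by its image under [B] acting
   through [R] in the reverse order and with the opposite sign, that is, by
   its image under [B] and the antipode. *)
Section Point.
Variables (e : M -> K^o) (B : g -> g).
Hypotheses (e_lin : linear e) (eM : forall a b, e (mu a b) = e a * e b)
  (B_lin : linear B) (B_br : forall x y, B (br x y) = br (B x) (B y))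
  (eLR : forall x m, e (L x m) = - e (R (B x) m)).

Definition uea_map : U -> U := ulift (fun x => uinj br (B x)).

Lemma uea_map_lie : lie_map br (fun x => uinj br (B x)).
Proof.
have [il ib] := uinj_lie_map br.
by split=> [a x y|x y]; rewrite ?B_lin ?il// B_br ib.
Qed.
Lemma uea_map_linear : linear uea_map.
Proof. by move=> a u v; exact: (uliftP uea_map_lie). Qed.
Lemma uea_mapM u v : uea_map (u * v) = uea_map u * uea_map v.
Proof. exact: (uliftM uea_map_lie). Qed.
Lemma uea_map1 : uea_map 1 = 1.
Proof. exact: (ulift1 uea_map_lie). Qed.
Lemma uea_map_inj x : uea_map (uinj br x) = uinj br (B x).
Proof. exact: (ulift_inj uea_map_lie). Qed.

Definition anti_map (u : U) : U := s (uea_map u).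
Lemma anti_map_linear : linear anti_map.
Proof. exact: (lin_comp uea_map_linear (@antipode_linear _ _ br)). Qed.
Lemma anti_map_anti u v : anti_map (u * v) = anti_map v * anti_map u.
Proof. by rewrite /anti_map uea_mapM antipodeM. Qed.

Lemma eul u m : e (ul u m) = e (ur (anti_map u) m).
Proof.
elim/uea_ind: u m => [|a u v hu hv|x u hu] m.
- by rewrite /anti_map uea_map1 antipode1 ul1 ur1.
- by rewrite ulD e_lin hu hv anti_map_linear urD e_lin.
rewrite ulM uli eLR anti_map_anti urM -ul_R hu.
have -> : anti_map (uinj br x) = - uinj br (B x) by rewrite /anti_map uea_map_inj antipode_inj.
by rewrite (linN (urD m)) uri (linN (urr _)) (linN e_lin).
Qed.

Lemma elr u v m : e (lr u v m) = e (ur (anti_map u * v) m).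
Proof. by rewrite /lr eul urM. Qed.

Definition N2 (a b : M) (t : U2) : K^o := tlift (fun t1 t2 => e (ur t1 a) * e (ur t2 b)) t.
Lemma N2_bil a b : bilinear_map (fun t1 t2 => e (ur t1 a) * e (ur t2 b) : K^o).
Proof.
split=> [t2|t1] d u v /=; rewrite urD e_lin.
  by rewrite mulrDl scalerAl.
by rewrite mulrDr scalerAr.
Qed.
Definition N3 (a b c : M) (t : U3) : K^o := tlift (fun t12 t3 => N2 a b t12 * e (ur t3 c)) t.
Lemma N3_bil a b c : bilinear_map (fun t12 t3 => N2 a b t12 * e (ur t3 c) : K^o).
Proof.
split=> [t3|t12] d u v /=.
  by rewrite /N2 (tlift_linear (N2_bil a b)) mulrDl scalerAl.
by rewrite urD e_lin mulrDr scalerAr.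
Qed.
Lemma N3_linear a b c : linear (N3 a b c).
Proof. exact: (tlift_linear (N3_bil a b c)). Qed.

Definition anti_map2 : U2 -> U2 := tmap anti_map anti_map.
Definition anti_map3 : U3 -> U3 := tmap anti_map2 anti_map.
Lemma anti_map2_linear : linear anti_map2.
Proof. exact: (tmap_linear anti_map_linear anti_map_linear). Qed.
Lemma anti_map3_linear : linear anti_map3.
Proof. exact: (tmap_linear anti_map2_linear anti_map_linear). Qed.
Lemma anti_map3_anti x y : anti_map3 (x * y) = anti_map3 y * anti_map3 x.
Proof.
apply: (tmap_anti anti_map2_linear anti_map_linear); last exact: anti_map_anti.
exact: (tmap_anti anti_map_linear anti_map_linear anti_map_anti anti_map_anti).
Qed.

(** Since [L] and [R] commute, [p] can be applied after [q]; at the point [e] it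
    is then converted to act through [R], and stays on the left of [q]. *)
Lemma eP2 p q a b : e (P2 p q a b) = N2 a b (anti_map2 p * q).
Proof.
move: p q; apply: tensor2_ext => [q|p|q|p|p1 p2 q1 q2].
- exact: (lin_comp (P2_linp _ a b) e_lin).
- exact: (lin_comp (P2_linq _ a b) e_lin).
- exact: (lin_comp (lin_comp anti_map2_linear (mul_linl _)) (tlift_linear (N2_bil a b))).
- exact: (lin_comp (mul_linr _) (tlift_linear (N2_bil a b))).
rewrite P2_pure eM /anti_map2 (tmap_pure _ _ anti_map_linear anti_map_linear) tensorM.
by rewrite /N2 (tlift_pure _ _ (N2_bil a b)) !elr.
Qed.

Lemma eP3 p q a b c : e (P3 p q a b c) = N3 a b c (anti_map3 p * q).
Proof.
move: p q; apply: tensor2_ext => [q|p|q|p|p1 p2 q1 q2].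
- exact: (lin_comp (P3_linp _ a b c) e_lin).
- exact: (lin_comp (P3_linq _ a b c) e_lin).
- exact: (lin_comp (lin_comp anti_map3_linear (mul_linl _)) (N3_linear a b c)).
- exact: (lin_comp (mul_linr _) (N3_linear a b c)).
rewrite P3_pure eM /anti_map3 (tmap_pure _ _ anti_map2_linear anti_map_linear) tensorM.
by rewrite /N3 (tlift_pure _ _ (N3_bil a b c)) eP2 elr.
Qed.

(** The left factors [Phi] coming from the two cocycle equations meet in the
    middle as [anti_map3 Phi * Phi], and cancel. *)
Lemma eP3_series (Phi P Q : nat -> U3) a b c N :
  hmul (anti_map3 \o Phi) Phi = hcst 1 ->
  e (hconv (fun p q => P3 p q a b c) (hmul Phi P) (hmul Phi Q) N) =
  e (hconv (fun p q => P3 p q a b c) P Q N).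
Proof.
move=> HPhi; have E X Y : e (hconv (fun p q => P3 p q a b c) X Y N) =
    N3 a b c (hmul (anti_map3 \o X) Y N).
  rewrite hconvE (S2_lin _ _ e_lin) hmulE (S2_lin _ _ (N3_linear a b c)).
  by apply: eq_S2 => i j _; rewrite eP3.
rewrite !E (hmul_anti _ _ anti_map3_linear anti_map3_anti).
by rewrite hmulA -(hmulA (anti_map3 \o Phi)) HPhi hmul1r.
Qed.

End Point.

Section Star.
Variables (Phi : nat -> U3) (r1 r2 : g ⊗ g).
Variables (Q1 : quantum_group Phi r1) (Q2 : quantum_group Phi r2).

(** Coefficient of [h^N] of the product twisted by the inverse of the first twist
    through [L] and of the second one through [R]. *)
Definition starm (N : nat) (a b : M) : M :=
  hconv (fun p q => P2 p q a b) (twist_inv Q1) (twist_inv Q2) N.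

Lemma starm_lina N b : linear (fun a => starm N a b).
Proof.
move=> c u v; rewrite /starm /hconv scaler_sumr -big_split /=.
by apply: eq_bigr => i _; exact: P2_lina.
Qed.
Lemma starm_linb N a : linear (starm N a).
Proof.
move=> c u v; rewrite /starm /hconv scaler_sumr -big_split /=.
by apply: eq_bigr => i _; exact: P2_linb.
Qed.

Let comul_id_linear := tmap_linear (@comul_linear _ _ br) (@lin_id _ U).

Lemma id_comul_linear : linear (@id_comul K g br U).
Proof.
exact: (lin_comp (tmap_linear (@lin_id _ U) (@comul_linear _ _ br)) (@tassoc_linear _ _ _ _)).
Qed.
Lemma one_tensor_linear : linear (@one_tensor K g br U).
Proof. exact: (lin_comp (pure_linr 1) (@tassoc_linear _ _ _ _)). Qed.

Lemma comul_idM x y : tmap Delta id (x * y : U2) = tmap Delta id x * tmap Delta id y :> U3.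
Proof. exact: (tmapM (@comul_linear _ _ br) (@lin_id _ U) (@comulM _ _ br) (fun _ _ => erefl)). Qed.
Lemma id_comulM x y : id_comul (x * y : U2) = id_comul x * id_comul y :> U3.
Proof.
rewrite /id_comul -tassocM; congr tassoc.
exact: (tmapM (@lin_id _ U) (@comul_linear _ _ br) (fun _ _ => erefl) (@comulM _ _ br)).
Qed.
Lemma one_tensorM x y : one_tensor (x * y : U2) = one_tensor x * one_tensor y :> U3.
Proof. by rewrite /one_tensor -tassocM pureM1. Qed.
Lemma comul_id1 : tmap Delta id (1 : U2) = 1 :> U3.
Proof.
by rewrite (tmap_pure (1 : U) (1 : U) (@comul_linear _ _ br) (@lin_id _ U)) comul1.
Qed.
Lemma tassoc1 : tassoc (1 : U ⊗ U2) = 1 :> U3.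
Proof. exact: (tassoc_pure (1 : U) (1 : U) (1 : U)). Qed.
Lemma id_comul1 : id_comul (1 : U2) = 1 :> U3.
Proof.
rewrite /id_comul (tmap_pure (1 : U) (1 : U) (@lin_id _ U) (@comul_linear _ _ br)) comul1.
exact: tassoc1.
Qed.
Lemma one_tensor1 : one_tensor (1 : U2) = 1 :> U3.
Proof. exact: tassoc1. Qed.

Lemma pure_1_morph x y : (x * y : U2) ⊗ (1 : U) = (x ⊗ 1) * (y ⊗ 1) :> U3.
Proof. exact: pure1M. Qed.

(** The inverse of the cocycle equation of the twist. The factor [Phi] appears
    in front, with the same series for both quantum groups. *)
Lemma cocycle_inverse (r : g ⊗ g) (Q : quantum_group Phi r) :
  hmul (@id_comul K g br U \o twist_inv Q) (@one_tensor K g br U \o twist_inv Q) =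
  hmul Phi (hmul (tmap Delta id \o twist_inv Q) ((fun t => t ⊗ 1) \o twist_inv Q)).
Proof.
have FF := twistK Q; have F'F := twist_invK Q.
have m1 (f : U2 -> U3) : linear f -> (forall x y, f (x * y) = f x * f y) -> f 1 = 1 ->
    hmul (f \o twist Q) (f \o twist_inv Q) = hcst 1.
  by move=> lf fM f1; rewrite -(hmul_morph _ _ lf fM) FF (hcst_morph lf f1).
have m2 (f : U2 -> U3) : linear f -> (forall x y, f (x * y) = f x * f y) -> f 1 = 1 ->
    hmul (f \o twist_inv Q) (f \o twist Q) = hcst 1.
  by move=> lf fM f1; rewrite -(hmul_morph _ _ lf fM) F'F (hcst_morph lf f1).
set X' := hmul (tmap Delta id \o _) _; set Y' := hmul (@id_comul _ _ _ _ \o _) _.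
set X := hmul ((fun t => t ⊗ 1) \o twist Q) (tmap Delta id \o twist Q).
set Y := hmul (@one_tensor K g br U \o twist Q) (@id_comul K g br U \o twist Q).
have XX : hmul X X' = hcst 1.
  rewrite /X /X' hmulA -(hmulA (tmap Delta id \o twist Q)).
  rewrite (m1 _ comul_id_linear comul_idM comul_id1) hmul1r.
  exact: (m1 _ (pure_linl 1) pure_1_morph (erefl _)).
have YY : hmul Y' Y = hcst 1.
  rewrite /Y /Y' hmulA -(hmulA (@one_tensor _ _ _ _ \o twist_inv Q)).
  rewrite (m2 _ one_tensor_linear one_tensorM one_tensor1) hmul1r.
  exact: (m2 _ id_comul_linear id_comulM id_comul1).
have XY : X = hmul Y Phi by exact: twist_cocycle.
by rewrite -[RHS]hmul1r -YY hmulA -(hmulA Y) -XY XX hmulr1.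
Qed.

Lemma starm_left N a b c :
  S2 N (fun i j => starm i (starm j a b) c) =
  hconv (fun p q => P3 p q a b c)
    (hmul (tmap Delta id \o twist_inv Q1) ((fun t => t ⊗ 1) \o twist_inv Q1))
    (hmul (tmap Delta id \o twist_inv Q2) ((fun t => t ⊗ 1) \o twist_inv Q2)) N.
Proof.
rewrite hconvE.
rewrite (eq_S2 (F' := fun i j => S2 i (fun p q => S2 j (fun p' q' =>
   P3 (tmap Delta id (twist_inv Q1 p) * (twist_inv Q1 p' ⊗ 1))
      (tmap Delta id (twist_inv Q2 q) * (twist_inv Q2 q' ⊗ 1)) a b c)))); last first.
  move=> i j _; rewrite /starm hconvE; apply: eq_S2 => p q _.
  rewrite hconvE (S2_lin _ _ (P2_lina _ _ c)); apply: eq_S2 => p' q' _.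
  exact: P2_P2l.
rewrite S2ACA; apply: eq_S2 => i j _.
rewrite hmulE (S2_lin _ _ (P3_linp _ a b c)); apply: eq_S2 => p p' _.
by rewrite hmulE (S2_lin _ _ (P3_linq _ a b c)).
Qed.

Lemma starm_right N a b c :
  S2 N (fun i j => starm i a (starm j b c)) =
  hconv (fun p q => P3 p q a b c)
    (hmul (@id_comul K g br U \o twist_inv Q1) (@one_tensor K g br U \o twist_inv Q1))
    (hmul (@id_comul K g br U \o twist_inv Q2) (@one_tensor K g br U \o twist_inv Q2)) N.
Proof.
rewrite hconvE.
rewrite (eq_S2 (F' := fun i j => S2 i (fun p q => S2 j (fun p' q' =>
   P3 (id_comul (twist_inv Q1 p) * one_tensor (twist_inv Q1 p'))
      (id_comul (twist_inv Q2 q) * one_tensor (twist_inv Q2 q')) a b c)))); last first.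
  move=> i j _; rewrite /starm hconvE; apply: eq_S2 => p q _.
  rewrite hconvE (S2_lin _ _ (P2_linb _ _ a)); apply: eq_S2 => p' q' _.
  exact: P2_P2r.
rewrite S2ACA; apply: eq_S2 => i j _.
rewrite hmulE (S2_lin _ _ (P3_linp _ a b c)); apply: eq_S2 => p p' _.
by rewrite hmulE (S2_lin _ _ (P3_linq _ a b c)).
Qed.

(** By [starm_left] and [starm_right] the two iterated products are given by
    [P3] at the inverses of the two sides of the cocycle equations, which differ
    by [Phi] both for [L] and for [R]. At each point these two factors cancel
    by [eP3_series], and points separate the elements of [M]. *)
Lemma starm_assoc (I : Type) (e : I -> M -> K^o) (B : I -> g -> g) :
  (forall i, linear (e i)) -> (forall i a b, e i (mu a b) = e i a * e i b) ->
  (forall i, linear (B i)) -> (forall i x y, B i (br x y) = br (B i x) (B i y)) ->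
  (forall i x m, e i (L x m) = - e i (R (B i x) m)) ->
  (forall a b, (forall i, e i a = e i b) -> a = b) ->
  (forall i, hmul (anti_map3 (B i) \o Phi) Phi = hcst 1) ->
  forall N a b c, S2 N (fun i j => starm i (starm j a b) c) =
                  S2 N (fun i j => starm i a (starm j b c)).
Proof.
move=> e_lin eM B_lin B_br eLR e_sep HPhi N a b c.
rewrite starm_left starm_right !cocycle_inverse; apply: e_sep => i.
by rewrite (eP3_series (e_lin i) (eM i) (B_lin i) (B_br i) (eLR i)).
Qed.

Local Notation H := (U ⊗ U)%type.
Definition hact (w : H) (a : M) : M := tlift (fun u v => lr u v a) w.

Lemma hact_bil a : bilinear_map (fun u v => lr u v a).
Proof. by split=> [v|u]; [exact: lr_linl|exact: lr_linm]. Qed.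
Lemma hact_linear a : linear (fun w => hact w a).
Proof. exact: (tlift_linear (hact_bil a)). Qed.
Lemma hact_pure u v a : hact (u ⊗ v) a = lr u v a.
Proof. by rewrite /hact (tlift_pure _ _ (hact_bil a)). Qed.

Definition starm_tensor (j : nat) (a b : M) (T : H ⊗ H) : M :=
  tlift (fun b1 b2 => starm j (hact b1 a) (hact b2 b)) T.
Lemma starm_tensor_bil j a b : bilinear_map (fun b1 b2 => starm j (hact b1 a) (hact b2 b)).
Proof.
split=> [b2|b1] c u v /=; first by rewrite (hact_linear a) starm_lina.
by rewrite (hact_linear b) starm_linb.
Qed.
Lemma starm_tensor_linear j a b : linear (starm_tensor j a b).
Proof. exact: (tlift_linear (starm_tensor_bil j a b)). Qed.

Lemma tswap23_bil3 (m n : U) : bilinear_map (fun p q : U => (m ⊗ p) ⊗ (n ⊗ q)).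
Proof.
split=> [q|p] c u v /=; first by rewrite (pure_linr m) (pure_linl (n ⊗ q)).
by rewrite (pure_linr n) (pure_linr (m ⊗ p)).
Qed.
Lemma tswap23_bil2 (pq : U2) :
  bilinear_map (fun m n : U => tlift (fun p q : U => (m ⊗ p) ⊗ (n ⊗ q)) pq).
Proof.
split=> [n|m]; apply: tlift_lin_param => p q c u v.
  by rewrite (pure_linl p) (pure_linl (n ⊗ q)).
by rewrite (pure_linl q) (pure_linr (m ⊗ p)).
Qed.
Lemma tswap23_bil : bilinear_map (fun mn pq : U2 =>
  tlift (fun m n : U => tlift (fun p q : U => (m ⊗ p) ⊗ (n ⊗ q)) pq) mn).
Proof.
split=> [pq|mn]; first exact: (tlift_linear (tswap23_bil2 pq)).
by apply: tlift_lin_param => m n; exact: (tlift_linear (tswap23_bil3 m n)).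
Qed.
Lemma tswap23_linear : linear (@tswap23 K U U U U).
Proof. exact: (tlift_linear tswap23_bil). Qed.
Lemma tswap23_pure (m n p q : U) :
  tswap23 ((m ⊗ n) ⊗ (p ⊗ q)) = (m ⊗ p) ⊗ (n ⊗ q).
Proof.
rewrite /tswap23 (tlift_pure _ _ tswap23_bil) (tlift_pure _ _ (tswap23_bil2 _)).
by rewrite (tlift_pure _ _ (tswap23_bil3 _ _)).
Qed.

Lemma starm_tensor_swap j a b p q : starm_tensor j a b (tswap23 (p ⊗ q)) =
  S2 j (fun c d => P2 (twist_inv Q1 c * p) (twist_inv Q2 d * q) a b).
Proof.
have lS F : (forall c d, linear (F c d : U2 -> M)) -> linear (fun p => S2 j (fun c d => F c d p)).
  move=> lF z u v; rewrite /S2 scaler_sumr -big_split.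
  by apply: eq_bigr => i _; exact: lF.
move: p q; apply: tensor2_ext => [q|p|q|p|p1 p2 q1 q2].
- exact: (lin_comp (lin_comp (pure_linl q) tswap23_linear) (starm_tensor_linear j a b)).
- exact: (lin_comp (lin_comp (pure_linr p) tswap23_linear) (starm_tensor_linear j a b)).
- by apply: lS => c d; exact: (lin_comp (mul_linr _) (P2_linp _ a b)).
- by apply: lS => c d; exact: (lin_comp (mul_linr _) (P2_linq _ a b)).
rewrite tswap23_pure /starm_tensor (tlift_pure _ _ (starm_tensor_bil j a b)) !hact_pure.
by rewrite /starm hconvE; apply: eq_S2 => c d _; rewrite P2_mulr.
Qed.

Lemma hcst_mul (A : algType K) (c : A) (a : nat -> A) : hmul (hcst c) a = (fun n => c * a n).
Proof.
apply/funext => N; rewrite /hmul /hconv big_ord_recl /= subn0 big1 ?addr0// => i _.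
by rewrite mul0r.
Qed.

(** The twisted comultiplication is conjugate to [Delta] by the twist, so that
    moving it across the inverse twist recovers [Delta]. *)
Lemma twist_inv_qcomul (r : g ⊗ g) (Q : quantum_group Phi r) u :
  hmul (twist_inv Q) (qcomul Q u) = (fun n => Delta u * twist_inv Q n).
Proof. by rewrite /qcomul (hmulA (twist Q)) -(hmulA (twist_inv Q) (twist Q)) twist_invK hmul1r hcst_mul. Qed.

Lemma S2_hmul_P2 l (A B : nat -> U2) a b :
  S2 l (fun r j => S2 r (fun p q => S2 j (fun c d =>
    P2 (twist_inv Q1 c * A p) (twist_inv Q2 d * B q) a b))) =
  S2 l (fun i j => P2 (hmul (twist_inv Q1) A i) (hmul (twist_inv Q2) B j) a b).
Proof.
rewrite S2ACA; apply: eq_S2 => i j _; rewrite S2C hmulE.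
rewrite (S2_lin _ _ (P2_linp _ a b)); apply: eq_S2 => c p _.
by rewrite S2C hmulE (S2_lin _ _ (P2_linq _ a b)).
Qed.

(** [Delta_h (u) = F Delta (u) F^-1], hence [F^-1 Delta_h (u) = Delta (u) F^-1],
    and [Delta (u)] followed by the multiplication is the action of [u] on the
    product by [P2_comul]. *)
Lemma starm_invariant (b : nat -> H) x y n :
  hconv hact b (fun j => starm j x y) n =
  hconv (fun T j => starm_tensor j x y T) (qcomul2 Q1 Q2 b) id n.
Proof.
rewrite !hconvE.
rewrite [RHS](eq_S2 (F' := fun i j => S2 i (fun k r => starm_tensor j x y (tlift (fun u v =>
  hconv (fun p q => tswap23 (p ⊗ q)) (qcomul Q1 u) (qcomul Q2 v) r) (b k))))); last first.
  move=> i j _; rewrite /qcomul2 /hext -/(S2 i (fun k r => tlift (fun u v =>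
  hconv (fun p q => tswap23 (p ⊗ q)) (qcomul Q1 u) (qcomul Q2 v) r) (b k))).
  exact: (S2_lin _ _ (starm_tensor_linear j x y)).
rewrite S2A; apply: eq_S2 => k l _.
have bl r : bilinear_map (fun u v =>
    hconv (fun p q => tswap23 (p ⊗ q)) (qcomul Q1 u) (qcomul Q2 v) r).
  have lq (r' : g ⊗ g) (Q : quantum_group Phi r') i : linear (fun u => qcomul Q u i).
    move=> c u v; rewrite /qcomul /hmul /hconv scaler_sumr -big_split.
    apply: eq_bigr => k' _; rewrite /= scalerAl -mulrDl; congr (_ * _).
    rewrite scaler_sumr -big_split; apply: eq_bigr => k'' _ /=.
    rewrite scalerAr -mulrDr; congr (_ * _).
    by case: (k' - k'')%N => [|m] /=; rewrite ?comul_linear ?scaler0 ?addr0.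
  split=> [v|u] c w w' /=; rewrite /hconv scaler_sumr -big_split; apply: eq_bigr => i _ /=.
    by rewrite lq (pure_linl (qcomul Q2 v _)) tswap23_linear.
  by rewrite lq (pure_linr (qcomul Q1 u _)) tswap23_linear.
have lD : linear (fun w => S2 l (fun r j => starm_tensor j x y (tlift (fun u v =>
    hconv (fun p q => tswap23 (p ⊗ q)) (qcomul Q1 u) (qcomul Q2 v) r) w))).
  move=> c w w'; rewrite /S2 scaler_sumr -big_split; apply: eq_bigr => i _ /=.
  by rewrite (tlift_linear (bl i)) starm_tensor_linear.
move: (b k); apply: (tensor_lin_ext (hact_linear _) lD) => u v.
rewrite hact_pure.
rewrite (eq_S2 (F' := fun r j => S2 r (fun p q => S2 j (fun c d =>
    P2 (twist_inv Q1 c * qcomul Q1 u p) (twist_inv Q2 d * qcomul Q2 v q) x y)))); last first.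
  move=> r j _; rewrite (tlift_pure _ _ (bl r)) hconvE (S2_lin _ _ (starm_tensor_linear j x y)).
  by apply: eq_S2 => p q _; exact: starm_tensor_swap.
rewrite S2_hmul_P2 !twist_inv_qcomul /starm hconvE (S2_lin _ _ (lr_linr u v)).
by apply: eq_S2 => i j _; rewrite P2_comul.
Qed.

Lemma twist_inv0 (r : g ⊗ g) (Q : quantum_group Phi r) : twist_inv Q 0%N = 1.
Proof.
have := congr1 (fun h => h 0%N) (twistK Q).
by rewrite /hmul /hconv big_ord1 /= twist_0 mul1r.
Qed.

Lemma starm0 a b : starm 0 a b = mu a b.
Proof.
rewrite /starm /hconv big_ord1 !twist_inv0.
by apply: (etrans (P2_pure (1 : U) (1 : U) (1 : U) (1 : U) a b)); rewrite !lr1.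
Qed.

Local Notation eps := (@counit K g br).

Definition epsl (p : U2) : U := tlift (fun u v => eps u *: v) p.
Definition epsr (p : U2) : U := tlift (fun u v => eps v *: u) p.

Lemma epsl_bil : @bilinear_map K U U U (fun u v => (eps u : K) *: v).
Proof.
split=> [v|u] c w w' /=; first by rewrite counit_linear scalerDl scalerA.
by rewrite scalerDr !scalerA mulrC.
Qed.
Lemma epsr_bil : @bilinear_map K U U U (fun u v => (eps v : K) *: u).
Proof.
split=> [v|u] c w w' /=; last by rewrite counit_linear scalerDl scalerA.
by rewrite scalerDr !scalerA mulrC.
Qed.
Lemma epsl_linear : linear epsl. Proof. exact: (tlift_linear epsl_bil). Qed.
Lemma epsr_linear : linear epsr. Proof. exact: (tlift_linear epsr_bil). Qed.

Lemma epslM x y : epsl (x * y) = epsl x * epsl y.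
Proof.
move: x y; apply: tensor2_ext => [q|p|q|p|p1 p2 q1 q2].
- exact: (lin_comp (mul_linl _) epsl_linear).
- exact: (lin_comp (mul_linr _) epsl_linear).
- exact: (lin_comp epsl_linear (mul_linl _)).
- exact: (lin_comp epsl_linear (mul_linr _)).
rewrite tensorM /epsl !(tlift_pure _ _ epsl_bil) counitM.
by rewrite -scalerAl -scalerAr scalerA.
Qed.
Lemma epsrM x y : epsr (x * y) = epsr x * epsr y.
Proof.
move: x y; apply: tensor2_ext => [q|p|q|p|p1 p2 q1 q2].
- exact: (lin_comp (mul_linl _) epsr_linear).
- exact: (lin_comp (mul_linr _) epsr_linear).
- exact: (lin_comp epsr_linear (mul_linl _)).
- exact: (lin_comp epsr_linear (mul_linr _)).
rewrite tensorM /epsr !(tlift_pure _ _ epsr_bil) counitM.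
by rewrite -scalerAl -scalerAr scalerA.
Qed.

Lemma twist_inv_epsl (r : g ⊗ g) (Q : quantum_group Phi r) : epsl \o twist_inv Q = hcst 1.
Proof.
have c1 : epsl \o twist Q = hcst 1 by exact: (twist_counitl Q).
have e1 : epsl (1 : U2) = 1.
  by apply: (etrans (tlift_pure (1 : U) (1 : U) epsl_bil)); rewrite counit1 scale1r.
have := hmul_morph (twist Q) (twist_inv Q) epsl_linear epslM.
by rewrite c1 hmul1r twistK => <-; exact: (hcst_morph epsl_linear e1).
Qed.
Lemma twist_inv_epsr (r : g ⊗ g) (Q : quantum_group Phi r) : epsr \o twist_inv Q = hcst 1.
Proof.
have c1 : epsr \o twist Q = hcst 1 by exact: (twist_counitr Q).
have e1 : epsr (1 : U2) = 1.
  by apply: (etrans (tlift_pure (1 : U) (1 : U) epsr_bil)); rewrite counit1 scale1r.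
have := hmul_morph (twist Q) (twist_inv Q) epsr_linear epsrM.
by rewrite c1 hmul1r twistK => <-; exact: (hcst_morph epsr_linear e1).
Qed.

Section constant.
Variable k : M.
Hypotheses (Lk : forall x, L x k = 0) (Rk : forall x, R x k = 0).

Lemma ul_cst u : ul u k = eps u *: k.
Proof.
elim/uea_ind: u => [|c u v hu hv|x u hu].
- by rewrite ul1 counit1 scale1r.
- by rewrite ulD hu hv counit_linear scalerDl scalerA.
by rewrite ulM uli hu (linZ (rd_linr LD x)) Lk scaler0 counitM counit_inj mul0r scale0r.
Qed.
Lemma ur_cst u : ur u k = eps u *: k.
Proof.
elim/uea_ind: u => [|c u v hu hv|x u hu].
- by rewrite ur1 counit1 scale1r.
- by rewrite urD hu hv counit_linear scalerDl scalerA.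
by rewrite urM uri hu (linZ (rd_linr RD x)) Rk scaler0 counitM counit_inj mul0r scale0r.
Qed.
Lemma lr_cst u v : lr u v k = (eps u * eps v) *: k.
Proof. by rewrite /lr ur_cst (linZ (ulr u)) ul_cst scalerA mulrC. Qed.

Lemma P2_cstl p q b : P2 p q k b = mu k (lr (epsl p) (epsl q) b).
Proof.
move: p q; apply: tensor2_ext => [q|p|q|p|p1 p2 q1 q2].
- exact: P2_linp.
- exact: P2_linq.
- exact: (lin_comp (lin_comp epsl_linear (lr_linl _ b)) (mu_linr k)).
- exact: (lin_comp (lin_comp epsl_linear (lr_linm _ b)) (mu_linr k)).
rewrite P2_pure lr_cst (linZ (mu_linl _)) /epsl !(tlift_pure _ _ epsl_bil).
by rewrite (linZ (lr_linl _ b)) (linZ (lr_linm _ b)) scalerA (linZ (mu_linr k)).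
Qed.
Lemma P2_cstr p q b : P2 p q b k = mu (lr (epsr p) (epsr q) b) k.
Proof.
move: p q; apply: tensor2_ext => [q|p|q|p|p1 p2 q1 q2].
- exact: P2_linp.
- exact: P2_linq.
- exact: (lin_comp (lin_comp epsr_linear (lr_linl _ b)) (mu_linl k)).
- exact: (lin_comp (lin_comp epsr_linear (lr_linm _ b)) (mu_linl k)).
rewrite P2_pure lr_cst (linZ (mu_linr _)) /epsr !(tlift_pure _ _ epsr_bil).
by rewrite (linZ (lr_linl _ b)) (linZ (lr_linm _ b)) scalerA (linZ (mu_linl k)).
Qed.

(** An element killed by [L] and [R] is acted on through the counit, which sends
    the twists to [1]. *)
Lemma starm_cst N b : (0 < N)%N -> starm N k b = 0 /\ starm N b k = 0.
Proof.
move=> N0; have E (r : g ⊗ g) (Q : quantum_group Phi r) i :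
    epsl (twist_inv Q i) = hcst 1 i /\ epsr (twist_inv Q i) = hcst 1 i.
  by split; [have := twist_inv_epsl Q|have := twist_inv_epsr Q] => /(congr1 (fun h => h i)).
split; rewrite /starm /hconv big1// => i _; rewrite ?P2_cstl ?P2_cstr.
  rewrite !(E _ _ _).1; case: (val i) => [|m]; rewrite ?subn0 /=.
    by case: N N0 i => // N _ _ /=; rewrite (lin0 (lr_linm _ b)) (lin0 (mu_linr k)).
  by rewrite (lin0 (lr_linl _ b)) (lin0 (mu_linr k)).
rewrite !(E _ _ _).2; case: (val i) => [|m]; rewrite ?subn0 /=.
  by case: N N0 i => // N _ _ /=; rewrite (lin0 (lr_linm _ b)) (lin0 (mu_linl k)).
by rewrite (lin0 (lr_linl _ b)) (lin0 (mu_linl k)).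
Qed.
End constant.

End Star.
End BiModuleAlgebra.

(** * Lie algebra endomorphisms acting on the triple tensor power *)

Opaque uea_map.

Section AutFunctor.
Variables (K : fieldType) (g : lmodType K) (br : g -> g -> g).
Local Notation U := (uea br).
Local Notation U2 := (U ⊗ U)%type.
Local Notation U3 := (U2 ⊗ U)%type.

Definition lie_endo (B : g -> g) : Prop :=
  linear B /\ forall x y, B (br x y) = br (B x) (B y).

Definition uea_map3 (B : g -> g) : U3 -> U3 := tmap (tmap (@uea_map K g br B) (@uea_map K g br B)) (@uea_map K g br B).

Section one.
Variable B : g -> g.
Hypothesis hB : lie_endo B.
Let ul := uea_map_linear hB.1 hB.2.
Let ul2 := tmap_linear ul ul.
Lemma uea_map3_linear : linear (uea_map3 B).
Proof. exact: (tmap_linear ul2 ul). Qed.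
Lemma uea_map3_pure u v w : uea_map3 B ((u ⊗ v) ⊗ w) = ((@uea_map K g br) B u ⊗ (@uea_map K g br) B v) ⊗ (@uea_map K g br) B w.
Proof. by rewrite /uea_map3 (tmap_pure _ _ ul2 ul) (tmap_pure _ _ ul ul). Qed.
Lemma uea_map3M x y : uea_map3 B (x * y) = uea_map3 B x * uea_map3 B y.
Proof.
apply: (tmapM ul2 ul); last exact: (uea_mapM hB.1 hB.2).
exact: (tmapM ul ul (uea_mapM hB.1 hB.2) (uea_mapM hB.1 hB.2)).
Qed.
End one.

Lemma tensor3_ext (P : lmodType K) (f h : U3 -> P) : linear f -> linear h ->
  (forall u v w, f ((u ⊗ v) ⊗ w) = h ((u ⊗ v) ⊗ w)) -> forall t, f t = h t.
Proof.
move=> lf lh H; apply: (tensor_lin_ext lf lh) => t w.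
move: t; apply: tensor_lin_ext => [||u v]; last exact: H.
- exact: (lin_comp (pure_linl w) lf).
- exact: (lin_comp (pure_linl w) lh).
Qed.

Lemma uea_map_comp B B' u : lie_endo B -> lie_endo B' ->
  (@uea_map K g br) (fun x => B' (B x)) u = (@uea_map K g br) B' ((@uea_map K g br) B u).
Proof.
move=> hB hB'.
have hC : lie_endo (fun x => B' (B x)).
  split=> [a x y|x y]; first by rewrite hB.1 hB'.1.
  by rewrite hB.2 hB'.2.
pose f := @uea_map K g br B'; elim/uea_ind: u => [|a u v hu hv|x u hu].
- apply: (etrans (uea_map1 hC.1 hC.2)); apply: esym.
  exact: (etrans (congr1 f (uea_map1 hB.1 hB.2)) (uea_map1 hB'.1 hB'.2)).
- have E := uea_map_linear hC.1 hC.2 a u v.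
  simpl in E.
  have E1 := uea_map_linear hB.1 hB.2 a u v.
  have E2 := uea_map_linear hB'.1 hB'.2 a (uea_map B u) (uea_map B v).
  by rewrite E hu hv E1 E2.
- apply: (etrans (uea_mapM hC.1 hC.2 _ _)); rewrite hu (uea_map_inj hC.1 hC.2); apply: esym.
  apply: (etrans (congr1 f (uea_mapM hB.1 hB.2 _ _))).
  apply: (etrans (uea_mapM hB'.1 hB'.2 _ _)); congr (_ * _).
  by rewrite (uea_map_inj hB.1 hB.2) /f (uea_map_inj hB'.1 hB'.2).
Qed.

Lemma uea_map3_comp B B' t : lie_endo B -> lie_endo B' ->
  uea_map3 (fun x => B' (B x)) t = uea_map3 B' (uea_map3 B t).
Proof.
move=> hB hB'.
have hC : lie_endo (fun x => B' (B x)).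
  split=> [a x y|x y]; first by rewrite hB.1 hB'.1.
  by rewrite hB.2 hB'.2.
move: t; apply: tensor3_ext => [||u v w]; first exact: uea_map3_linear.
- exact: (lin_comp (uea_map3_linear hB) (uea_map3_linear hB')).
- apply: (etrans (uea_map3_pure hC u v w)); apply: esym.
  apply: (etrans (congr1 (uea_map3 B') (uea_map3_pure hB u v w))).
  apply: (etrans (uea_map3_pure hB' _ _ _)).
  by rewrite (uea_map_comp u hB hB') (uea_map_comp v hB hB') (uea_map_comp w hB hB').
Qed.

Lemma uea_map_id u : (@uea_map K g br) id u = u.
Proof.
have h1 : linear (@id g) by [].
have h2 x y : id (br x y) = br (id x) (id y) by [].
elim/uea_ind: u => [|a u v hu hv|x u hu].
- exact: (uea_map1 h1 h2).
- by rewrite (uea_map_linear h1 h2) hu hv.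
- by rewrite (uea_mapM h1 h2) hu (uea_map_inj h1 h2).
Qed.
Lemma uea_map3_id t : uea_map3 id t = t.
Proof.
have hid : lie_endo id by split.
move: t; apply: tensor3_ext => [||u v w]; first exact: uea_map3_linear.
- by [].
- by apply: (etrans (uea_map3_pure hid u v w)); rewrite (uea_map_id u) (uea_map_id v) (uea_map_id w).
Qed.

Definition slot (i : 'I_3) (u : U) : U3 :=
  match val i with 0%N => (u ⊗ 1) ⊗ 1 | 1%N => (1 ⊗ u) ⊗ 1 | _ => 1 ⊗ u end.

Lemma slot_linear i : linear (slot i).
Proof.
move=> a u v; rewrite /slot; case: (val i) => [|[|_]].
- by rewrite (pure_linl 1) (pure_linl 1).
- by rewrite (pure_linr 1) (pure_linl 1).
- exact: (pure_linr 1).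
Qed.
Lemma slotM i u v : slot i (u * v) = slot i u * slot i v.
Proof.
by rewrite /slot; case: (val i) => [|[|_]]; rewrite !tensorM ?mulr1 ?mul1r.
Qed.
Lemma slot1 i : slot i 1 = 1.
Proof. by rewrite /slot; case: (val i) => [|[|_]]. Qed.

Lemma uea_map3_slot B i u : lie_endo B -> uea_map3 B (slot i u) = slot i ((@uea_map K g br) B u).
Proof.
move=> hB; have B1 := uea_map1 hB.1 hB.2; rewrite /slot; case: (val i) => [|[|_]].
- by rewrite (uea_map3_pure hB) !B1.
- by rewrite (uea_map3_pure hB) !B1.
- by apply: (etrans (uea_map3_pure hB 1 1 u)); rewrite !B1.
Qed.

Definition diag3 (x : g) : U3 :=
  tmap (@comul K g br) id (@comul K g br (uinj br x)).

Definition sl0 : 'I_3 := @Ordinal 3 0 isT.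
Definition sl1 : 'I_3 := @Ordinal 3 1 isT.
Definition sl2 : 'I_3 := @Ordinal 3 2 isT.

Lemma diag3E x : diag3 x =
  slot sl0 (uinj br x) + slot sl1 (uinj br x) + slot sl2 (uinj br x).
Proof.
have lc := @comul_linear _ _ br; have lt := tmap_linear lc (@lin_id _ U).
rewrite /diag3 comul_inj (linD lt) !(tmap_pure _ _ lc (@lin_id _ U)) comul_inj comul1.
by rewrite (linD (pure_linl (1 : U))).
Qed.

Lemma slot_comm i j (x : g) u : i != j ->
  slot i (uinj br x) * slot j u = slot j u * slot i (uinj br x).
Proof.
case: i j => [[|[|[|//]]] hi] [[|[|[|//]]] hj] // _; rewrite /slot /=;
  rewrite !tensorM ?mulr1 ?mul1r; by [].
Qed.

(** The diagonal element is the sum of the copies of [x] in the three slots, and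
    copies in different slots commute. *)
Lemma diag3_slot x i u : diag3 x * slot i u - slot i u * diag3 x =
  slot i (uinj br x * u - u * uinj br x).
Proof.
have C j : j != i -> slot j (uinj br x) * slot i u - slot i u * slot j (uinj br x) = 0.
  by move=> ji; rewrite (slot_comm x u ji) subrr.
have E : slot i (uinj br x) * slot i u - slot i u * slot i (uinj br x) =
    slot i (uinj br x * u - u * uinj br x).
  by rewrite -!slotM (linD (slot_linear i)) (linN (slot_linear i)).
have S (a b c t : U3) : (a + b + c) * t - t * (a + b + c) =
    (a * t - t * a) + (b * t - t * b) + (c * t - t * c).
  by rewrite !mulrDl !mulrDr !opprD addrACA [X in X + _]addrACA.
rewrite diag3E S; case: i C E => [[|[|[|//]]] hi] C E.
- have e : sl0 = Ordinal hi by exact: val_inj.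
  by rewrite (C sl1)// (C sl2)// !addr0 e.
- have e : sl1 = Ordinal hi by exact: val_inj.
  by rewrite (C sl0)// (C sl2)// addr0 add0r e.
- have e : sl2 = Ordinal hi by exact: val_inj.
  by rewrite (C sl0)// (C sl1)// !add0r e.
Qed.

End AutFunctor.

(** * Ad-invariance of the associator *)

Opaque uea_map3.

Lemma pure3_slots (K : fieldType) (A B D : algType K) (a : A) (b : B) (d : D) :
  ((a ⊗ 1) ⊗ 1) * (((1 ⊗ b) ⊗ 1) * (((1 ⊗ 1) ⊗ d) * 1)) = (a ⊗ b) ⊗ d
    :> (A ⊗ B) ⊗ D.
Proof. by rewrite mulr1 !tensorM !mul1r !mulr1. Qed.

Lemma commutator_linear (K : fieldType) (A : algType K) (d : A) (z : K) t t' :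
  d * (z *: t + t') - (z *: t + t') * d =
  z *: (d * t - t * d) + (d * t' - t' * d).
Proof.
rewrite mulrDr mulrDl opprD addrACA scalerBr; congr (_ + _ + _).
  by rewrite scalerAr.
by rewrite scalerAl.
Qed.

Lemma commutator_mul (K : fieldType) (A : algType K) (d s t : A) :
  s * (d * t - t * d) + (d * s - s * d) * t = d * (s * t) - s * t * d.
Proof. by rewrite mulrBr mulrBl !mulrA addrC addrA subrK. Qed.

Lemma lin_mull (K : fieldType) (V : lmodType K) (A : algType K) (f : V -> A) :
  linear f -> forall t z u v, f (z *: u + v) * t = z *: (f u * t) + f v * t.
Proof. by move=> lf t z u v; rewrite lf mulrDl scalerAl. Qed.

Section AdDerivative.
Variables (R : realType) (G : complexLieGroup R).
Local Notation C := R[i].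
Local Notation n := (lie_dim G).
Local Notation g := (lie_algebra G).
Local Notation br := (@lie_bracket R G).
Local Notation td := (@tangent_derive R G).
Local Notation e_ j := (delta_mx ord0 j : g).

Definition Ad_inv (a : G) (X : g) : g := Adv a^-1%g X.

Lemma Ad_inv_endo a : lie_endo br (Ad_inv a).
Proof.
split=> [z X Y|X Y]; first exact: Adv_linear.
exact: Adv_bracket.
Qed.

Lemma Ad_inv_mul a b : Ad_inv (a * b)%g = (fun X => Ad_inv b (Ad_inv a X)).
Proof. by apply/funext => X; rewrite /Ad_inv invgM Adv_mul. Qed.

Lemma Ad_inv1 : Ad_inv 1%g = id.
Proof. by apply/funext => X; rewrite /Ad_inv invg1 Adv1. Qed.

(* An algebra [A] on which the group acts on the right by automorphisms [T a],
   like [Ad_(a^-1)], with infinitesimal action given by commutators with the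
   elements [D X]. *)
Variables (A : algType C) (T : G -> A -> A) (D : g -> A).
Hypotheses (T_lin : forall a, linear (T a))
  (T_mul : forall a x y, T a (x * y) = T a x * T a y)
  (T_1 : forall a, T a 1 = 1) (T_unit : forall t, T 1%g t = t)
  (T_comp : forall a b t, T (a * b)%g t = T b (T a t)).

(** [T a t] is a function of [a] with values in an infinite-dimensional space;
    it is differentiated after composition with an arbitrary linear form. Its
    derivative at [1] along [Y] is the opposite of the commutator with [D Y]. *)
Definition Ad_derivable (t : A) : Prop := forall l : A -> C^o, linear l ->
  germ_at true (fun a => l (T a t) : C) 1%g /\
  forall Y, td Y (fun a => l (T a t) : C) = - (l (D Y * t - t * D Y) : C).

Lemma Ad_derivable1 : Ad_derivable 1.
Proof.
move=> l ll; have E : (fun a => l (T a 1) : C) = fun=> l 1.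
  by apply/funext => a; rewrite T_1.
rewrite E; split; first exact: germ_at_cst.
by move=> Y; rewrite td_cst mulr1 mul1r subrr (lin0 ll) oppr0.
Qed.

Lemma Ad_derivable_lin z t t' : Ad_derivable t -> Ad_derivable t' -> Ad_derivable (z *: t + t').
Proof.
move=> ht ht' l ll; have [h1 h2] := ht l ll; have [h1' h2'] := ht' l ll.
have E : (fun a => l (T a (z *: t + t')) : C) = (fun a => z * l (T a t) + l (T a t')).
  by apply/funext => a; rewrite T_lin ll.
have hz := germ_atM (germ_at_cst true z 1%g) h1.
rewrite E; split; first exact: (germ_atD hz h1').
move=> Y; apply: (etrans (tdD Y (germ_at_smooth hz) (germ_at_smooth h1'))).
rewrite (tdM Y (germ_at_cst false z 1%g) (germ_at_smooth h1)) (td_cst Y z) mulr0 addr0 h2 h2'.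
rewrite mulrN -opprD; congr (- _).
by rewrite commutator_linear ll.
Qed.

Section Generators.
Variable j : g -> A.
Hypotheses (j_lin : linear j) (j_T : forall a X, T a (j X) = j (Ad_inv a X))
  (j_D : forall Y X, D Y * j X - j X * D Y = j (br Y X)).

Lemma gen_expand (l : A -> C^o) (X : g) t : linear l ->
  l (j X * t) = \sum_k X ord0 k * (l (j (e_ k) * t) : C) :> C.
Proof.
move=> ll; rewrite {1}[X]row_sum_delta (lin_sum j_lin) mulr_suml (lin_sum ll).
by apply: eq_bigr => k _; rewrite (linZ j_lin) -scalerAl (linZ ll).
Qed.

(** Leibniz rule: the value of [T a] on [j X * t] is the product of
    [j (Ad_(a^-1) X)], whose derivative is minus the bracket by [td_Adv_inv], and
    of [T a t]. *)
Lemma Ad_derivable_gen (X : g) t : Ad_derivable t -> Ad_derivable (j X * t).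
Proof.
move=> ht l ll; pose lj k (w : A) : C^o := l (j (e_ k) * w).
have llj k : linear (lj k) by exact: (lin_comp (mul_linr _) ll).
pose B k (a : G) : C := Ad_inv a X ord0 k.
have hB k : germ_at true (B k) 1%g by exact: Adv_inv_hol.
have hlj k := (ht (lj k) (llj k)).1.
have E : (fun a => l (T a (j X * t)) : C) =
    (fun a => \sum_k B k a * (lj k (T a t) : C)).
  by apply/funext => a; rewrite T_mul j_T; exact: gen_expand.
rewrite E; split.
  by apply: germ_at_sum => k; exact: (germ_atM (hB k) (hlj k)).
move=> Y.
apply: (etrans (td_sum Y (index_enum 'I_n) (fun k => germ_at_smooth (germ_atM (hB k) (hlj k))))).
pose Dt := D Y * t - t * D Y.
transitivity (\sum_k (X ord0 k * - (lj k Dt : C) + (lj k t : C) * - br Y X ord0 k)).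
  apply: eq_bigr => k _.
  apply: (etrans (tdM Y (germ_at_smooth (hB k)) (germ_at_smooth (hlj k)))).
  congr (_ * _ + _ * _).
  - by rewrite /B Ad_inv1.
  - exact: (ht (lj k) (llj k)).2.
  - by rewrite T_unit.
  - exact: td_Adv_inv.
rewrite big_split /=.
have -> : \sum_k X ord0 k * - (lj k Dt : C) = - (l (j X * Dt) : C).
  by rewrite (gen_expand X Dt ll) -sumrN; apply: eq_bigr => k _; rewrite mulrN.
have -> : \sum_k (lj k t : C) * - br Y X ord0 k = - (l (j (br Y X) * t) : C).
  by rewrite (gen_expand (br Y X) t ll) -sumrN; apply: eq_bigr => k _; rewrite mulrN mulrC.
rewrite -opprD -(linD ll); congr (- l _).
by rewrite -(j_D Y X) /Dt commutator_mul.
Qed.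
End Generators.

(** If [t] commutes with the elements [D X] then all derivatives of
    [a |-> l (T a t)] vanish at [1], hence everywhere by translation since [T] is
    multiplicative; connectedness concludes. Linear forms separate
    vectors. *)
Lemma Ad_invariant (t : A) : connected [set: G] -> (forall w, Ad_derivable w) ->
  (forall X, D X * t = t * D X) -> forall a, T a t = t.
Proof.
move=> cG Ad_derivable_all inv a; apply/eqP; rewrite -subr_eq0; apply/negP => /negP nz.
have [l [ll l1]] := exists_linear_form nz.
suff : l (T a t) = l t.
  by move=> E; move: l1; rewrite (linD ll) (linN ll) E subrr => /eqP; rewrite eq_sym oner_eq0.
pose q (x : G) : C := l (T x t).
have lB x : linear (fun w => l (T x w)) by exact: (lin_comp (T_lin x) ll).
have E x : (fun b => q (transl false x b)) = (fun b => l (T x (T b t))).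
  by apply/funext => b; rewrite /q /transl T_comp.
have hq x : germ_at true q x.
  have h := (Ad_derivable_all t _ (lB x)).1; rewrite -(E x) in h.
  have e1 : transl false x^-1%g x = 1%g by rewrite /transl mulgV.
  rewrite -e1 in h; have := germ_at_translate h.
  have -> : (fun y => q (transl false x (transl false x^-1%g y))) = q.
    by apply/funext => y; exact: (congr1 q (translV false x y)).
  by [].
have zq X x : ifield false X q x = 0.
  rewrite ifield_at ifield1 (E x) (Ad_derivable_all t _ (lB x)).2 inv subrr.
  by rewrite (lin0 (lB x)) oppr0.
have := connected_constant cG hq zq a.
by rewrite /q T_unit.
Qed.

End AdDerivative.

Section AdInvariance.
Variables (R : realType) (G : complexLieGroup R).
Local Notation C := R[i].
Local Notation g := (lie_algebra G).
Local Notation br := (@lie_bracket R G).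
Local Notation U := (uea br).
Local Notation U2 := (U ⊗ U)%type.
Local Notation U3 := (U2 ⊗ U)%type.
Local Notation B3 a := (uea_map3 (br := br) (Ad_inv a)).

Lemma B3_mul (a b : G) t : B3 (a * b)%g t = B3 b (B3 a t).
Proof. by rewrite Ad_inv_mul; exact: (uea_map3_comp t (Ad_inv_endo a) (Ad_inv_endo b)). Qed.

Lemma B3_unit t : B3 (1%g : G) t = t.
Proof. by rewrite Ad_inv1; exact: uea_map3_id. Qed.

Lemma B3_1 (a : G) : B3 a 1 = 1.
Proof.
have hB := Ad_inv_endo a.
by have := uea_map3_slot sl0 1 hB; rewrite (uea_map1 hB.1 hB.2) slot1.
Qed.

Lemma B3_slot_inj (a : G) i X : B3 a (slot i (uinj br X)) = slot i (uinj br (Ad_inv a X)).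
Proof.
have hB := Ad_inv_endo a.
exact: (etrans (uea_map3_slot i (uinj br X) hB) (congr1 (slot i) (uea_map_inj hB.1 hB.2 X))).
Qed.

Lemma diag3_slot_inj i (Y X : g) :
  diag3 br Y * slot i (uinj br X) - slot i (uinj br X) * diag3 br Y =
  slot i (uinj br (br Y X)).
Proof.
exact: (etrans (diag3_slot Y i (uinj br X)) (esym (congr1 (slot i) ((uinj_lie_map br).2 Y X)))).
Qed.

Local Notation Ad_derivable := (@Ad_derivable R G U3 (fun a => B3 a) (diag3 br)).
Let B3_lin (a : G) := uea_map3_linear (Ad_inv_endo a).
Let Ad_derivableL := @Ad_derivable_lin R G U3 (fun a => B3 a) (diag3 br) B3_lin.
Let slot_inj_lin i := lin_comp (uinj_lie_map br).1 (@slot_linear _ _ br i).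

Lemma Ad_derivable_slot i (X : g) t : Ad_derivable t -> Ad_derivable (slot i (uinj br X) * t).
Proof.
exact: (@Ad_derivable_gen R G U3 (fun a => B3 a) (diag3 br) (fun a => uea_map3M (Ad_inv_endo a))
  B3_unit _ (slot_inj_lin i) (fun a => B3_slot_inj a i) (diag3_slot_inj i) X t).
Qed.

Lemma Ad_derivable_slotU (i : 'I_3) (u : U) t : Ad_derivable t -> Ad_derivable (slot i u * t).
Proof.
elim/uea_ind: u t => [|z u v hu hv|X u hu] t ht.
- by rewrite slot1 mul1r.
- have -> : slot i (z *: u + v) * t = z *: (slot i u * t) + slot i v * t.
    exact: (lin_mull (@slot_linear _ _ br i) t z u v).
  by apply: Ad_derivableL; [exact: hu|exact: hv].
- have -> : slot i (uinj br X * u) * t = slot i (uinj br X) * (slot i u * t).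
    by apply: (etrans (congr1 (fun w => w * t) (slotM i (uinj br X) u))); exact: esym (mulrA _ _ _).
  by apply: Ad_derivable_slot; exact: hu.
Qed.

Lemma Ad_derivable_all t : Ad_derivable t.
Proof.
have g1 : Ad_derivable 1 := Ad_derivable1 (diag3 br) B3_1.
have Ad_derivable0 : Ad_derivable 0.
  by have := Ad_derivableL (-1) g1 g1; rewrite scaleN1r addNr.
have Ad_derivableD x y : Ad_derivable x -> Ad_derivable y -> Ad_derivable (x + y).
  by move=> hx hy; have := Ad_derivableL 1 hx hy; rewrite scale1r.
have P (u v w : U) : Ad_derivable ((u ⊗ v) ⊗ w).
  have -> : (u ⊗ v) ⊗ w = slot sl0 u * (slot sl1 v * (slot sl2 w * 1)) :> U3.
    exact: (esym (pure3_slots u v w)).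
  by do 3![apply: Ad_derivable_slotU]; exact: g1.
elim/tensor_ind: t => [|x w t ht]; first exact: Ad_derivable0.
apply: (Ad_derivableD _ _ _ ht); elim/tensor_ind: x => [|u v x hx].
  by rewrite (lin0 (pure_linl w)).
by rewrite (linD (pure_linl w)); exact: (Ad_derivableD _ _ (P u v w) hx).
Qed.

(** By invariance [Ad_(a^-1)] can be dropped. The relation [Phi Phi^s = 1] implies
    [Phi^s Phi = 1] since [Phi] has leading coefficient [1]. *)
Lemma Phi_series (phi : g ⊗ g ⊗ g) (Phi : nat -> U3) : connected [set: G] ->
  is_associator phi Phi -> forall a,
  hmul (anti_map3 (Ad_inv a) \o Phi) Phi = hcst 1.
Proof.
move=> cG hP a; have hB := Ad_inv_endo a.
have lU := uea_map_linear hB.1 hB.2; have ls := @antipode_linear _ _ br.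
pose s3 : U3 -> U3 := tmap (tmap (@antipode C g br) (@antipode C g br)) (@antipode C g br).
have ls2 := tmap_linear ls ls.
have E t : anti_map3 (Ad_inv a) t = s3 (B3 a t).
  move: t; apply: tensor3_ext.
  - exact: (anti_map3_linear hB.1 hB.2).
  - exact: (lin_comp (uea_map3_linear hB) (tmap_linear ls2 ls)).
  move=> u v w; apply: esym; apply: (etrans (congr1 s3 (uea_map3_pure hB u v w))).
  have lsB := anti_map_linear hB.1 hB.2.
  apply: (etrans (tmap_pure _ _ ls2 ls)); rewrite (tmap_pure _ _ ls ls).
  apply: esym; apply: (etrans (tmap_pure _ _ (tmap_linear lsB lsB) lsB)).
  by rewrite (tmap_pure _ _ lsB lsB).
have inv k X : diag3 br X * Phi k = Phi k * diag3 br X by exact: (assoc_invariant hP).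
have -> : anti_map3 (Ad_inv a) \o Phi = s3 \o Phi.
  by apply/funext => k /=; rewrite E (Ad_invariant B3_lin B3_unit B3_mul cG Ad_derivable_all (inv k)).
apply: hmul_inverse; first exact: (assoc_0 hP).
exact: (assoc_antipode hP).
Qed.

End AdInvariance.

(** * Submodules, and products of series *)

Section SubModule.
Variables (K : fieldType) (E : lmodType K).

(** Bundled with its closure properties, so that the structure of module on the
    subtype [submod] can be inferred. *)
Record submodule := SubModule {
  carrier :> E -> Prop;
  sub_0 : carrier 0;
  sub_lin : forall z x y, carrier x -> carrier y -> carrier (z *: x + y)
}.

Variable S : submodule.

Record submod := Submod { elt :> E; eltP : S elt }.

HB.instance Definition _ := gen_eqMixin submod.
HB.instance Definition _ := gen_choiceMixin submod.

Lemma elt_inj (x y : submod) : elt x = elt y -> x = y.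
Proof. by case: x y => x Sx [y Sy] /= E'; subst y; congr Submod; exact: Prop_irrelevance. Qed.

Lemma sub_D x y : S x -> S y -> S (x + y).
Proof. by move=> Sx Sy; have := sub_lin 1 Sx Sy; rewrite scale1r. Qed.
Lemma sub_Z z x : S x -> S (z *: x).
Proof. by move=> Sx; have := sub_lin z Sx (sub_0 S); rewrite addr0. Qed.
Lemma sub_sum (I : Type) (r : seq I) (F : I -> E) :
  (forall i, S (F i)) -> S (\sum_(i <- r) F i).
Proof. by move=> H; elim/big_rec: _ => [|i x _]; [exact: sub_0|exact: sub_D]. Qed.

Definition sm_add (x y : submod) := Submod (sub_D (eltP x) (eltP y)).
Definition sm_scale z (x : submod) := Submod (sub_Z z (eltP x)).
Definition sm_0 := Submod (sub_0 S).

Lemma sm_addA : associative sm_add.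
Proof. by move=> x y z; apply: elt_inj; exact: addrA. Qed.
Lemma sm_addC : commutative sm_add.
Proof. by move=> x y; apply: elt_inj; exact: addrC. Qed.
Lemma sm_add0 : left_id sm_0 sm_add.
Proof. by move=> x; apply: elt_inj; exact: add0r. Qed.
Lemma sm_addN : left_inverse sm_0 (sm_scale (-1)) sm_add.
Proof. by move=> x; apply: elt_inj; rewrite /= scaleN1r addNr. Qed.
HB.instance Definition _ := GRing.isZmodule.Build submod sm_addA sm_addC sm_add0 sm_addN.

Lemma sm_scaleA a b x : sm_scale a (sm_scale b x) = sm_scale (a * b) x.
Proof. by apply: elt_inj; exact: scalerA. Qed.
Lemma sm_scale1 : left_id 1 sm_scale.
Proof. by move=> x; apply: elt_inj; exact: scale1r. Qed.
Lemma sm_scaleDr : right_distributive sm_scale +%R.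
Proof. by move=> a x y; apply: elt_inj; exact: scalerDr. Qed.
Lemma sm_scaleDl x : {morph sm_scale^~ x : a b / a + b}.
Proof. by move=> a b; apply: elt_inj; exact: scalerDl. Qed.
HB.instance Definition _ := GRing.Zmodule_isLmodule.Build K submod
  sm_scaleA sm_scale1 sm_scaleDr sm_scaleDl.

Lemma elt_linear : linear (elt : submod -> E).
Proof. by []. Qed.
End SubModule.

Section StarSeries.
Variables (K : fieldType) (M : lmodType K) (m : nat -> M -> M -> M).

Definition seriesm (x y : nat -> M) : nat -> M :=
  fun N => S2 N (fun k j => S2 j (fun p q => m k (x p) (y q))).

Hypotheses (ml : forall k b, linear (fun a => m k a b)) (mr : forall k a, linear (m k a)).
Hypothesis mA : forall N a b c,
  S2 N (fun i j => m i (m j a b) c) = S2 N (fun i j => m i a (m j b c)).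

(** Both triple products are sums over five degrees, two for the products and
    three for the series; collecting the two degrees of the products gives the
    associativity assumption. *)
Lemma seriesmA x y z : seriesm (seriesm x y) z = seriesm x (seriesm y z).
Proof.
apply/funext => N; rewrite /seriesm.
transitivity (S2 N (fun l t => S2 t (fun s r => S2 s (fun p q =>
    S2 l (fun k i => m k (m i (x p) (y q)) (z r)))))).
  rewrite (eq_S2 (F' := fun k j => S2 j (fun s r => S2 s (fun i t => S2 t (fun p q =>
      m k (m i (x p) (y q)) (z r)))))); last first.
    move=> k j _; apply: eq_S2 => s r _.
    rewrite (S2_lin _ _ (ml k (z r))); apply: eq_S2 => i t _.
    exact: (S2_lin _ _ (ml k (z r))).
  rewrite (eq_S2 (F' := fun k j => S2 j (fun i t' => S2 t' (fun t r => S2 t (fun p q =>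
      m k (m i (x p) (y q)) (z r)))))); last first.
    by move=> k j _; exact: (S2A j (fun i t r => S2 t (fun p q => m k (m i (x p) (y q)) (z r)))).
  rewrite -(S2A N (fun k i t' => S2 t' (fun t r => S2 t (fun p q => m k (m i (x p) (y q)) (z r))))).
  apply: eq_S2 => l t _; rewrite /S2 exchange_big; apply: eq_bigr => s _ /=.
  by rewrite exchange_big.
transitivity (S2 N (fun l t => S2 t (fun p s => S2 s (fun q r =>
    S2 l (fun k i => m k (x p) (m i (y q) (z r))))))).
  apply: eq_S2 => l t _; rewrite S2A; apply: eq_S2 => p s _; apply: eq_S2 => q r _.
  exact: mA.
rewrite [RHS](eq_S2 (F' := fun k j => S2 j (fun p s => S2 s (fun i t => S2 t (fun q r =>
      m k (x p) (m i (y q) (z r))))))); last first.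
  move=> k j _; apply: eq_S2 => s r _.
  rewrite (S2_lin _ _ (mr k (x s))); apply: eq_S2 => i t _.
  exact: (S2_lin _ _ (mr k (x s))).
rewrite [RHS](eq_S2 (F' := fun k j => S2 j (fun i t' => S2 t' (fun p t => S2 t (fun q r =>
      m k (x p) (m i (y q) (z r))))))); last first.
  move=> k j _; rewrite -(S2A j (fun p i t => S2 t (fun q r => m k (x p) (m i (y q) (z r))))).
  rewrite -(S2A j (fun i p t => S2 t (fun q r => m k (x p) (m i (y q) (z r))))).
  by apply: eq_S2 => a b _; exact: S2C.
rewrite -(S2A N (fun k i t' => S2 t' (fun p t => S2 t (fun q r => m k (x p) (m i (y q) (z r)))))).
apply: eq_S2 => l t _; rewrite [RHS]/S2 exchange_big; apply: eq_bigr => p _ /=.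
by rewrite [RHS]exchange_big.
Qed.
End StarSeries.

(** * The twisted product on an invariant submodule *)

Section Naturality.
Variables (K : fieldType) (g : lmodType K) (br : g -> g -> g) (M M' : lmodType K).
Variables (mu : M -> M -> M) (L R : g -> M -> M).
Variables (mu' : M' -> M' -> M') (L' R' : g -> M' -> M').
Local Notation U := (uea br).
Local Notation U3 := ((U ⊗ U) ⊗ U)%type.
Variable rho : M -> M'.
Hypothesis rho_lin : linear rho.
Hypothesis rho_mu : forall a b, rho (mu a b) = mu' (rho a) (rho b).
Hypothesis rho_L : forall x a, rho (L x a) = L' x (rho a).
Hypothesis rho_R : forall x a, rho (R x a) = R' x (rho a).

Lemma uact_natural (D : g -> M -> M) (D' : g -> M' -> M') (u : U) a :
  (forall x b, rho (D x b) = D' x (rho b)) -> rho (uact D u a) = uact D' u (rho a).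
Proof.
move=> h; rewrite /uact (lin_sum rho_lin); apply: eq_bigr => p _.
by rewrite (linZ rho_lin); congr (_ *: _); elim: p.2 => //= x s <-; exact: h.
Qed.

Lemma tlift_natural (A B : lmodType K) (F : A -> B -> M) (F' : A -> B -> M') t :
  (forall a b, rho (F a b) = F' a b) -> rho (tlift F t) = tlift F' t.
Proof.
by move=> h; rewrite /tlift /tsum (lin_sum rho_lin); apply: eq_bigr => p _; exact: h.
Qed.

Lemma lr_natural u v a : rho (lr (br := br) L R u v a) = lr L' R' u v (rho a).
Proof. by rewrite /lr (uact_natural u _ rho_L) (uact_natural v _ rho_R). Qed.

Lemma hact_natural w a : rho (hact (br := br) L R w a) = hact L' R' w (rho a).
Proof. by apply: tlift_natural => u v; exact: lr_natural. Qed.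

Lemma P2_natural p q a b :
  rho (P2 (br := br) mu L R p q a b) = P2 mu' L' R' p q (rho a) (rho b).
Proof.
apply: tlift_natural => p1 p2; apply: tlift_natural => q1 q2.
by rewrite rho_mu !lr_natural.
Qed.

Lemma starm_natural (Phi : nat -> U3) (r1 r2 : g ⊗ g)
    (Q1 : quantum_group Phi r1) (Q2 : quantum_group Phi r2) N a b :
  rho (starm (br := br) mu L R Q1 Q2 N a b) =
  starm (br := br) mu' L' R' Q1 Q2 N (rho a) (rho b).
Proof.
by rewrite /starm /hconv (lin_sum rho_lin); apply: eq_bigr => i _; exact: P2_natural.
Qed.
End Naturality.

Section OnSubmodule.
Variables (K : fieldType) (g : lmodType K) (br : g -> g -> g).
Variables (E : lmodType K) (S : submodule E) (mu : E -> E -> E).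
Local Notation U := (uea br).
Local Notation U2 := (U ⊗ U)%type.
Local Notation U3 := (U2 ⊗ U)%type.
Local Notation H := (U ⊗ U)%type.

(** The same as [rep_by_derivations], with identities holding only on [S]: the
    operators restricted to an open set act on all functions extended by zero,
    but are a representation on sections only. *)
Record rep_on (rho : g -> E -> E) : Prop := {
  ro_closed : forall x m, S m -> S (rho x m);
  ro_linl : forall m z x y, S m -> rho (z *: x + y) m = z *: rho x m + rho y m;
  ro_linr : forall x z a b, S a -> S b -> rho x (z *: a + b) = z *: rho x a + rho x b;
  ro_rep : forall x y m, S m -> rho (br x y) m = rho x (rho y m) - rho y (rho x m);
  ro_der : forall x a b, S a -> S b -> rho x (mu a b) = mu (rho x a) b + mu a (rho x b)
}.

Variables (L R : g -> E -> E).
Hypotheses (S_mu : forall a b, S a -> S b -> S (mu a b)).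
Hypotheses (mu_linl : forall b z x y, mu (z *: x + y) b = z *: mu x b + mu y b).
Hypotheses (mu_linr : forall a z x y, mu a (z *: x + y) = z *: mu a x + mu a y).
Hypotheses (muA : forall a b c, mu (mu a b) c = mu a (mu b c)).
Hypotheses (LD : rep_on L) (RD : rep_on R).
Hypothesis LR : forall x y m, S m -> L x (R y m) = R y (L x m).

Local Notation M := (submod S).
Let muS (a b : M) : M := Submod (S_mu (eltP a) (eltP b)).
Let LS x (a : M) : M := Submod (ro_closed LD x (eltP a)).
Let RS x (a : M) : M := Submod (ro_closed RD x (eltP a)).

Let muS_linl b : linear (muS^~ b).
Proof. by move=> z x y; apply: elt_inj; exact: mu_linl. Qed.
Let muS_linr a : linear (muS a).
Proof. by move=> z x y; apply: elt_inj; exact: mu_linr. Qed.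
Let muSA a b c : muS (muS a b) c = muS a (muS b c).
Proof. by apply: elt_inj; exact: muA. Qed.
Let repS rho (h : rep_on rho) :
  rep_by_derivations br muS (fun x (a : M) => Submod (ro_closed h x (eltP a)) : M).
Proof.
split=> [m z x y|x z a b|x y m|x a b]; apply: elt_inj => /=.
- by apply: (ro_linl h); exact: eltP.
- by apply: (ro_linr h); exact: eltP.
- by rewrite scaleN1r; apply: (ro_rep h); exact: eltP.
- by apply: (ro_der h); exact: eltP.
Qed.
Let LSD := repS LD.
Let RSD := repS RD.
Let LRS x y m : LS x (RS y m) = RS y (LS x m).
Proof. by apply: elt_inj; apply: LR; exact: eltP. Qed.

Lemma elt_hact w a : elt (hact (br := br) LS RS w a) = hact L R w (elt a).
Proof. by apply: (hact_natural (@elt_linear _ _ S)). Qed.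

Variables (Phi : nat -> U3) (r1 r2 : g ⊗ g).
Variables (Q1 : quantum_group Phi r1) (Q2 : quantum_group Phi r2).

Local Notation starS := (starm (br := br) muS LS RS Q1 Q2).
Local Notation starE := (starm (br := br) mu L R Q1 Q2).

Lemma elt_starm N a b : elt (starS N a b) = starE N (elt a) (elt b).
Proof. by apply: (starm_natural (@elt_linear _ _ S)). Qed.

Lemma starm_closed N a b : S a -> S b -> S (starE N a b).
Proof.
by move=> Sa Sb; have := eltP (starS N (Submod Sa) (Submod Sb)); rewrite elt_starm.
Qed.

(** The star product is made of sums, of [mu] and of the two actions, and so is
    preserved by every linear map that preserves these; used for restriction
    to a smaller open set. *)
Lemma starm_on_natural (E' : lmodType K) (mu' : E' -> E' -> E') (L' R' : g -> E' -> E')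
    (rho : E -> E') : linear rho -> (forall a b, rho (mu a b) = mu' (rho a) (rho b)) ->
  (forall x a, S a -> rho (L x a) = L' x (rho a)) ->
  (forall x a, S a -> rho (R x a) = R' x (rho a)) ->
  forall N a b, S a -> S b ->
    rho (starE N a b) = starm (br := br) mu' L' R' Q1 Q2 N (rho a) (rho b).
Proof.
move=> rl rmu rL rR N a b Sa Sb.
rewrite -(elt_starm N (Submod Sa) (Submod Sb)).
apply: (starm_natural (rho := fun c : M => rho (elt c))) => [z x y|x y|x c|x c] /=.
- exact: rl.
- exact: rmu.
- by apply: rL; exact: eltP.
- by apply: rR; exact: eltP.
Qed.

Lemma starm_on_linl N z a a' b : S a -> S a' -> S b ->
  starE N (z *: a + a') b = z *: starE N a b + starE N a' b.
Proof.
move=> Sa Sa' Sb.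
have := congr1 (@elt _ _ S) (starm_lina muS_linl LSD RSD Q1 Q2 N (Submod Sb) z (Submod Sa) (Submod Sa')).
by rewrite [elt (_ *: _ + _)]/= !elt_starm.
Qed.

Lemma starm_on_linr N z a b b' : S a -> S b -> S b' ->
  starE N a (z *: b + b') = z *: starE N a b + starE N a b'.
Proof.
move=> Sa Sb Sb'.
have := congr1 (@elt _ _ S) (starm_linb muS_linr LSD RSD Q1 Q2 N (Submod Sa) z (Submod Sb) (Submod Sb')).
by rewrite [elt (_ *: _ + _)]/= !elt_starm.
Qed.

Lemma starm_on0 a b : S a -> S b -> starE 0 a b = mu a b.
Proof.
move=> Sa Sb.
have := congr1 (@elt _ _ S) (starm0 muS_linl muS_linr LSD RSD Q1 Q2 (Submod Sa) (Submod Sb)).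
by rewrite elt_starm.
Qed.

Lemma starm_on_cst k N b : S k -> S b -> (forall x, L x k = 0) -> (forall x, R x k = 0) ->
  (0 < N)%N -> starE N k b = 0 /\ starE N b k = 0.
Proof.
move=> Sk Sb Lk Rk N0.
have LSk x : LS x (Submod Sk) = 0 by apply: elt_inj; exact: Lk.
have RSk x : RS x (Submod Sk) = 0 by apply: elt_inj; exact: Rk.
have [h1 h2] := starm_cst muS_linl muS_linr LSD RSD Q1 Q2 LSk RSk (Submod Sb) N0.
by have := congr1 (@elt _ _ S) h1; have := congr1 (@elt _ _ S) h2; rewrite !elt_starm.
Qed.

Lemma starm_on_invariant (b : nat -> H) x y : S x -> S y ->
  hconv (hact L R) b (fun j => starE j x y) =
  hconv (fun (T : H ⊗ H) j =>
    tlift (fun b1 b2 => starE j (hact L R b1 x) (hact L R b2 y)) T)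
    (qcomul2 Q1 Q2 b) id.
Proof.
move=> Sx Sy; apply/funext => n.
have := congr1 (@elt _ _ S) (starm_invariant muS_linl muS_linr LSD RSD LRS Q1 Q2 b (Submod Sx) (Submod Sy) n).
rewrite /hconv !(lin_sum (@elt_linear _ _ S)) => h.
etransitivity; last (etransitivity; first exact: h).
  by apply: eq_bigr => i _; rewrite elt_hact elt_starm.
apply: eq_bigr => i _; apply: (tlift_natural (@elt_linear _ _ S)) => b1 b2.
by rewrite elt_starm !elt_hact.
Qed.

Lemma starm_on_assoc (I : Type) (e : I -> E -> K^o) (B : I -> g -> g) :
  (forall i, linear (e i)) ->
  (forall i a b, S a -> S b -> e i (mu a b) = e i a * e i b) ->
  (forall i, linear (B i)) -> (forall i x y, B i (br x y) = br (B i x) (B i y)) ->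
  (forall i x m, S m -> e i (L x m) = - e i (R (B i x) m)) ->
  (forall a b, S a -> S b -> (forall i, e i a = e i b) -> a = b) ->
  (forall i, hmul (anti_map3 (br := br) (B i) \o Phi) Phi = hcst 1) ->
  forall x y z : nat -> E, (forall i, S (x i)) -> (forall i, S (y i)) -> (forall i, S (z i)) ->
  seriesm starE (seriesm starE x y) z = seriesm starE x (seriesm starE y z).
Proof.
move=> e_lin eM B_lin B_br eLR e_sep HPhi x y z Sx Sy Sz.
have A := starm_assoc muS_linl muS_linr muSA LSD RSD LRS Q1 Q2
  (e := fun i (a : M) => e i (elt a)) (B := B).
have {}A : forall N a b c, S2 N (fun i j => starS i (starS j a b) c) =
    S2 N (fun i j => starS i a (starS j b c)).
  apply: A => //.
  - by move=> i c a b; exact: e_lin.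
  - by move=> i a b; exact: (eM _ _ _ (eltP a) (eltP b)).
  - by move=> i c m; exact: (eLR _ _ _ (eltP m)).
  - by move=> a b h; apply: elt_inj; exact: (e_sep _ _ (eltP a) (eltP b) h).
have := seriesmA (fun k b => starm_lina muS_linl LSD RSD Q1 Q2 k b)
  (fun k a => starm_linb muS_linr LSD RSD Q1 Q2 k a) A
  (fun i => Submod (Sx i)) (fun i => Submod (Sy i)) (fun i => Submod (Sz i)).
have eltS (a b : nat -> M) : (fun N => elt (seriesm starS a b N)) =
    seriesm starE (fun i => elt (a i)) (fun i => elt (b i)).
  apply/funext => N; rewrite /seriesm (S2_lin _ _ (@elt_linear _ _ S)).
  apply: eq_S2 => k j _; rewrite (S2_lin _ _ (@elt_linear _ _ S)).
  by apply: eq_S2 => p q _; exact: elt_starm.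
move=> /(congr1 (fun s : nat -> M => fun N => elt (s N))).
by rewrite !eltS.
Qed.

End OnSubmodule.

(** * Differential operators of bounded order *)

Section DiffOps.
Variables (R : realType) (G : complexLieGroup R).
Local Notation C := R[i].
Local Notation op := ((G -> C) -> G -> C).

Section OneModule.
Variable S : (G -> C) -> Prop.
Hypothesis S_mul : forall a f, S a -> S f -> S (fmul a f).

Lemma eq_diffop k (D D' : op) : (forall f, S f -> D f = D' f) ->
  diffop S k D -> diffop S k D'.
Proof.
elim: k D D' => [|k ih] D D' E H.
  by move=> a f Sa Sf; rewrite -!E ?H//; exact: S_mul.
move=> a Sa; apply: ih (H a Sa) => f Sf /=.
by rewrite !E//; exact: S_mul.
Qed.

Lemma diffop0 k : diffop S k (fun=> 0).
Proof.
elim: k => [|k ih] => [a f _ _|a Sa] /=.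
  by apply/funext => x; rewrite /fmul/= mulr0.
apply: eq_diffop ih => f _.
by apply/funext => x; rewrite /fmul !fctE mulr0 subr0.
Qed.

Lemma diffop_add k (D D' : op) : diffop S k D -> diffop S k D' ->
  diffop S k (fun f => D f + D' f).
Proof.
elim: k D D' => [|k ih] D D' H H'.
  move=> a f Sa Sf; rewrite H// H'//.
  by apply/funext => x; rewrite /fmul !fctE mulrDr.
move=> a Sa; apply: eq_diffop (ih _ _ (H a Sa) (H' a Sa)) => f _ /=.
by apply/funext => x; rewrite /fmul !fctE mulrDr opprD addrACA.
Qed.

Lemma diffop_mul k b (D : op) : diffop S k D -> diffop S k (fun f => fmul b (D f)).
Proof.
elim: k D => [|k ih] D H.
  move=> a f Sa Sf; rewrite H//.
  by apply/funext => x; rewrite /fmul mulrCA.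
move=> a Sa; apply: eq_diffop (ih _ (H a Sa)) => f _ /=.
by apply/funext => x; rewrite /fmul !fctE mulrBr; congr (_ - _); rewrite mulrCA.
Qed.

Lemma diffopS k (D : op) : diffop S k D -> diffop S k.+1 D.
Proof.
elim: k D => [|k ih] D H a Sa; last exact: (ih _ (H a Sa)).
apply: eq_diffop (diffop0 0) => f Sf; rewrite H//.
by rewrite subrr.
Qed.

Lemma diffop_le k l (D : op) : (k <= l)%N -> diffop S k D -> diffop S l D.
Proof.
move=> /subnKC <-; elim: (l - k)%N => [|m ih] H; first by rewrite addn0.
by rewrite addnS; apply: diffopS; exact: ih.
Qed.

Lemma diffop_id : diffop S 0 id.
Proof. by []. Qed.

Hypothesis S_sub : forall f k, S f -> S k -> S (f - k).
Variable X : op.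
Hypotheses (XS : forall f, S f -> S (X f))
  (XB : forall f k, S f -> S k -> X (f - k) = X f - X k)
  (XM : forall a f, S a -> S f -> X (fmul a f) = fmul (X a) f + fmul a (X f)).

(** [[X D, a] = X [D, a] + (X a) D], by the Leibniz rule; then induction on the
    order of [D]. *)
Lemma diffop_comp k (D : op) : (forall f, S f -> S (D f)) -> diffop S k D ->
  diffop S k.+1 (fun f => X (D f)).
Proof.
have E (a : G -> C) (D0 : op) : (forall f, S f -> S (D0 f)) -> S a -> forall f, S f ->
    X (D0 (fmul a f) - fmul a (D0 f)) + fmul (X a) (D0 f) =
    X (D0 (fmul a f)) - fmul a (X (D0 f)).
  move=> DS Sa f Sf; rewrite XB; [|exact: DS (S_mul _ _)|exact: S_mul (DS _ _)].
  rewrite XM//; last exact: DS.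
  by rewrite opprD addrA addrAC addrNK.
elim: k D => [|k ih] D DS H a Sa.
  refine (@eq_diffop 0 _ _ (E a D DS Sa) _).
  apply: diffop_add; last exact: diffop_mul.
  apply: eq_diffop (diffop0 0) => f Sf; rewrite H// subrr.
  have S0 : S 0 by have := S_sub Sf Sf; rewrite subrr.
  by have := XB S0 S0; rewrite !subrr => ->.
refine (@eq_diffop k.+1 _ _ (E a D DS Sa) _).
apply: diffop_add; last exact: diffop_mul.
apply: (ih (fun f => D (fmul a f) - fmul a (D f))); last exact: H.
by move=> f Sf; apply: S_sub; [exact: DS (S_mul _ _)|exact: S_mul (DS _ _)].
Qed.

End OneModule.

(* The order has to be bounded uniformly in the open set and in the section
   that parametrize an operator; these are the indices [i] below. *)
Section Uniform.
Variables (I : Type) (adm : I -> Prop) (S : I -> (G -> C) -> Prop).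
Hypothesis S_mul : forall i a f, adm i -> S i a -> S i f -> S i (fmul a f).

Definition bounded_order (D : I -> op) :=
  exists N, forall i, adm i -> diffop (S i) N (D i).

Lemma bounded_add D D' : bounded_order D -> bounded_order D' ->
  bounded_order (fun i f => D i f + D' i f).
Proof.
move=> [N H] [N' H']; exists (maxn N N') => i ai; have Sm := fun a f => @S_mul i a f ai.
apply: (diffop_add Sm).
- by apply: (diffop_le Sm) (H i ai); exact: leq_maxl.
- by apply: (diffop_le Sm) (H' i ai); exact: leq_maxr.
Qed.

Lemma bounded_mul D (b : I -> G -> C) : bounded_order D ->
  bounded_order (fun i f => fmul (b i) (D i f)).
Proof.
by move=> [N H]; exists N => i ai; apply: (diffop_mul (fun a f => @S_mul i a f ai)); exact: H.
Qed.

Lemma bounded_scale D (z : C) : bounded_order D ->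
  bounded_order (fun i f => z *: D i f).
Proof. exact: (bounded_mul (fun=> fun=> z)). Qed.

Lemma bounded_sum (J : Type) (r : seq J) (D : J -> I -> op) :
  (forall j, bounded_order (D j)) ->
  bounded_order (fun i f => \sum_(j <- r) D j i f).
Proof.
move=> H; elim: r => [|j r [N ih]].
  exists 0%N => i ai; apply: (eq_diffop (fun a f => @S_mul i a f ai)) (diffop0 (fun a f => @S_mul i a f ai) 0).
  by move=> f _; rewrite big_nil.
have [N' H'] := bounded_add (H j) (ex_intro _ N ih).
exists N' => i ai; apply: (eq_diffop (fun a f => @S_mul i a f ai)) (H' i ai).
by move=> f _; rewrite big_cons.
Qed.

Lemma eq_bounded D D' : (forall i f, adm i -> S i f -> D i f = D' i f) ->
  bounded_order D -> bounded_order D'.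
Proof.
move=> E [N H]; exists N => i ai.
by apply: (eq_diffop (fun a f => @S_mul i a f ai)) (H i ai) => f; exact: E.
Qed.

Hypothesis S_sub : forall i f k, adm i -> S i f -> S i k -> S i (f - k).

Lemma bounded_comp (X : I -> op) D :
  (forall i f, adm i -> S i f -> S i (X i f)) ->
  (forall i f k, adm i -> S i f -> S i k -> X i (f - k) = X i f - X i k) ->
  (forall i a f, adm i -> S i a -> S i f ->
     X i (fmul a f) = fmul (X i a) f + fmul a (X i f)) ->
  (forall i f, adm i -> S i f -> S i (D i f)) ->
  bounded_order D -> bounded_order (fun i f => X i (D i f)).
Proof.
move=> XS XB XM DS [N H]; exists N.+1 => i ai.
apply: (diffop_comp (fun a f => @S_mul i a f ai) (fun a f => @S_sub i a f ai)) => //.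
- by move=> f k; exact: XB.
- by move=> a f; exact: XM.
- by move=> f; exact: DS.
- exact: H.
Qed.

End Uniform.
End DiffOps.

(** * The two infinitesimal actions on sections *)

Section Fields.
Variables (R : realType) (G : complexLieGroup R).
Local Notation C := R[i].
Local Notation g := (lie_algebra G).
Local Notation br := (@lie_bracket R G).
Implicit Types (f k : G -> C) (V W : set G).

Lemma patch_eq V f k : (forall a, V a -> f a = k a) -> (forall a, ~ V a -> f a = k a) ->
  f = k.
Proof. by move=> h h'; apply/funext => a; have [Va|Va] := pselect (V a); [exact: h|exact: h']. Qed.

Lemma section_scale cls V (z : C) f : cls_open cls V -> section_on cls V f ->
  section_on cls V (z *: f).
Proof.
move=> hV hf.
suff -> : z *: f = (fun x => restr V (fun=> z) x * f x).
  exact: section_mul (section_cst z hV) hf.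
apply: (@patch_eq V) => a Va; first by rewrite restrT.
by rewrite restrC// mul0r fctE (section_out hf Va) scaler0.
Qed.

Lemma section_0 cls V : cls_open cls V -> section_on cls V 0.
Proof.
move=> hV; have -> : (0 : G -> C) = restr V (fun=> 0); last exact: section_cst.
by apply: (@patch_eq V) => a Va; [rewrite restrT|rewrite restrC].
Qed.

Lemma section_lin cls V : cls_open cls V -> forall (z : C) f k,
  section_on cls V f -> section_on cls V k -> section_on cls V (z *: f + k).
Proof. by move=> hV z f k hf hk; apply: (section_add hV (section_scale z hV hf) hk). Qed.

Definition sections cls V (hV : cls_open cls V) : submodule (G -> C) :=
  SubModule (section_0 hV) (section_lin hV).

(** Common form of [act_left], up to sign, and of [act_right]. *)
Definition vfield s V (X : g) f : G -> C := restr V (ifield s X f).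

Section OnOpen.
Variables (cls : function_class) (V : set G).
Hypothesis hV : cls_open cls V.
Local Notation S := (section_on cls V).

Lemma vfieldT s X f a : V a -> vfield s V X f a = ifield s X f a.
Proof. exact: restrT. Qed.

Lemma vfieldC s X f a : ~ V a -> vfield s V X f a = 0.
Proof. exact: restrC. Qed.

Lemma ifield_restr s X f a : V a -> ifield s X (restr V f) a = ifield s X f a.
Proof. by move=> Va; apply: ifield_near; exact: (restr_near f (cls_open_open hV) Va). Qed.

Lemma vfield_closed s X f : S f -> S (vfield s V X f).
Proof. exact: section_ifield. Qed.

Lemma vfield_linX s (z : C) X Y f : S f ->
  vfield s V (z *: X + Y) f = z *: vfield s V X f + vfield s V Y f.
Proof.
move=> Sf; apply: (@patch_eq V) => a Va; last first.
  by rewrite !fctE !vfieldC// scaler0 addr0.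
rewrite !fctE !vfieldT//; exact: (ifield_linX s z X Y (section_smooth hV Sf Va)).
Qed.

Lemma vfield_lin s X (z : C) f k : S f -> S k ->
  vfield s V X (z *: f + k) = z *: vfield s V X f + vfield s V X k.
Proof.
move=> Sf Sk; apply: (@patch_eq V) => a Va; last first.
  by rewrite !fctE !vfieldC// scaler0 addr0.
have hf := section_smooth hV Sf Va; have hk := section_smooth hV Sk Va.
have hz := germ_at_cst false z a.
rewrite !fctE !vfieldT//.
apply: (etrans (ifieldD s X (germ_atM hz hf) hk)).
by rewrite (ifieldM s X hz hf) ifield_cst mulr0 addr0.
Qed.

Lemma vfield_der s X f k : S f -> S k ->
  vfield s V X (fmul f k) = fmul (vfield s V X f) k + fmul f (vfield s V X k).
Proof.
move=> Sf Sk; apply: (@patch_eq V) => a Va; last first.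
  by rewrite fctE /fmul !vfieldC// mul0r mulr0 addr0.
have hf := section_smooth hV Sf Va; have hk := section_smooth hV Sk Va.
rewrite fctE /fmul !vfieldT//; apply: (etrans (ifieldM s X hf hk)).
by rewrite addrC; congr (_ + _); rewrite mulrC.
Qed.

Lemma vfield_vfield s s' X Y f a : V a ->
  vfield s V X (vfield s' V Y f) a = ifield s X (ifield s' Y f) a.
Proof. by move=> Va; rewrite vfieldT// ifield_restr. Qed.

Lemma act_rightE X f : act_right V X f = vfield true V X f.
Proof. by rewrite /act_right left_ifield. Qed.

Lemma right_rep : rep_on br (sections hV) (@fmul R G) (act_right V).
Proof.
split=> [X f Sf|f z X Y Sf|X z f k Sf Sk|X Y f Sf|X f k Sf Sk].
- by rewrite act_rightE; apply: vfield_closed.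
- by rewrite !act_rightE; apply: vfield_linX.
- by rewrite !act_rightE; apply: vfield_lin.
- rewrite !act_rightE; apply: (@patch_eq V) => a Va; last by rewrite !fctE !vfieldC// subr0.
  rewrite !fctE; apply: (etrans (vfieldT true _ _ Va)).
  apply: (etrans (left_bracket X Y (section_smooth hV Sf Va))).
  by rewrite (vfield_vfield true true X Y f Va) (vfield_vfield true true Y X f Va).
- by rewrite !act_rightE; apply: vfield_der.
Qed.

Lemma act_leftE X f : act_left V X f = - vfield false V X f.
Proof.
apply: (@patch_eq V) => a Va; first by rewrite /act_left right_ifield restrT// fctE vfieldT.
by rewrite /act_left restrC// fctE vfieldC// oppr0.
Qed.

Lemma vfieldN s X f : S f -> vfield s V X (- f) = - vfield s V X f.
Proof.
move=> Sf; have := vfield_lin s X (-1) Sf (section_0 hV).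
have := vfield_lin s X (-1) (section_0 hV) (section_0 hV).
by rewrite scaler0 addr0 !scaleN1r addNr addr0 => ->; rewrite addr0.
Qed.

Lemma act_left_left X Y f : S f ->
  act_left V X (act_left V Y f) = vfield false V X (vfield false V Y f).
Proof.
move=> Sf; rewrite (act_leftE X) (act_leftE Y).
rewrite (vfieldN false X (vfield_closed false Y Sf)); exact: opprK.
Qed.

(** The bracket of right invariant fields has the opposite sign
    ([right_bracket]), which the sign in [act_left] corrects. *)
Lemma left_rep : rep_on br (sections hV) (@fmul R G) (act_left V).
Proof.
split=> [X f Sf|f z X Y Sf|X z f k Sf Sk|X Y f Sf|X f k Sf Sk].
- rewrite act_leftE -scaleN1r; exact: (section_scale (-1) hV (vfield_closed false X Sf)).
- rewrite !act_leftE (vfield_linX false z X Y Sf).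
  by apply: (etrans (opprD _ _)); rewrite scalerN.
- rewrite !act_leftE (vfield_lin false X z Sf Sk).
  by apply: (etrans (opprD _ _)); rewrite scalerN.
- rewrite (act_left_left X Y Sf) (act_left_left Y X Sf) (act_leftE (br X Y)).
  apply: (@patch_eq V) => a Va.
    apply: (etrans (congr1 -%R (vfieldT false _ _ Va))).
    apply: (etrans (congr1 -%R (right_bracket X Y (section_smooth hV Sf Va)))).
    rewrite opprK; apply: esym; apply: (congr2 (fun x y => x - y)).
      exact: (vfield_vfield false false X Y f Va).
    exact: (vfield_vfield false false Y X f Va).
  apply: (etrans (congr1 -%R (vfieldC false _ _ Va))); rewrite oppr0.
  by apply: esym; apply: (etrans (congr2 (fun x y => x - y)
    (vfieldC false X _ Va) (vfieldC false Y _ Va))); exact: subr0.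
- rewrite !act_leftE (vfield_der false X Sf Sk); apply/funext => a.
  by rewrite /fmul !fctE opprD mulNr mulrN.
Qed.

Lemma act_comm X Y f : S f -> act_left V X (act_right V Y f) = act_right V Y (act_left V X f).
Proof.
move=> Sf; rewrite (act_rightE Y f) (act_leftE X) (act_leftE X f) (act_rightE Y).
rewrite (vfieldN true Y (vfield_closed false X Sf)).
apply: (congr1 -%R); apply: (@patch_eq V) => a Va; last first.
  by rewrite (vfieldC false X _ Va) (vfieldC true Y _ Va).
rewrite (vfield_vfield false true X Y f Va) (vfield_vfield true false Y X f Va).
by apply: esym; exact: (ifield_comm Y X (section_smooth hV Sf Va)).
Qed.

Lemma act_left_right X f a : V a -> S f ->
  act_left V X f a = - act_right V (Adv a^-1%g X) f a.
Proof.
move=> Va Sf; rewrite act_leftE act_rightE fctE (vfieldT false X f Va) (vfieldT true _ f Va).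
apply: (congr1 -%R); exact: (right_leftE X (section_smooth hV Sf Va)).
Qed.

Lemma vfield_cst s X (z : C) : vfield s V X (restr V (fun=> z)) = 0.
Proof.
apply: (@patch_eq V) => a Va; last by rewrite vfieldC.
by rewrite vfieldT// ifield_restr// ifield_cst.
Qed.

End OnOpen.

Lemma restr_linear W : linear (restr W : (G -> C) -> G -> C).
Proof.
move=> z f k; apply: (@patch_eq W) => a Wa; rewrite !fctE.
  by rewrite !restrT.
by rewrite !restrC// scaler0 addr0.
Qed.

Lemma restr_fmul W f k : restr W (fmul f k) = fmul (restr W f) (restr W k).
Proof.
apply: (@patch_eq W) => a Wa; rewrite /fmul; first by rewrite !restrT.
by rewrite !restrC// mul0r.
Qed.

Lemma restr_vfield cls V W s X f : cls_open cls W -> W `<=` V ->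
  restr W (vfield s V X f) = vfield s W X (restr W f).
Proof.
move=> hW WV; apply: (@patch_eq W) => a Wa; last by rewrite restrC// vfieldC.
by rewrite restrT// !vfieldT ?(ifield_restr hW)//; exact: WV.
Qed.

Lemma restr_act_left cls V W X f : cls_open cls W -> W `<=` V ->
  restr W (act_left V X f) = act_left W X (restr W f).
Proof.
move=> hW WV; rewrite (act_leftE V X f) (act_leftE W X (restr W f)).
rewrite -(restr_vfield false X f hW WV).
exact: (linN (@restr_linear W) (vfield false V X f)).
Qed.

Lemma restr_act_right cls V W X f : cls_open cls W -> W `<=` V ->
  restr W (act_right V X f) = act_right W X (restr W f).
Proof.
move=> hW WV; rewrite (act_rightE V X f) (act_rightE W X (restr W f)).
exact: (restr_vfield true X f hW WV).
Qed.

End Fields.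

(** * The invariant quantization *)

Section Order.
Variables (R : realType) (G : complexLieGroup R).
Local Notation C := R[i].
Local Notation g := (lie_algebra G).
Local Notation br := (@lie_bracket R G).
Local Notation U := (uea br).
Local Notation U2 := (U ⊗ U)%type.
Local Notation op := ((G -> C) -> G -> C).
Variables (cls : function_class).

Local Notation Idx := (set G * (G -> C))%type.
Definition admissible (i : Idx) := cls_open cls i.1 /\ section_on cls i.1 i.2.
Definition isec (i : Idx) : (G -> C) -> Prop := section_on cls i.1.
Local Notation bdd := (bounded_order admissible isec).

Lemma isec_mul i a f : admissible i -> isec i a -> isec i f -> isec i (fmul a f).
Proof. by move=> [hV _]; exact: section_mul. Qed.

Lemma isec_sub i a f : admissible i -> isec i a -> isec i f -> isec i (a - f).
Proof.
move=> [hV _] ha hf; rewrite -scaleN1r addrC; exact: section_lin.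
Qed.

Lemma fmulC (f k : G -> C) : fmul f k = fmul k f.
Proof. by apply/funext => x; rewrite /fmul mulrC. Qed.

Section Act.
Variable rho : set G -> g -> (G -> C) -> G -> C.
Hypothesis rhoP : forall V (hV : cls_open cls V), rep_on br (sections hV) (@fmul R G) (rho V).

Lemma foldr_closed V (hV : cls_open cls V) f s : section_on cls V f ->
  section_on cls V (foldr (rho V) f s).
Proof. by move=> Sf; elim: s => //= X s ih; exact: (ro_closed (rhoP hV)). Qed.

Lemma uact_closed V (hV : cls_open cls V) (u : U) f : section_on cls V f ->
  section_on cls V (uact (rho V) u f).
Proof.
move=> Sf; apply: (@sub_sum _ _ (sections hV)) => p.
exact: (section_scale p.1 hV (foldr_closed hV p.2 Sf)).
Qed.

(** A word of length [l] raises the order by at most [l]; the words that occur in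
    a representative of [u] are finitely many and do not depend on the open
    set. *)
Lemma bounded_uact (D : Idx -> op) (u : U) :
  (forall i f, admissible i -> isec i f -> isec i (D i f)) -> bdd D ->
  bdd (fun i f => uact (rho i.1) u (D i f)).
Proof.
move=> DS bD; apply: (bounded_sum isec_mul) => p; apply: (bounded_scale isec_mul).
elim: p.2 => [//|X s ih] /=.
apply: (bounded_comp isec_mul isec_sub (X := fun i => rho i.1 X)) ih.
- by move=> i f [hV _]; exact: (ro_closed (rhoP hV)).
- move=> i f k [hV _] Sf Sk; have := ro_linr (rhoP hV) X (-1) Sk Sf.
  by rewrite !scaleN1r addrC => ->; rewrite addrC.
- by move=> i a f [hV _] Sa Sf; exact: (ro_der (rhoP hV) X Sa Sf).
by move=> i f ai Sf; have [hV _] := ai; apply: (foldr_closed hV); exact: DS.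
Qed.
End Act.

Lemma bounded_lr (u v : U) :
  bdd (fun i f => lr (br := br) (act_left i.1) (act_right i.1) u v f).
Proof.
apply: (bounded_uact (@left_rep R G cls)).
  by move=> i f [hV _]; exact: (uact_closed (@right_rep R G cls)).
apply: (bounded_uact (@right_rep R G cls)) => //.
by exists 0%N => i _; exact: diffop_id.
Qed.

Variables (r1 r2 : g ⊗ g) (Phi : nat -> (U2 ⊗ U)%type).
Variables (Q1 : quantum_group Phi r1) (Q2 : quantum_group Phi r2).
Local Notation m N V := (starm (br := br) (@fmul R G) (act_left V) (act_right V) Q1 Q2 N).

Lemma bounded_starr N : bdd (fun i => m N i.1 i.2).
Proof.
apply: (bounded_sum isec_mul) => j.
apply: (bounded_sum isec_mul) => p; apply: (bounded_sum isec_mul) => q.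
by apply: (bounded_mul isec_mul); exact: bounded_lr.
Qed.

Lemma bounded_starl N : bdd (fun i f => m N i.1 f i.2).
Proof.
apply: (bounded_sum isec_mul) => j.
apply: (bounded_sum isec_mul) => p; apply: (bounded_sum isec_mul) => q.
pose b (i : Idx) := lr (br := br) (act_left i.1) (act_right i.1) p.2 q.2 i.2.
apply: eq_bounded (bounded_mul isec_mul b (bounded_lr p.1 q.1)) => [|i f _ _].
  exact: isec_mul.
exact: fmulC.
Qed.

End Order.

Section Quantization.
Variables (R : realType) (G : complexLieGroup R).
Local Notation C := R[i].
Local Notation g := (lie_algebra G).
Local Notation br := (@lie_bracket R G).
Local Notation U := (uea br).
Local Notation U2 := (U ⊗ U)%type.

Lemma fmul_linl (b : G -> C) (z : C) x y : fmul (z *: x + y) b = z *: fmul x b + fmul y b.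
Proof. by apply/funext => a; rewrite /fmul !fctE mulrDl -scalerAl. Qed.

Lemma fmul_linr (b : G -> C) (z : C) x y : fmul b (z *: x + y) = z *: fmul b x + fmul b y.
Proof. by rewrite fmulC fmul_linl !(fmulC b). Qed.

Lemma fmulA (a b c : G -> C) : fmul (fmul a b) c = fmul a (fmul b c).
Proof. by apply/funext => x; rewrite /fmul mulrA. Qed.

Lemma act_right_cst cls (V : set G) (hV : cls_open cls V) X (z : C) :
  act_right V X (restr V (fun=> z)) = 0.
Proof. rewrite act_rightE; exact: (vfield_cst hV). Qed.

Lemma act_left_cst cls (V : set G) (hV : cls_open cls V) X (z : C) :
  act_left V X (restr V (fun=> z)) = 0.
Proof. rewrite act_leftE (vfield_cst hV); exact: oppr0. Qed.

Variables (r1 r2 : g ⊗ g) (Phi : nat -> (U2 ⊗ U)%type).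
Variables (Q1 : quantum_group Phi r1) (Q2 : quantum_group Phi r2).

Definition mstar N (V : set G) : (G -> C) -> (G -> C) -> G -> C :=
  starm (br := br) (@fmul R G) (act_left V) (act_right V) Q1 Q2 N.

Variable cls : function_class.

Lemma sections_mul (V : set G) (hV : cls_open cls V) (a b : G -> C) :
  sections hV a -> sections hV b -> sections hV (fmul a b).
Proof. exact: section_mul. Qed.

Lemma mstar_sheaf N : bilinear_sheaf_op cls (mstar N).
Proof.
split=> [V f k hV Sf Sk|V W f k hV hW WV Sf Sk|V f f' k z hV Sf Sf' Sk|V f k k' z hV Sf Sk Sk'].
- exact: (starm_closed (S := sections hV) (sections_mul (hV := hV)) (left_rep hV) (right_rep hV) Q1 Q2 N Sf Sk).
- apply: (starm_on_natural (S := sections hV) (sections_mul (hV := hV)) (left_rep hV) (right_rep hV) Q1 Q2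
    (restr_linear W) (@restr_fmul R G W)) => // X a _.
    exact: (restr_act_left X a hW WV).
  exact: (restr_act_right X a hW WV).
- exact: (starm_on_linl (S := sections hV) (sections_mul (hV := hV)) fmul_linl (left_rep hV) (right_rep hV) Q1 Q2 N z Sf Sf' Sk).
- exact: (starm_on_linr (S := sections hV) (sections_mul (hV := hV)) fmul_linr (left_rep hV) (right_rep hV) Q1 Q2 N z Sf Sk Sk').
Qed.

Lemma mstar_bidifferential N : bidifferential cls (mstar N).
Proof.
split; first exact: mstar_sheaf.
have [n1 H1] := bounded_starr cls Q1 Q2 N; have [n2 H2] := bounded_starl cls Q1 Q2 N.
exists (maxn n1 n2) => V hV f Sf; have ai : admissible cls (V, f) by split.
have Sm := fun a k => @isec_mul R G cls (V, f) a k ai.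
split.
- exact: (diffop_le Sm (leq_maxl _ _) (H1 _ ai)).
- exact: (diffop_le Sm (leq_maxr _ _) (H2 _ ai)).
Qed.

(** The points of [V] play the role of the evaluations [e], and the endomorphism
    of the Lie algebra attached to a point [a] is [Ad_(a^-1)]. *)
Lemma mstar_assoc (phi : g ⊗ g ⊗ g) V (hV : cls_open cls V) (x y z : nat -> G -> C) :
  connected [set: G] -> is_associator phi Phi ->
  (forall i, section_on cls V (x i)) -> (forall i, section_on cls V (y i)) ->
  (forall i, section_on cls V (z i)) ->
  star (fun N => mstar N V) (star (fun N => mstar N V) x y) z =
  star (fun N => mstar N V) x (star (fun N => mstar N V) y z).
Proof.
move=> cG hP Sx Sy Sz.
pose I := {a : G | V a}.
pose e (i : I) (f : G -> C) : C^o := f (sval i).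
pose B (i : I) (X : g) : g := Ad_inv (sval i) X.
apply: (starm_on_assoc (S := sections hV) (sections_mul (hV := hV)) fmul_linl fmul_linr
  fmulA (left_rep hV) (right_rep hV) (act_comm hV) Q1 Q2 (e := e) (B := B)
  _ _ _ _ _ _ _ Sx Sy Sz) => //.
- by move=> i; exact: (Ad_inv_endo (sval i)).1.
- by move=> i; exact: (Ad_inv_endo (sval i)).2.
- by move=> [a Va] X f Sf; exact: (act_left_right hV X Va Sf).
- move=> f k Sf Sk H; apply: (@patch_eq R G V) => a Va.
    exact: (H (exist _ a Va)).
  by rewrite (section_out Sf Va) (section_out Sk Va).
- by move=> i; exact: (Phi_series cG hP).
Qed.

End Quantization.

Theorem proposition5p1 (R : realType) (G : complexLieGroup R)
  (G_connected : connected [set: G])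
  (G_semisimple : semisimple G)
  (cls : function_class)
  (r1 r2 : lie_algebra G ⊗ lie_algebra G)
  (r1_rmatrix : classical_rmatrix (@lie_bracket R G) r1)
  (r2_rmatrix : classical_rmatrix (@lie_bracket R G) r2)
  (phi : lie_algebra G ⊗ lie_algebra G ⊗ lie_algebra G)
  (r1_phi : schouten (@lie_bracket R G) r1 = phi)
  (r2_phi : schouten (@lie_bracket R G) r2 = phi)
  (Phi : nat -> uea (@lie_bracket R G) ⊗ uea (@lie_bracket R G)
                  ⊗ uea (@lie_bracket R G))
  (Phi_associator : is_associator phi Phi)
  (Q1 : quantum_group Phi r1) (Q2 : quantum_group Phi r2) :
  exists m : nat -> set G -> (G -> R[i]) -> (G -> R[i]) -> G -> R[i],
    invariant_quantization cls Q1 Q2 m.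
Proof.
exists (mstar Q1 Q2); split.
- move=> V f k hV Sf Sk.
  exact: (starm_on0 (S := sections hV) (sections_mul (hV := hV)) (@fmul_linl R G)
    (@fmul_linr R G) (left_rep hV) (right_rep hV) Q1 Q2 Sf Sk).
- by move=> N _; exact: mstar_bidifferential.
- move=> N V f z N0 hV Sf.
  exact: (starm_on_cst (S := sections hV) (sections_mul (hV := hV)) (@fmul_linl R G)
    (@fmul_linr R G) (left_rep hV) (right_rep hV) Q1 Q2 (section_cst z hV) Sf
    (fun X => act_left_cst hV X z) (fun X => act_right_cst hV X z) N0).
- move=> V x y z hV Sx Sy Sz.
  exact: (mstar_assoc Q1 Q2 hV G_connected Phi_associator Sx Sy Sz).
- move=> V b x y hV Sx Sy.
  exact: (starm_on_invariant (S := sections hV) (sections_mul (hV := hV)) (@fmul_linl R G)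
    (@fmul_linr R G) (left_rep hV) (right_rep hV) (act_comm hV) Q1 Q2 b Sx Sy).
Qed.
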